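(* Let $n\geq 3$ and $k\ge 0$ be integers and let $p:M'\rightarrow M$ be a universal covering of connected manifolds whose deck transformation group is the finitely generated abelian group $\mathbb{Z}^k$. Suppose that (i) any group action of $\mathrm{SL}_n(\mathbb{Z})$ on $M'$ by homeomorphisms (resp. diffeomorphisms, PL homeomorphisms) is trivial; (ii) $k\leq n-1$. Then any group action of $\mathrm{SL}_n(\mathbb{Z})$ on $M$ by homeomorphisms (resp. diffeomorphisms, PL homeomorphisms) is trivial.
   Context: When actions by diffeomorphisms (resp. piecewise linear (PL) homeomorphisms) are considered, the manifolds are assumed to be smooth (resp. piecewise linear), with $M'$ carrying the structure lifted from $M$. A group action is trivial if every group element acts as the identity map. *)

(* Defs.v *)
From HB Require Import structures.
From mathcomp Require Import all_boot all_order all_algebra all_fingroup.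
From mathcomp Require Import all_classical all_reals all_analysis.

Set Implicit Arguments.
Unset Strict Implicit.
Unset Printing Implicit Defensive.

Import Order.TTheory GRing.Theory Num.Theory.
Import numFieldNormedType.Exports.

Local Open Scope classical_set_scope.
Local Open Scope ring_scope.

(* The special linear group SL_n(Z). *)

Record SLZ (n : nat) := MkSLZ { SLZval :> 'M[int]_n; _ : \det SLZval == 1 }.

HB.instance Definition _ (n : nat) := [isSub for @SLZval n].
HB.instance Definition _ (n : nat) := [Choice of SLZ n by <:].

Section SLZ_group.
Variable n : nat.
Implicit Types A B C : SLZ n.

Lemma SLZ_det A : \det (SLZval A) = 1.
Proof. by case: A => A /= /eqP. Qed.

Fact SLZ_one_subproof : \det (1%:M : 'M[int]_n) == 1.
Proof. by rewrite det1. Qed.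

Fact SLZ_mul_subproof A B : \det (SLZval A *m SLZval B) == 1.
Proof. by rewrite det_mulmx !SLZ_det mulr1. Qed.

Fact SLZ_inv_subproof A : \det (\adj (SLZval A)) == 1.
Proof.
have := congr1 determinant (mul_mx_adj (SLZval A)).
by rewrite det_mulmx SLZ_det mul1r det1 => ->.
Qed.

Definition SLZ_one := MkSLZ SLZ_one_subproof.
Definition SLZ_mul A B := MkSLZ (SLZ_mul_subproof A B).
(* det A = 1, so the adjugate of A is its inverse. *)
Definition SLZ_inv A := MkSLZ (SLZ_inv_subproof A).

Fact SLZ_mulA : associative SLZ_mul.
Proof. by move=> A B C; apply: val_inj; rewrite /= mulmxA. Qed.

Fact SLZ_mul1 : left_id SLZ_one SLZ_mul.
Proof. by move=> A; apply: val_inj; rewrite /= mul1mx. Qed.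

Fact SLZ_mulr1 : right_id SLZ_one SLZ_mul.
Proof. by move=> A; apply: val_inj; rewrite /= mulmx1. Qed.

Fact SLZ_mulV : left_inverse SLZ_one SLZ_inv SLZ_mul.
Proof. by move=> A; apply: val_inj; rewrite /= mul_adj_mx SLZ_det. Qed.

Fact SLZ_mulrV : right_inverse SLZ_one SLZ_inv SLZ_mul.
Proof. by move=> A; apply: val_inj; rewrite /= mul_mx_adj SLZ_det. Qed.

End SLZ_group.

HB.instance Definition _ (n : nat) := isGroup.Build (SLZ n)
  (@SLZ_mulA n) (@SLZ_mul1 n) (@SLZ_mulr1 n) (@SLZ_mulV n) (@SLZ_mulrV n).

Definition group_action (G : groupType) (X : Type) (rho : G -> X -> X) : Prop :=
  (forall x, rho 1%g x = x) /\
  (forall g h x, rho (g * h)%g x = rho g (rho h x)).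

Definition trivial_action (G : groupType) (X : Type) (rho : G -> X -> X) : Prop :=
  forall g x, rho g x = x.

Definition homeo_on (X Y : topologicalType) (U : set X) (V : set Y)
    (f : X -> Y) : Prop :=
  exists g : Y -> X,
    [/\ set_fun U V f, set_fun V U g,
        {in U, cancel f g}, {in V, cancel g f} &
        {within U, continuous f} /\ {within V, continuous g}].

Definition homeomorphism (X Y : topologicalType) (f : X -> Y) : Prop :=
  exists g : Y -> X, [/\ cancel f g, cancel g f, continuous f & continuous g].

Section covering_spaces.
Variables (R : realType) (X Y : topologicalType).

Definition evenly_covered (p : X -> Y) (U : set Y) : Prop :=
  exists S : set (set X),
    [/\ forall V, S V -> open V,
        forall V W, S V -> S W -> V `&` W !=set0 -> V = W,
        \bigcup_(V in S) V = p @^-1` U &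
        forall V, S V -> homeo_on V U p].

Definition covering_map (p : X -> Y) : Prop :=
  [/\ continuous p, range p = setT &
      forall y, exists U, [/\ open U, U y & evenly_covered p U]].

(* Paths and loops are functions on R of which only the values on [0, 1]
   matter. *)
Definition path_connected : Prop :=
  forall x y : X, exists g : R -> X,
    [/\ {within `[0, 1], continuous g}, g 0 = x & g 1 = y].

Definition null_homotopic (g : R -> X) : Prop :=
  exists H : R * R -> X,
    [/\ {within `[0, 1] `*` `[0, 1], continuous H},
        forall s, s \in `[0, 1] -> H (s, 0) = g s,
        forall s, s \in `[0, 1] -> H (s, 1) = g 0 &
        forall t, t \in `[0, 1] -> H (0, t) = g 0 /\ H (1, t) = g 0].

Definition simply_connected : Prop :=
  [/\ [set: X] !=set0, path_connected &
      forall g : R -> X,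
        {within `[0, 1], continuous g} -> g 0 = g 1 -> null_homotopic g].

Definition universal_covering (p : X -> Y) : Prop :=
  covering_map p /\ simply_connected.

Definition deck_transformation (p : X -> Y) : set (X -> X) :=
  [set d | homeomorphism d /\ p \o d = p].

Definition deck_group_is_Zk (p : X -> Y) (k : nat) : Prop :=
  exists phi : 'rV[int]_k -> X -> X,
    [/\ injective phi, range phi = deck_transformation p &
        forall a b, phi (a + b) = phi a \o phi b].

End covering_spaces.

Variant category := TOP | DIFF | PL.

Section local_maps.
Variables (R : realType) (m : nat).
Notation E := 'rV[R]_m.

Definition continuous_on (W : set E) (t : E -> E) : Prop :=
  forall x, W x -> {for x, continuous t}.

Fixpoint Ck_on (j : nat) (W : set E) (t : E -> E) : Prop :=
  continuous_on W t /\
  if j is j'.+1 then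
    forall i : 'I_m,
      (forall x, W x -> derivable t x (delta_mx 0 i)) /\
      Ck_on j' W ('D_(delta_mx 0 i) t)
  else True.

Definition smooth_on (W : set E) (t : E -> E) : Prop := forall j, Ck_on j W t.

(* The pair (a, b) stands for the closed half-space { y | <y, a> <= b }. *)
Definition polyhedron (s : seq ('cV[R]_m * R)) : set E :=
  [set y | forall h, h \in s -> (y *m h.1) 0 0 <= h.2].

(* (s, L, c) is the affine map y |-> yL + c on the polyhedron of s. *)
Definition pl_on (W : set E) (t : E -> E) : Prop :=
  continuous_on W t /\
  forall x, W x ->
    exists pieces : seq (seq ('cV[R]_m * R) * 'M[R]_m * E),
      nbhs x (\bigcup_(P in [set` pieces]) polyhedron P.1.1) /\
      forall P, P \in pieces ->
        forall y, W y -> polyhedron P.1.1 y -> t y = y *m P.1.2 + P.2.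

(* Only meant for open W. *)
Definition regular_on (C : category) (W : set E) (t : E -> E) : Prop :=
  match C with
  | TOP => continuous_on W t
  | DIFF => smooth_on W t
  | PL => pl_on W t
  end.

End local_maps.

(* A chart is a pair (U, phi); phi is total but only its values on U matter. *)
Definition chart (R : realType) (m : nat) (M : Type) : Type :=
  (set M * (M -> 'rV[R]_m))%type.

Section manifolds.
Variables (R : realType) (m : nat) (C : category).

Definition is_chart (M : topologicalType) (c : chart R m M) : Prop :=
  [/\ open c.1, open (c.2 @` c.1) & homeo_on c.1 (c.2 @` c.1) c.2].

(* The coordinate expression d o f o c^-1 of f, defined on
   c (dom c `&` f^-1 (dom d)), is a map of class C. *)
Definition regular_in_charts (M N : topologicalType)
    (c : chart R m M) (d : chart R m N) (f : M -> N) : Prop :=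
  let D := c.1 `&` f @^-1` d.1 in
  exists t : 'rV[R]_m -> 'rV[R]_m,
    regular_on C (c.2 @` D) t /\ forall x, D x -> t (c.2 x) = d.2 (f x).

Definition is_atlas (M : topologicalType) (A : set (chart R m M)) : Prop :=
  [/\ forall c, A c -> is_chart c,
      forall x, exists2 c, A c & c.1 x &
      forall c d, A c -> A d -> regular_in_charts c d idfun].

Definition is_manifold (M : topologicalType) (A : set (chart R m M)) : Prop :=
  [/\ hausdorff_space M, @second_countable M & is_atlas A].

Definition morphism_of_class (M N : topologicalType)
    (A : set (chart R m M)) (B : set (chart R m N)) (f : M -> N) : Prop :=
  continuous f /\ forall c d, A c -> B d -> regular_in_charts c d f.

(* Homeomorphisms, diffeomorphisms or PL homeomorphisms of M, according to C. *)
Definition automorphism (M : topologicalType) (A : set (chart R m M))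
    (f : M -> M) : Prop :=
  exists g : M -> M,
    [/\ cancel f g, cancel g f,
        morphism_of_class A A f & morphism_of_class A A g].

Definition action_by_automorphisms (G : groupType) (M : topologicalType)
    (A : set (chart R m M)) (rho : G -> M -> M) : Prop :=
  group_action rho /\ forall g, automorphism A (rho g).

(* Charts (V, phi o p) with p mapping the open set V homeomorphically onto an
   open subset of the domain of a chart phi of the base. *)
Definition lifted_atlas (M' M : topologicalType) (p : M' -> M)
    (A : set (chart R m M)) : set (chart R m M') :=
  [set c' | [/\ open c'.1, open (p @` c'.1), homeo_on c'.1 (p @` c'.1) p &
    exists c, [/\ A c, p @` c'.1 `<=` c.1 & c'.2 = c.2 \o p]]].

End manifolds.

(* Coherence facts: the lifted atlas is an atlas, and for the class TOP the
   automorphisms are exactly the homeomorphisms. *)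
Lemma homeo_on_openP (X Y : topologicalType) (U : set X) (V : set Y) f :
  open U -> open V ->
  homeo_on U V f <->
  exists g, (forall x, U x -> [/\ V (f x), g (f x) = x & {for x, continuous f}]) /\
    (forall y, V y -> [/\ U (g y), f (g y) = y & {for y, continuous g}]).
Proof.
move=> oU oV; split=> -[g].
  case=> sf sg fK gK []; rewrite !continuous_open_subspace// => cf cg.
  exists g; split=> x Ux; split.
  - exact: sf.
  - by apply: fK; rewrite inE.
  - by apply: cf; rewrite inE.
  - exact: sg.
  - by apply: gK; rewrite inE.
  - by apply: cg; rewrite inE.
move=> [h1 h2]; exists g; split.
- by move=> x /h1[].
- by move=> x /h2[].
- by move=> x; rewrite inE => /h1[].
- by move=> x; rewrite inE => /h2[].
- rewrite !continuous_open_subspace//; split=> x; rewrite inE.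
    by move=> /h1[].
  by move=> /h2[].
Qed.

Lemma homeo_on_open (X Y : topologicalType) (U : set X) (V : set Y) f W :
  open U -> open V -> homeo_on U V f -> open W -> W `<=` U -> open (f @` W).
Proof.
move=> oU oV /(homeo_on_openP _ oU oV)[g [h1 h2]] oW WU.
have -> : f @` W = V `&` g @^-1` W.
  apply/seteqP; split=> y.
    move=> [x Wx <-]; have [Vf gf _] := h1 _ (WU _ Wx).
    by split=> //=; rewrite gf.
  by move=> [/h2[_ fg _] Wg]; exists (g y).
have : {in V, continuous g} by move=> y; rewrite inE => /h2[].
by move/(continuous_inP g oV) => /(_ _ oW).
Qed.

Lemma homeo_on_sub (X Y : topologicalType) (U : set X) (V : set Y) f W :
  open U -> open V -> homeo_on U V f -> open W -> W `<=` U ->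
  homeo_on W (f @` W) f.
Proof.
move=> oU oV h oW WU; have ofW := homeo_on_open oU oV h oW WU.
case/(homeo_on_openP _ oU oV) : (h) => g [h1 h2].
apply/homeo_on_openP => //; exists g; split.
  by move=> x Wx; have [? ? ?] := h1 _ (WU _ Wx); split=> //; exists x.
move=> _ [x Wx <-]; have [Vf gf cf] := h1 _ (WU _ Wx).
by have [_ _ ?] := h2 _ Vf; rewrite gf.
Qed.

Lemma homeo_on_comp (X Y Z : topologicalType) (U : set X) (V : set Y)
    (W : set Z) f f' : open U -> open V -> open W ->
  homeo_on U V f -> homeo_on V W f' -> homeo_on U W (f' \o f).
Proof.
move=> oU oV oW /(homeo_on_openP _ oU oV)[g [h1 h2]].
move=> /(homeo_on_openP _ oV oW)[g' [h1' h2']].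
apply/homeo_on_openP => //; exists (g \o g'); split => x /=.
  move=> /h1[/h1'[Wf gf' cf'] gf cf]; rewrite gf'; split=> //.
  exact: continuous_comp.
move=> /h2'[/h2[Wf gf' cf'] gf cf]; rewrite gf'; split=> //.
exact: continuous_comp.
Qed.

Lemma Ck_onW (R : realType) m j (W W' : set 'rV[R]_m) t :
  W' `<=` W -> Ck_on j W t -> Ck_on j W' t.
Proof.
move=> W'W; elim: j t => [|j IH] t /= [ct h]; split=> //.
- by move=> x /W'W /ct.
- by move=> x /W'W /ct.
move=> i; have [d c] := h i; split; last exact: IH.
by move=> x /W'W /d.
Qed.

Lemma regular_onW (R : realType) m C (W W' : set 'rV[R]_m) t :
  W' `<=` W -> regular_on C W t -> regular_on C W' t.
Proof.
move=> W'W; case: C => /=.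
- by move=> c x /W'W /c.
- by move=> s j; apply: (Ck_onW W'W).
move=> [c h]; split; first by move=> x /W'W /c.
move=> x /W'W /h[P [nP hP]]; exists P; split=> // Q QP y /W'W; exact: hP.
Qed.

Lemma lifted_atlasP (R : realType) m C (M' M : topologicalType) (p : M' -> M)
    (A : set (chart R m M)) :
  covering_map p -> is_atlas C A -> is_atlas C (lifted_atlas p A).
Proof.
move=> [cp _ hp] [Ac Acov Atr]; split.
- move=> [V phi] [/= oV opV hV [c [Acc sub e]]].
  have [oc oic hc] := Ac _ Acc.
  have eph : phi @` V = c.2 @` (p @` V) by rewrite e image_comp.
  have o2 : open (phi @` V).
    by rewrite eph; apply: (homeo_on_open oc oic hc).
  split=> //=; rewrite {2}e; apply: (homeo_on_comp oV opV o2 hV).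
  rewrite eph; exact: (homeo_on_sub oc oic hc).
- move=> x; have [c Acc cpx] := Acov (p x); have [oc oic hc] := Ac _ Acc.
  have [U [oU Ux [S [So Sd Sc Sh]]]] := hp (p x).
  have : (p @^-1` U) x by [].
  rewrite -Sc => -[W SW Wx]; have oW := So _ SW; have hW := Sh _ SW.
  have oV : open (W `&` p @^-1` c.1).
    by apply: openI => //; apply: open_comp => // y _; exact: cp.
  have VW : W `&` p @^-1` c.1 `<=` W by apply: subIsetl.
  exists (W `&` p @^-1` c.1, c.2 \o p) => //; split => //=.
  + exact: (homeo_on_open oW oU hW).
  + exact: (homeo_on_sub oW oU hW).
  + by exists c; split=> // _ [y [_ ?] <-].
- move=> [V phi] [V' phi'] [/= oV opV hV [c [Acc sub e]]].
  move=> [/= oV' opV' hV' [d [Ad sub' e']]].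
  have [t [rt ht]] := Atr _ _ Acc Ad; exists t; split=> /=; last first.
    move=> x [Vx V'x]; rewrite e e' /= ht//; split.
      by apply: sub; exists x.
    by apply: sub'; exists x.
  apply: regular_onW rt => _ [x [Vx V'x] <-]; rewrite e; exists (p x) => //.
  by split; [apply: sub; exists x|apply: sub'; exists x].
Qed.

Lemma morphism_TOP (R : realType) m (M : topologicalType)
    (A : set (chart R m M)) f : is_atlas TOP A ->
  morphism_of_class TOP A A f <-> continuous f.
Proof.
move=> [Ac Acov Atr]; split=> [[]//|cf]; split=> // c d Acc Add.
have [oc oic hc] := Ac _ Acc; have [od oid hd] := Ac _ Add.
have [g [h1 h2]] := (homeo_on_openP c.2 oc oic).1 hc.
have [g' [h1' h2']] := (homeo_on_openP d.2 od oid).1 hd.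
exists (d.2 \o f \o g); split => /=.
  move=> _ [x [cx dfx] <-]; have [a gx ccx] := h1 _ cx.
  have [_ _ cgx] := h2 _ a.
  have [_ _ cd] := h1' _ dfx.
  apply: continuous_comp => //; rewrite gx.
  by apply: continuous_comp => //; exact: cf.
by move=> x [cx _]; have [_ -> _] := h1 _ cx.
Qed.

Lemma automorphism_TOP (R : realType) m (M : topologicalType)
    (A : set (chart R m M)) f : is_atlas TOP A ->
  automorphism TOP A f <-> homeomorphism f.
Proof.
by move=> hA; split=> -[g [? ?]] => [/(morphism_TOP _ hA) ? /(morphism_TOP _ hA)|? ?];
  exists g; split=> //; apply/morphism_TOP.
Qed.

(* Main.v *)
Require Import Defs.
From HB Require Import structures.
From mathcomp Require Import all_boot all_order all_algebra all_fingroup.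
From mathcomp Require Import all_classical all_reals all_analysis.
From mathcomp Require Import zify ring lra.

Set Implicit Arguments.
Unset Strict Implicit.
Unset Printing Implicit Defensive.

Import Order.TTheory GRing.Theory Num.Theory.
Import numFieldNormedType.Exports.

Local Open Scope ring_scope.

(* Let [E] be the group of lifts to [M'] of the homeomorphisms [rho g]; it is an
   extension of SL_n(Z) by the deck group Z^k, and a splitting turns [rho] into
   an action on [M'], which is trivial, so that [rho] is trivial.

   Every representation of SL_n(Z) of dimension [k < n] is trivial: its
   restriction to the diagonal sign matrices, and then to the root subgroups of
   one row, is diagonalizable, and a nontrivial character would have at least [n]
   conjugates (except for one configuration with [n = 4], treated by hand).  Hence
   Z^k is central in [E].

   A central extension of SL_n(Z) whose kernel has no 2-torsion splits:
   commutators of lifts of elementary matrices do not depend on the lifts, and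
   conjugation by signed permutations shows that each unwanted central value
   equals its own inverse, so that the Steinberg relations and [w ^ 4 = 1] hold.
   Silvester's argument, a peak reduction for the l^1 norm on unimodular rows,
   then shows that these relations present SL_n(Z). *)

(** * Elementary and signed permutation matrices *)

(** The Schur multiplier of SL_n(Z), n >= 3, is an elementary abelian 2-group, larger for n = 3 and
    4 than for n >= 5; this is why absence of 2-torsion makes a central extension of this perfect
    group split. The argument does not compute that multiplier: a third index, available as n >= 3,
    serves both to write elementary matrices as commutators and to build diagonal sign matrices,
    whose entries -1 come in pairs because the determinant is 1. The bound k <= n - 1 is sharp for
    the representation step, Z^n being a nontrivial module. There the action on Z^k is extended to
    Q^k, since sign characters need a field with 2 nonzero. On the topological side, lifting
    homeomorphisms needs small contractible neighbourhoods, which charts provide on M'; a continuous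
    lift then has the coordinate expression of the map below, so the three categories are treated at
    once. *)

Section elementary.
Variable n : nat.
Implicit Types (i j k l : 'I_n) (b c : bool) (v : 'rV[int]_n) (g h : SLZ n).

Lemma SLZ_valM g h : SLZval (g * h)%g = SLZval g *m SLZval h.
Proof. by []. Qed.

Lemma SLZ_val1 : SLZval (1%g : SLZ n) = 1%:M.
Proof. by []. Qed.

(** Matrices are compared through their right action on row vectors, so that identities between
    words reduce to coordinate formulas such as [eltE]. *)
Lemma SLZ_ext g h : (forall v l, (v *m g) 0 l = (v *m h) 0 l) -> g = h.
Proof.
move=> gh; apply: val_inj; apply/row_matrixP => i; rewrite !rowE.
by apply/rowP => l; exact: gh.
Qed.

(** The bit [b] is the sign of the off-diagonal entry. The identity as value for [i = j] makes the
    family total. *)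
Definition elt_mx i j b : 'M[int]_n :=
  1%:M + (if i == j then 0 else (-1) ^+ b *: delta_mx i j).

Lemma det_elt_mx i j b : \det (elt_mx i j b) == 1.
Proof.
have diag k l : k = l -> elt_mx i j b k l = 1.
  move=> ->; rewrite /elt_mx; case: ifPn => [|ij]; rewrite !mxE eqxx ?addr0//.
  by case: (eqVneq l i) ij => [->|]; rewrite ?mulr0 ?addr0// => /negPf ->; rewrite mulr0 addr0.
have offdiag k l : k != l -> (k != i) || (l != j) -> elt_mx i j b k l = 0.
  move=> kl kilj; rewrite /elt_mx; case: ifPn => _; rewrite !mxE (negPf kl) ?addr0//.
  by move: kilj; rewrite -negb_and => /negPf ->; rewrite mulr0 addr0.
apply/eqP; case: (leqP i j) => ij; last first.
  rewrite det_trig; first by rewrite big1// => k _; exact: diag.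
  apply/forallP => k; apply/forallP => l; apply/implyP => kl; apply/eqP.
  apply: offdiag; first by rewrite -val_eqE ltn_eqF.
  by rewrite -negb_and; apply/negP => /andP[/eqP ki /eqP lj]; subst; lia.
rewrite -det_tr det_trig; first by rewrite big1// => k _; rewrite mxE; exact: diag.
apply/forallP => k; apply/forallP => l; apply/implyP => kl; apply/eqP; rewrite mxE.
apply: offdiag; first by rewrite -val_eqE gtn_eqF.
by rewrite -negb_and; apply/negP => /andP[/eqP ki /eqP lj]; subst; lia.
Qed.

Definition elt i j b : SLZ n := MkSLZ (det_elt_mx i j b).

Lemma eltE i j b v l : (v *m elt i j b) 0 l =
  v 0 l + (if (l == j) && (i != j) then (-1) ^+ b * v 0 i else 0).
Proof.
rewrite /= /elt_mx mulmxDr mulmx1 mxE; congr (_ + _).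
case: ifPn => [|ij]; first by rewrite andbF mulmx0 mxE.
rewrite andbT -scalemxAr !mxE (bigD1 i)//= big1 => [|k /negPf ki].
  by rewrite mxE eqxx /=; case: ifP => _; rewrite ?mulr1 ?mulr0 ?addr0 ?mulr0.
by rewrite mxE ki mulr0.
Qed.

Lemma elt_diag i b : elt i i b = 1%g.
Proof.
by apply: SLZ_ext => v l; rewrite eltE eqxx andbF addr0 SLZ_val1 mulmx1.
Qed.

Lemma elt_mulN i j b : (elt i j b * elt i j (~~ b))%g = 1%g.
Proof.
have [->|ij] := eqVneq i j; first by rewrite !elt_diag monoid.mulg1.
apply: SLZ_ext => v l; rewrite SLZ_valM mulmxA !eltE ij SLZ_val1 mulmx1 (negPf ij).
by case: eqP => _; case: b; rewrite /=; ring.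
Qed.

Lemma eltV i j b : (elt i j b)^-1%g = elt i j (~~ b).
Proof. by apply: monoid.mulg1_eq; exact: elt_mulN. Qed.

Lemma elt_commute i j k l b c : j != k -> i != l ->
  commute (elt i j b) (elt k l c).
Proof.
move=> jk il; have [->|ij] := eqVneq i j; first by rewrite elt_diag; apply/commute_sym/commute1.
have [->|kl] := eqVneq k l; first by rewrite elt_diag; apply: commute1.
apply: SLZ_ext => v m; rewrite !SLZ_valM !mulmxA !eltE ij kl !andbT (negPf il).
rewrite [k == j]eq_sym (negPf jk); case: eqP => _; case: eqP => _; ring.
Qed.

Lemma elt_commg i j k : i != j -> j != k -> i != k ->
  [~ elt i j false, elt j k false]%g = elt i k false.
Proof.
move=> ij jk ik; apply: SLZ_ext => v m.
rewrite /commg /conjg !eltV !SLZ_valM !mulmxA !eltE ij jk ik !andbT !eqxx.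
rewrite !(negPf ij) !(negPf ik) !(negPf jk).
case: (eqVneq m k) => [->|mk]; rewrite ?[k == j]eq_sym ?(negPf jk) /=; last by case: eqP => _; ring.
ring.
Qed.

(* [signed_perm g s e]: the matrix [g] sends the [i]-th basis row vector to
   [(-1) ^ e i] times the [s i]-th one. *)
Definition signed_perm g (s : {perm 'I_n}) (e : 'I_n -> bool) :=
  forall v i, (v *m g) 0 (s i) = (-1) ^+ e i * v 0 i.

Lemma signed_perm1 : signed_perm 1%g 1%g (fun=> false).
Proof. by move=> v i; rewrite SLZ_val1 mulmx1 perm1 mul1r. Qed.

Lemma signed_permM g h s s' e e' : signed_perm g s e -> signed_perm h s' e' ->
  signed_perm (g * h)%g (s * s')%g (fun i => e i (+) e' (s i)).
Proof.
move=> gs hs v i; rewrite SLZ_valM mulmxA permM hs gs mulrA signr_addb.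
by rewrite [X in X * _]mulrC.
Qed.

Lemma signed_permV g s e : signed_perm g s e ->
  signed_perm g^-1%g s^-1%g (fun i => e (s^-1%g i)).
Proof.
move=> gs v i; have := gs (v *m SLZval g^-1%g) (s^-1%g i).
rewrite -mulmxA -SLZ_valM monoid.mulVg SLZ_val1 mulmx1 permKV => ->.
by rewrite mulrA -signr_addb addbb mul1r.
Qed.

Lemma elt_conj g s e i j b : signed_perm g s e ->
  (elt i j b ^ g)%g = elt (s i) (s j) (b (+) e i (+) e j).
Proof.
move=> gs; rewrite /conjg; apply: (canLR (monoid.mulKg _)); apply: SLZ_ext => v m.
rewrite -(permKV s m) !SLZ_valM !mulmxA gs !eltE !gs !(inj_eq perm_inj).
case: eqP => [->|_] /=; last by rewrite !addr0.
case: ifP => _; last by rewrite !addr0.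
rewrite !signr_addb; case: b; case: (e i); case: (e j) => /=; ring.
Qed.

(** The Weyl element w_ij(1) of the Steinberg calculus: on row vectors e_i goes to e_j and e_j to
    -e_i. *)
Definition wt i j : SLZ n := (elt i j false * elt j i true * elt i j false)%g.

Lemma wt_signed i j :
  signed_perm (wt i j) (tperm i j) (fun l => (l == j) && (i != j)).
Proof.
have [->|ij] := eqVneq i j.
  rewrite /wt !elt_diag !monoid.mulg1 tperm1 => v l.
  by rewrite andbF /= perm1 mulmx1 mul1r.
move=> v l; rewrite /wt !SLZ_valM !mulmxA !eltE ij (eq_sym j) ij.
case: tpermP => [->|->|/eqP li /eqP lj]; rewrite !eqxx /= ?(eq_sym j) ?(negPf ij) ?(negPf li) ?(negPf lj) /=; ring.
Qed.

(* Diagonal, with entry -1 at [i] and [j]; the identity if [i = j]. *)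
Definition dt i j : SLZ n := (wt i j * wt i j)%g.

Lemma dt_signed i j : signed_perm (dt i j) 1%g (fun l => (l == i) (+) (l == j)).
Proof.
move=> v l; have := signed_permM (wt_signed i j) (wt_signed i j) v l.
rewrite /= tperm2 => ->; congr ((-1) ^+ (nat_of_bool _) * _).
have [->|ij] := eqVneq i j; first by rewrite /= !andbF !addbb.
rewrite /= !andbT; case: tpermP => [->|->|/eqP li /eqP lj].
- by rewrite !eqxx (negPf ij).
- by rewrite !eqxx [j == i]eq_sym (negPf ij).
- by rewrite (negPf li) (negPf lj).
Qed.

Lemma signed_perm_inj g h s e e' : signed_perm g s e -> signed_perm h s e' ->
  e =1 e' -> g = h.
Proof.
move=> gs hs ee; apply: SLZ_ext => v l.
by rewrite -(permKV s l) gs hs ee.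
Qed.

Lemma dtM i j k : (dt i j * dt j k)%g = dt i k.
Proof.
apply: (@signed_perm_inj _ _ 1%g).
- have := signed_permM (dt_signed i j) (dt_signed j k); rewrite monoid.mulg1; exact.
- exact: dt_signed.
- move=> l /=; rewrite perm1; case: (l == i); case: (l == j); by case: (l == k).
Qed.

Lemma dtC i j : dt i j = dt j i.
Proof.
apply: (signed_perm_inj (dt_signed i j) (dt_signed j i)) => l.
exact: addbC.
Qed.

Lemma dt2 i j : (dt i j * dt i j)%g = 1%g.
Proof.
apply: (@signed_perm_inj _ _ 1%g).
- have := signed_permM (dt_signed i j) (dt_signed i j); rewrite monoid.mulg1; exact.
- exact: signed_perm1.
- by move=> l /=; rewrite perm1 addbb.
Qed.

Lemma dt_commute i j k l : commute (dt i j) (dt k l).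
Proof.
apply: (@signed_perm_inj _ _ 1%g).
- have := signed_permM (dt_signed i j) (dt_signed k l); rewrite monoid.mulg1; exact.
- have := signed_permM (dt_signed k l) (dt_signed i j); rewrite monoid.mulg1; exact.
- by move=> m /=; rewrite !perm1 addbC.
Qed.

Lemma dt_conj g s e i j : signed_perm g s e -> (dt i j ^ g)%g = dt (s i) (s j).
Proof.
move=> gs; have := signed_permM (signed_permV gs) (signed_permM (dt_signed i j) gs).
rewrite monoid.mul1g monoid.mulVg => h.
apply: (signed_perm_inj h (dt_signed (s i) (s j))) => l /=.
rewrite perm1 -[in RHS](permKV s l) !(inj_eq perm_inj).
by case: (e _); case: (_ == i); case: (_ == j).
Qed.

Lemma elt_dt i j k l b : (elt k l b ^ dt i j)%g =
  elt k l (b (+) ((k == i) (+) (k == j)) (+) ((l == i) (+) (l == j))).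
Proof. by rewrite (elt_conj _ _ _ (dt_signed i j)) !perm1. Qed.

Lemma elt_wt i j k l b : (elt k l b ^ wt i j)%g =
  elt (tperm i j k) (tperm i j l)
    (b (+) ((k == j) && (i != j)) (+) ((l == j) && (i != j))).
Proof. by rewrite (elt_conj _ _ _ (wt_signed i j)). Qed.

End elementary.

Ltac eq_cases := try subst; repeat (match goal with
  | |- context[@eq_op ?T ?a ?b] =>
      let h := fresh in
      case: (@eqVneq T a b) => [h|h]; [try subst|]; rewrite ?eqxx /=
  end); try (match goal with h : is_true (?x != ?x) |- _ => by rewrite eqxx in h end);
  try done.

(** * Steinberg relations in a central extension *)

Section group_words.
Variable G : groupType.
Implicit Types (x y z : G) (b c : bool).
Local Open Scope group_scope.

Definition sgx x b := if b then x^-1 else x.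

Lemma sgxV x b : (sgx x b)^-1 = sgx x (~~ b).
Proof. by case: b => //=; rewrite invgK. Qed.

Lemma sgx_sgx x b c : sgx (sgx x b) c = sgx x (b (+) c).
Proof. by case: b; case: c => //=; rewrite invgK. Qed.

Lemma sgx1 b : sgx 1 b = 1.
Proof. by case: b => //=; rewrite invg1. Qed.

Lemma sgxJ x y b : sgx x b ^ y = sgx (x ^ y) b.
Proof. by case: b => //=; rewrite conjVg. Qed.

Lemma commute_sgx x y b : commute x y -> commute x (sgx y b).
Proof. by case: b => //= h; exact: commuteV. Qed.

Lemma commgVr x y : [~ x, y^-1] = [~ x, y]^-1 ^ y^-1.
Proof. by rewrite /commg /conjg !gnorm. Qed.

Lemma commgVl x y : [~ x^-1, y] = [~ x, y]^-1 ^ x^-1.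
Proof. by rewrite /commg /conjg !gnorm. Qed.

Lemma commute_conjg x y : commute x y -> x ^ y = x.
Proof. by move=> h; rewrite /conjg h mulKg. Qed.

(** When [x, y] commutes with both entries, the commutator is compatible with inversion in each of
    them. *)
Lemma commg_sgx x y b c : commute [~ x, y] x -> commute [~ x, y] y ->
  [~ sgx x b, sgx y c] = sgx [~ x, y] (b (+) c).
Proof.
move=> hx hy.
have ex : [~ x^-1, y] = [~ x, y]^-1.
  by rewrite commgVl commute_conjg//; apply/commuteV/commute_sym/commuteV/commute_sym.
case: b; case: c => //=.
- rewrite commgVr ex invgK commute_conjg//.
  exact/commuteV.
- by rewrite commgVr commute_conjg//; apply/commuteV/commute_sym/commuteV/commute_sym.
Qed.

End group_words.

Section central_extension.
Variables (n : nat) (E : groupType) (q : E -> SLZ n).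
Hypothesis n3 : (3 <= n)%N.
Hypothesis qM : forall x y, q (x * y)%g = (q x * q y)%g.
Hypothesis q_surj : forall g, exists x, q x = g.
Hypothesis q_central : forall z, q z = 1%g -> forall x, commute z x.
Hypothesis q_tors : forall z, q z = 1%g -> (z * z)%g = 1%g -> z = 1%g.
Implicit Types (i j k l m : 'I_n) (a b c d : bool) (x y z g : E).
Local Open Scope group_scope.

Lemma q1 : q 1 = 1.
Proof. by apply: (@mulIg _ (q 1)); rewrite mul1g -qM mul1g. Qed.

Lemma qV x : q x^-1 = (q x)^-1.
Proof. by symmetry; apply: mulg1_eq; rewrite -qM mulgV q1. Qed.

Lemma qJ x y : q (x ^ y) = q x ^ q y.
Proof. by rewrite /conjg !qM qV. Qed.

Lemma qR x y : q [~ x, y] = [~ q x, q y].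
Proof. by rewrite /commg qM qV qJ. Qed.

Lemma q_sgx x b : q (sgx x b) = sgx (q x) b.
Proof. by case: b => //=; rewrite qV. Qed.

Lemma q_eq x y : q x = q y -> exists2 z, q z = 1 & y = x * z.
Proof.
by move=> xy; exists (x^-1 * y); rewrite ?mulVKg// qM qV xy mulVg.
Qed.

Lemma commg_lift x y x' y' : q x = q x' -> q y = q y' -> [~ x, y] = [~ x', y'].
Proof.
move=> /q_eq[z z1 ->] /q_eq[t t1 ->].
have conjK u v w : q v = 1 -> u ^ (w * v) = u ^ w.
  by move=> v1; rewrite conjgM commute_conjg//; exact/commute_sym/q_central.
by rewrite [RHS]commgEr conjK// -commgEr !commgEl conjK.
Qed.

(** A central element is fixed by conjugation, so being inverted by one forces its square to be 1.
    This is how the torsion hypothesis is exploited. *)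
Lemma ker_selfinv z g : q z = 1 -> z ^ g = z^-1 -> z = 1.
Proof.
move=> z1; rewrite commute_conjg; last exact: q_central.
by move=> zV; apply: q_tors => //; rewrite {1}zV mulVg.
Qed.

Lemma lift_commg_central x y : commute (q x) (q y) -> q [~ x, y] = 1.
Proof. by move=> h; rewrite qR; apply/eqP/commgP. Qed.

Lemma index_outside i j : exists2 m, m != i & m != j.
Proof.
have : (0 < #|~: [set i; j]|)%N.
  by rewrite cardsCs finset.setCK card_ord subn_gt0 (leq_ltn_trans _ n3)// cards2; case: eqP.
by case/card_gt0P => m; rewrite !inE negb_or => /andP[? ?]; exists m.
Qed.

(* The commutator is central; conjugating by a suitable signed permutation shows
   that it equals its inverse, and the kernel has no 2-torsion. *)
Lemma commute_lift_ff i j k l x y : q x = elt i j false -> q y = elt k l false ->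
  j != k -> i != l -> commute x y.
Proof.
move=> xE yE jk il.
have qxy : commute (q x) (q y) by rewrite xE yE; exact: elt_commute.
have z1 := lift_commg_central qxy.
have [ijE|ij] := eqVneq i j; first by apply: q_central; rewrite xE ijE elt_diag.
have [klE|kl] := eqVneq k l.
  by apply/commute_sym/q_central; rewrite yE klE elt_diag.
have zV : [~ x, y^-1] = [~ x, y]^-1.
  exact: (@commg_sgx _ x y false true (q_central z1 _) (q_central z1 _)).
apply/commgP/eqP.
have [ikE|ik] := eqVneq i k; have [jlE|jl] := eqVneq j l.
- have [z zq ->] : exists2 z, q z = 1 & y = x * z.
    by apply: q_eq; rewrite xE yE ikE jlE.
  by apply/eqP/commgP/commuteM => //; exact/commute_sym/q_central.
(* Here and in the next case [dt i j] fixes [elt i j], having -1 at both of its indices, and inverts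
   [elt k l], which shares exactly one of them. *)
- have [g gE] := q_surj (dt i j); apply: (ker_selfinv (g := g)) => //.
  rewrite conjRg -zV; apply: commg_lift; rewrite !(qJ, qV) gE ?xE ?yE ?eltV elt_dt.
    by congr elt; eq_cases.
  by congr elt; eq_cases.
- have [g gE] := q_surj (dt i j); apply: (ker_selfinv (g := g)) => //.
  rewrite conjRg -zV; apply: commg_lift; rewrite !(qJ, qV) gE ?xE ?yE ?eltV elt_dt.
    by congr elt; eq_cases.
  by congr elt; eq_cases.
(* All four indices are distinct: this element swaps the two matrices, hence sends the commutator to
   its inverse. *)
- have [g gE] := q_surj (wt i k * wt j l); apply: (ker_selfinv (g := g)) => //.
  rewrite conjRg invgR; apply: commg_lift; rewrite !qJ gE xE yE conjgM !elt_wt.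
    rewrite tpermL (tpermD (x := i) (z := j)) ?(eq_sym k)// (tpermD (x := j) (z := k)) 1?(eq_sym l)// tpermL.
    by congr elt; eq_cases.
  rewrite tpermR (tpermD (x := i) (z := l)) // (tpermD (x := j) (z := i)) 1?(eq_sym j) 1?(eq_sym l)// tpermR.
  by congr elt; eq_cases.
Qed.

Lemma commute_lift i j k l b c x y : q x = elt i j b -> q y = elt k l c ->
  j != k -> i != l -> commute x y.
Proof.
move=> xE yE jk il.
have h : commute (sgx x b) (sgx y c).
  by apply: (@commute_lift_ff i j k l) => //; rewrite q_sgx ?xE ?yE; [case: b {xE}|case: c {yE}] => //=; rewrite eltV.
move: (commute_sgx c h); rewrite sgx_sgx addbb /= => /commute_sym/(commute_sgx b).
by rewrite sgx_sgx addbb => /commute_sym.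
Qed.

(* Makes the Steinberg generators below independent of the intermediate index. *)
Lemma lift_inverted_uniq i j b x y g :
  q x = elt i j b -> q y = elt i j b -> x ^ g = x^-1 -> y ^ g = y^-1 -> x = y.
Proof.
move=> xE yE xg yg; have [z z1 yz] : exists2 z, q z = 1 & y = x * z.
  by apply: q_eq; rewrite xE yE.
have zV : z ^ g = z^-1.
  apply: (mulgI x^-1); rewrite -{1}xg -conjMg -yz yg yz invMg.
  by apply: q_central; rewrite qV z1 invg1.
by rewrite yz (ker_selfinv z1 zV) mulg1.
Qed.

(** [dt i m'] inverts exactly one factor: [y] if [m = m'], [x] otherwise. Since [m'] need not be
    [m], a single [g] inverts the commutators built with all intermediate indices, as
    [lift_inverted_uniq] requires. *)
Lemma commg_inverted i j m m' g x y : i != j -> m != i -> m != j -> m' != i -> m' != j ->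
  q x = elt i m false -> q y = elt m j false -> q g = dt i m' ->
  [~ x, y] ^ g = [~ x, y]^-1.
Proof.
move=> ij mi mj m'i m'j xE yE gE.
have zE : q [~ x, y] = elt i j false.
  by rewrite qR xE yE elt_commg// eq_sym.
have cx : commute [~ x, y] x by apply: (commute_lift zE xE); rewrite eq_sym.
have cy : commute [~ x, y] y by apply: (commute_lift zE yE); rewrite // eq_sym.
have [mm'|mm'] := eqVneq m m'.
  rewrite -[RHS](@commg_sgx _ x y false true cx cy) conjRg.
  by apply: commg_lift; rewrite !(qJ, qV) gE ?xE ?yE ?eltV elt_dt; congr elt; eq_cases.
rewrite -[RHS](@commg_sgx _ x y true false cx cy) conjRg.
by apply: commg_lift; rewrite !(qJ, qV) gE ?xE ?yE ?eltV elt_dt; congr elt; eq_cases.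
Qed.

Definition lift_of (u : SLZ n) := sval (cid (q_surj u)).

Lemma lift_ofK u : q (lift_of u) = u.
Proof. by rewrite /lift_of; case: cid. Qed.

Definition third i j := s2val (cid2 (index_outside i j)).

Lemma thirdP i j : third i j != i /\ third i j != j.
Proof. by rewrite /third; case: cid2. Qed.

(** A commutator of lifts is free of the central ambiguity, so the arbitrary [lift_of] does no harm;
    that [third] does none either is [x_commg_lift]. *)
Definition x_ i j : E :=
  if i == j then 1
  else [~ lift_of (elt i (third i j) false), lift_of (elt (third i j) j false)].

Lemma q_x i j : q (x_ i j) = elt i j false.
Proof.
rewrite /x_; case: eqVneq => [->|ij]; first by rewrite q1 elt_diag.
by have [? ?] := thirdP i j; rewrite qR !lift_ofK elt_commg// eq_sym.
Qed.

Lemma x_diag i : x_ i i = 1.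
Proof. by rewrite /x_ eqxx. Qed.

Lemma x_commg_lift i j m x y : i != j -> m != i -> m != j ->
  q x = elt i m false -> q y = elt m j false -> [~ x, y] = x_ i j.
Proof.
move=> ij mi mj xE yE; have [gi gj] := thirdP i j.
have [g gE] := q_surj (dt i m).
have zE : q [~ x, y] = elt i j false by rewrite qR xE yE elt_commg// eq_sym.
apply: (lift_inverted_uniq zE (q_x i j) (commg_inverted ij mi mj mi mj xE yE gE)).
by rewrite /x_ (negPf ij); exact: (commg_inverted ij gi gj mi mj (lift_ofK _) (lift_ofK _) gE).
Qed.

Definition xs i j b := sgx (x_ i j) b.

Lemma q_xs i j b : q (xs i j b) = elt i j b.
Proof. by rewrite q_sgx q_x; case: b => //=; rewrite eltV. Qed.

Lemma xsV i j b : (xs i j b)^-1 = xs i j (~~ b).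
Proof. exact: sgxV. Qed.

(** Conjugation by [g] carries the commutator defining [x_ i j] to one of lifts over the permuted
    indices, so no central factor can appear; the sign [e m] of the intermediate index occurs twice
    and cancels. *)
Lemma xs_conj g s e i j b : signed_perm (q g) s e ->
  xs i j b ^ g = xs (s i) (s j) (b (+) e i (+) e j).
Proof.
move=> gs; rewrite /xs sgxJ -addbA [b (+) _]addbC.
suff -> : x_ i j ^ g = sgx (x_ (s i) (s j)) (e i (+) e j) by rewrite sgx_sgx.
have [->|ij] := eqVneq i j; first by rewrite !x_diag conj1g sgx1.
have [mi mj] := thirdP i j; set m := third i j in mi mj.
have sij : s i != s j by rewrite (inj_eq perm_inj).
have smi : s m != s i by rewrite (inj_eq perm_inj).
have smj : s m != s j by rewrite (inj_eq perm_inj).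
have xm k l : q (sgx (x_ k l ^ g) (e k (+) e l)) = elt (s k) (s l) false.
  rewrite q_sgx qJ q_x (elt_conj _ _ _ gs) /=.
  by case: (e k); case: (e l) => //=; rewrite eltV.
rewrite -(x_commg_lift sij smi smj (xm i m) (xm m j)).
have zE : [~ x_ i m, x_ m j] = x_ i j by apply: (x_commg_lift ij mi mj); rewrite q_x.
rewrite commg_sgx -?conjRg ?zE; last 2 first.
- rewrite /commute -!conjMg; congr (_ ^ g).
  by apply: (commute_lift (q_x i j) (q_x i m)); rewrite eq_sym.
- rewrite /commute -!conjMg; congr (_ ^ g).
  by apply: (commute_lift (q_x i j) (q_x m j)); rewrite // eq_sym.
by rewrite sgx_sgx; case: (e i); case: (e j); case: (e m) => //=; rewrite invgK.
Qed.

Lemma xs_commute i j k l b c : j != k -> i != l ->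
  commute (xs i j b) (xs k l c).
Proof. by apply: commute_lift; rewrite q_xs. Qed.

Lemma xs_commg i j k b c : i != j -> j != k -> i != k ->
  [~ xs i j b, xs j k c] = xs i k (b (+) c).
Proof.
move=> ij jk ik; have e : [~ x_ i j, x_ j k] = x_ i k.
  by apply: (@x_commg_lift i k j); rewrite ?q_x// eq_sym.
by rewrite /xs commg_sgx e//; [apply: (commute_lift (q_x i k) (q_x i j))
  |apply: (commute_lift (q_x i k) (q_x j k))]; rewrite // eq_sym.
Qed.

Definition w_ i j := x_ i j * (x_ j i)^-1 * x_ i j.

Lemma q_w i j : q (w_ i j) = wt i j.
Proof. by rewrite /w_ !qM qV !q_x eltV. Qed.

Lemma w_conj g s e i j : signed_perm (q g) s e ->
  w_ i j ^ g = sgx (w_ (s i) (s j)) (e i (+) e j).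
Proof.
move=> gs; have h k l : x_ k l ^ g = xs (s k) (s l) (e k (+) e l).
  by rewrite -[x_ k l]/(xs k l false) (xs_conj _ _ _ gs).
rewrite /w_ !conjMg conjVg !h /xs [e j (+) _]addbC.
by case: (e i (+) e j) => //=; rewrite !invMg !invgK mulgA.
Qed.

(** Conjugation by [w_ i j] fixes [w_ i j], and sends x_ij to the inverse of x_ji and x_ji to the
    inverse of x_ij. *)
Lemma w_alt i j : w_ i j = (x_ j i)^-1 * x_ i j * (x_ j i)^-1.
Proof.
have [->|ij] := eqVneq i j; first by rewrite /w_ x_diag !invg1 !mulg1.
have h : signed_perm (q (w_ i j)) (tperm i j) (fun l => (l == j) && (i != j)).
  by rewrite q_w; exact: wt_signed.
have e : w_ i j ^ w_ i j = w_ i j by apply: commute_conjg.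
rewrite -e {1}/w_ !conjMg conjVg.
have hx k l : x_ k l ^ w_ i j = _ := xs_conj k l false h.
by rewrite !hx tpermL tpermR eqxx (negPf ij) /= invgK.
Qed.

(** In the Steinberg group this fourth power is the symbol {-1, -1}, the generator of K_2(Z) of
    order 2. Here it is central, and a lift of [dt i m] inverts [w_ i j]. *)
Lemma w_mul4 i j : w_ i j * w_ i j * (w_ i j * w_ i j) = 1.
Proof.
have [->|ij] := eqVneq i j; first by rewrite /w_ x_diag !invg1 !mulg1.
have [m mi mj] := index_outside i j; have [g gE] := q_surj (dt i m).
have gs := dt_signed i m; rewrite -gE in gs.
apply: (ker_selfinv (g := g)); first by rewrite qM qM q_w dt2.
rewrite conjMg conjMg (w_conj _ _ gs) !perm1.
have -> : (i == i) (+) (i == m) (+) ((j == i) (+) (j == m)) by eq_cases.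
by rewrite /= !invMg.
Qed.

End central_extension.

(** * Peak reduction *)

Section steinberg_generators.
Variables (n : nat) (E : groupType) (q : E -> SLZ n).
Hypothesis qM : forall x y, q (x * y)%g = (q x * q y)%g.
Variable xs : 'I_n -> 'I_n -> bool -> E.
Implicit Types (i j k l m : 'I_n) (a b c d : bool) (g h : E).
Local Open Scope group_scope.
Hypothesis q_xs : forall i j b, q (xs i j b) = elt i j b.
Hypothesis xsV : forall i j b, (xs i j b)^-1 = xs i j (~~ b).
Hypothesis xs_conj : forall g s e i j b, signed_perm (q g) s e ->
  xs i j b ^ g = xs (s i) (s j) (b (+) e i (+) e j).
Hypothesis xs_commute : forall i j k l b c, j != k -> i != l ->
  commute (xs i j b) (xs k l c).
Hypothesis xs_commg : forall i j k b c, i != j -> j != k -> i != k ->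
  [~ xs i j b, xs j k c] = xs i k (b (+) c).
Variable w_ : 'I_n -> 'I_n -> E.
Hypothesis w_def : forall i j, w_ i j = xs i j false * xs j i true * xs i j false.
Hypothesis w_alt : forall i j, w_ i j = xs j i true * xs i j false * xs j i true.
Hypothesis w_mul4 : forall i j, w_ i j * w_ i j * (w_ i j * w_ i j) = 1.

Lemma q_weyl i j : q (w_ i j) = wt i j.
Proof. by rewrite w_def !qM !q_xs. Qed.

Lemma weyl_sym i j : w_ j i = (w_ i j)^-1.
Proof. by rewrite w_alt w_def !invMg !xsV /= mulgA. Qed.

Lemma xs_w i j k l b : xs k l b ^ w_ i j =
  xs (tperm i j k) (tperm i j l)
    (b (+) ((k == j) && (i != j)) (+) ((l == j) && (i != j))).
Proof.
by rewrite (@xs_conj _ (tperm i j) (fun l => (l == j) && (i != j)))// q_weyl; exact: wt_signed.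
Qed.

Section peak_reduction.
Variables (J : {set 'I_n}) (v0 : 'rV[int]_n).

Definition vec g : 'rV[int]_n := v0 *m SLZval (q g).
Definition nrm g : nat := (\sum_l `|vec g 0%R l|)%N.

(** Weyl elements are steps in their own right because they preserve the norm, whereas the three
    elementary factors of one of them may pass through larger norms. *)
Inductive step : E -> Prop :=
  | step_x i j b : i \in J -> j \in J -> i != j -> step (xs i j b)
  | step_w i j : i \in J -> j \in J -> i != j -> step (w_ i j).

(* A chain of generators leads from [g] to [h] through elements whose associated
   row vector has norm at most [N]. *)
Inductive conn (N : nat) g : E -> Prop :=
  | conn0 : conn N g g
  | connS h s : conn N g h -> step s ->
      (nrm h <= N)%N -> (nrm (h * s) <= N)%N -> conn N g (h * s).

Lemma vecM g h : vec (g * h) = vec g *m SLZval (q h).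
Proof. by rewrite /vec qM SLZ_valM mulmxA. Qed.

Lemma vec_x g i j b l : vec (g * xs i j b) 0%R l =
  (vec g 0 l + (if (l == j) && (i != j) then (-1) ^+ b * vec g 0 i else 0))%R.
Proof. by rewrite vecM q_xs eltE. Qed.

Lemma vec_sp g h s e i : signed_perm (q h) s e ->
  vec (g * h) 0%R (s i) = ((-1) ^+ e i * vec g 0 i)%R.
Proof. by move=> hs; rewrite vecM hs. Qed.

Lemma nrm_x g i j b : i != j ->
  (nrm (g * xs i j b) + `|vec g 0%R j| =
   nrm g + `|(vec g 0 j + (-1) ^+ b * vec g 0 i)%R|)%N.
Proof.
move=> ij; rewrite /nrm (bigD1 j)//= [in RHS](bigD1 j)//= vec_x eqxx ij /=.
rewrite (eq_bigr (fun l => `|vec g 0%R l|%N)) => [|l lj]; first by lia.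
by rewrite vec_x (negPf lj) addr0.
Qed.

Lemma nrm_sp g h s e : signed_perm (q h) s e -> nrm (g * h) = nrm g.
Proof.
move=> hs; rewrite /nrm (reindex_inj (@perm_inj _ s)) /=; apply: eq_bigr => i _.
by rewrite (vec_sp _ _ hs) abszMsign.
Qed.

Lemma nrm_w g i j : nrm (g * w_ i j) = nrm g.
Proof.
by apply: (@nrm_sp _ _ (tperm i j) (fun l => (l == j) && (i != j))); rewrite q_weyl; exact: wt_signed.
Qed.

Lemma stepV s : step s -> step s^-1.
Proof.
case=> i j => [b|] iJ jJ ij; first by rewrite xsV; exact: step_x.
by rewrite -weyl_sym; apply: step_w => //; rewrite eq_sym.
Qed.

Lemma conn_step N g s : step s -> (nrm g <= N)%N -> (nrm (g * s) <= N)%N ->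
  conn N g (g * s).
Proof. by move=> *; apply: connS => //; exact: conn0. Qed.

Lemma conn_trans N g h u : conn N g h -> conn N h u -> conn N g u.
Proof. by move=> gh; elim=> // l s hl IH *; exact: connS. Qed.

Lemma conn_sym N g h : conn N g h -> conn N h g.
Proof.
elim=> [|{}h s gh IH ss hN hsN]; first exact: conn0.
apply: conn_trans IH; rewrite -{2}(mulgK s h).
by apply: conn_step => //; [exact: stepV|rewrite mulgK].
Qed.

Lemma conn_le N M g h : (N <= M)%N -> conn N g h -> conn M g h.
Proof.
move=> NM; elim=> [|{}h s gh IH ss hN hsN]; first exact: conn0.
by apply: connS => //; exact: leq_trans NM.
Qed.

(** Adding the nonzero entry [i] with sign [b] shortens entry [j] by the full length of entry [i]. A
    step that lowers the norm in another way is exchanged for the opposite one in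
    [decreasing_proper]. *)
Definition proper i j b g :=
  [/\ i \in J, j \in J, i != j, vec g 0%R i != 0%R &
    (`|(vec g 0 j + (-1) ^+ b * vec g 0 i)%R| + `|vec g 0%R i| = `|vec g 0%R j|)%N].

Lemma proper_nrm i j b g : proper i j b g ->
  (nrm (g * xs i j b) + `|vec g 0%R i| = nrm g)%N.
Proof. by case=> _ _ ij _ e; have := nrm_x g b ij; lia. Qed.

Lemma proper_lt N i j b g : proper i j b g -> (nrm g <= N.+1)%N ->
  (nrm (g * xs i j b) <= N)%N.
Proof.
by move=> p; have := proper_nrm p; case: p => _ _ _ vi _; lia.
Qed.

(* The two ways of reducing the pair of entries [i], [j] differ by a
   signed permutation. *)
Lemma conn_pair N g i j b : i \in J -> j \in J -> i != j ->
  (nrm (g * xs i j b) <= N)%N -> (nrm (g * xs j i b) <= N)%N ->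
  conn N (g * xs i j b) (g * xs j i b).
Proof.
move=> iJ jJ ij gi gj; have ji : j != i by rewrite eq_sym.
have e : g * xs i j b * xs j i (~~ b) =
         g * xs j i b * (if b then w_ j i else w_ i j).
  rewrite -!mulgA; congr (_ * _).
  case: b {gi gj} => /=.
    by rewrite w_def -[xs j i true](xsV j i false) -!mulgA mulKg.
  by rewrite w_alt -[xs j i false](xsV j i true) -!mulgA mulKg.
have wJ : step (if b then w_ j i else w_ i j) by case: b {e gi gj}; exact: step_w.
have we : (nrm (g * xs j i b * (if b then w_ j i else w_ i j)) <= N)%N.
  by case: b {e wJ} gj gi => *; rewrite nrm_w.
apply: (@conn_trans _ _ (g * xs i j b * xs j i (~~ b))).
  by apply: conn_step => //; [exact: step_x|rewrite e].
by rewrite e; apply/conn_sym/conn_step.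
Qed.

(** The two steps commute and neither alters an entry that the other reads or changes, so the fourth
    corner of the square has still smaller norm. *)
Lemma conn_commuting N g i j b k l c : proper i j b g -> proper k l c g ->
  (nrm g <= N.+1)%N -> j != k -> i != l -> j != l ->
  conn N (g * xs i j b) (g * xs k l c).
Proof.
move=> p1 p2 gN jk il jl.
have n1 := proper_lt p1 gN; have n2 := proper_lt p2 gN.
case: (p1) => iJ jJ ij vi ei; case: (p2) => kJ lJ kl vk ek.
have nst : (nrm (g * xs i j b * xs k l c) <= N)%N.
  have := nrm_x (g * xs i j b) c kl; rewrite !vec_x.
  rewrite [l == j]eq_sym (negPf jl) [k == j]eq_sym (negPf jk) /= !addr0.
  by move: ek; set u := absz (_ + _); move: n1 vk; clear; lia.
have e : g * xs i j b * xs k l c = g * xs k l c * xs i j b.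
  by rewrite -!mulgA; congr (_ * _); exact: xs_commute.
apply: (@conn_trans _ _ (g * xs i j b * xs k l c)).
  by apply: conn_step => //; exact: step_x.
rewrite e in nst *; apply/conn_sym/conn_step => //; exact: step_x.
Qed.

(** The relation x_ij x_jl = x_jl x_ij x_il gives a pentagon through [g]. Properness yields |v_i| <=
    |v_j| <= |v_l| with matching signs, so all corners other than [g] have smaller norm. *)
Lemma conn_chain N g i j b l c : proper i j b g -> proper j l c g ->
  (nrm g <= N.+1)%N -> i != l -> conn N (g * xs i j b) (g * xs j l c).
Proof.
move=> p1 p2 gN il.
have n1 := proper_lt p1 gN; have n2 := proper_lt p2 gN.
case: (p1) => iJ jJ ij vi ei; case: (p2) => _ lJ jl vj el.
have lj : l != j by rewrite eq_sym.
have nst : (nrm (g * xs i j b * xs j l c) <= N)%N.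
  have := nrm_x (g * xs i j b) c jl; have := nrm_x g b ij.
  rewrite !vec_x eqxx ij (negPf lj) /= addr0.
  by case: b {p1 n1} ei; case: c {p2 n2} el => /=; lia.
have nts : (nrm (g * xs j l c * xs i j b) <= N)%N.
  have := nrm_x (g * xs j l c) b ij; have := nrm_x g c jl.
  rewrite !vec_x (negPf jl) (negPf il) /= !addr0.
  by case: b {p1 n1 nst} ei; case: c {p2 n2} el => /=; lia.
have e : g * xs i j b * xs j l c = g * xs j l c * xs i j b * xs i l (b (+) c).
  by rewrite -!mulgA; congr (_ * _); rewrite commgC xs_commg// mulgA.
apply: (@conn_trans _ _ (g * xs i j b * xs j l c)).
  by apply: conn_step => //; exact: step_x.
apply: (@conn_trans _ _ (g * xs j l c * xs i j b)); last first.
  by apply/conn_sym/conn_step => //; exact: step_x.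
rewrite e in nst *; apply/conn_sym/conn_step => //; exact: step_x.
Qed.

Lemma conn_proper N g i j b k l c : proper i j b g -> proper k l c g ->
  (nrm g <= N.+1)%N -> conn N (g * xs i j b) (g * xs k l c).
Proof.
move=> p1 p2 gN.
have n1 := proper_lt p1 gN; have n2 := proper_lt p2 gN.
case: (p1) => iJ jJ ij vi ei; case: (p2) => kJ lJ kl vk ek.
have [jlE|jl] := eqVneq j l.
  subst l; have [ikE|ik] := eqVneq i k.
    subst k; suff -> : b = c by exact: conn0.
    by case: b {p1 n1} ei; case: c {p2 n2} ek => //=; lia.
  have kj : k != j by [].
  (* Both steps together change |v_j| into the absolute value of |v_j| - |v_i| - |v_k|, which is
     smaller than |v_j| exactly under this condition. *)
  have [lt|ge] := boolP (`|vec g 0%R i| + `|vec g 0%R k| < 2 * `|vec g 0%R j|)%N.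
    have nst : (nrm (g * xs i j b * xs k j c) <= N)%N.
      have := nrm_x (g * xs i j b) c kl; have := nrm_x g b ij.
      rewrite !vec_x eqxx ij (negPf kj) /= addr0.
      by case: b {p1 n1} ei; case: c {p2 n2} ek => /=; lia.
    have e : g * xs i j b * xs k j c = g * xs k j c * xs i j b.
      by rewrite -!mulgA; congr (_ * _); apply: xs_commute; rewrite // eq_sym.
    apply: (@conn_trans _ _ (g * xs i j b * xs k j c)).
      by apply: conn_step => //; exact: step_x.
    rewrite e in nst *; apply/conn_sym/conn_step => //; exact: step_x.
  (* Otherwise the three entries have the same absolute value, so entry [i] can be cleared by entry
     [j] instead and [conn_chain] applies. *)
  have p3 : proper j i b g.
    split=> //; first by rewrite eq_sym.
      by apply/negP => /eqP v0'; move: ei vi; rewrite v0'; lia.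
    by move: ge; case: b {p1 n1} ei; case: c {p2 n2} ek => /=; lia.
  apply: (conn_trans (conn_pair iJ jJ ij n1 (proper_lt p3 gN))).
  by apply/conn_sym/(conn_chain p2 p3) => //; rewrite eq_sym.
have [jkE|jk] := eqVneq j k; last first.
  have [ilE|il] := eqVneq i l; last exact: conn_commuting.
  by subst l; apply/conn_sym/conn_chain => //; rewrite eq_sym.
subst k; have [ilE|il] := eqVneq i l; last exact: conn_chain.
subst l; suff bc : b = c by rewrite -bc in p2 n2 *; exact: conn_pair.
by case: b {p1 n1} ei; case: c {p2 n2} ek => //=; lia.
Qed.

Definition good g := (forall i, i \notin J -> vec g 0%R i = 0%R) /\
  exists u : 'cV[int]_n, (vec g *m u) 0%R 0%R = 1%R.

Lemma goodM g h : step h -> good g -> good (g * h).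
Proof.
move=> hs [gJ [u gu]]; split; last first.
  by exists (SLZval (q h)^-1 *m u); rewrite vecM mulmxA -(mulmxA (vec g)) -SLZ_valM mulgV mulmx1.
move=> l lJ; case: hs => i j => [b|] iJ jJ ij.
  rewrite vec_x gJ// add0r; case: eqP => [lj|//].
  by rewrite lj jJ in lJ.
have lij : tperm i j l = l.
  by rewrite tpermD//; apply: contraNneq lJ => <-.
have ws := wt_signed i j; rewrite -q_weyl in ws.
by rewrite -{1}lij (vec_sp _ _ ws) gJ// mulr0.
Qed.

(** A unimodular row with a single nonzero entry has norm 1. *)
Lemma good_two g : good g -> (2 <= nrm g)%N ->
  exists i j, [/\ i \in J, j \in J, i != j, vec g 0%R i != 0%R & vec g 0%R j != 0%R].
Proof.
move=> [gJ [u gu]] g2; apply: contrapT => none.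
have inJ i : vec g 0%R i != 0%R -> i \in J by apply: contraNT => /gJ ->.
have [i vi] : exists i, vec g 0%R i != 0%R.
  apply: contrapT => all0; move: gu; rewrite mxE big1// => i _.
  suff -> : vec g 0%R i = 0%R by rewrite mul0r.
  by apply/eqP/negP => /negP vi; apply: all0; exists i.
have other j : j != i -> vec g 0%R j = 0%R.
  move=> ji; apply/eqP/negP => /negP vj; apply: none; exists i, j.
  by split=> //; [exact: inJ|exact: inJ|rewrite eq_sym].
move: gu g2; rewrite mxE (bigD1 i)//= big1 => [|j /other ->]; last by rewrite mul0r.
rewrite addr0 /nrm (bigD1 i)//= big1 => [|j /other ->]; last by rewrite absz0.
by move=> /(congr1 absz); rewrite abszM addn0 => /eqP; rewrite muln_eq1 => /andP[/eqP-> _].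
Qed.

Lemma proper_of_pair g i j : i \in J -> j \in J -> i != j ->
  vec g 0%R i != 0%R -> vec g 0%R j != 0%R ->
  exists c, proper i j c g \/ proper j i c g.
Proof.
move=> iJ jJ ij vi vj; have ji : j != i by rewrite eq_sym.
have [lt|lt] := leqP `|vec g 0%R i| `|vec g 0%R j|;
  have [s|s] := boolP (0%R <= vec g 0%R i * vec g 0%R j)%R.
- by exists true; left; split=> //=; rewrite mulN1r; nia.
- by exists false; left; split=> //=; rewrite mul1r; nia.
- by exists true; right; split=> //=; rewrite mulN1r; nia.
- by exists false; right; split=> //=; rewrite mul1r; nia.
Qed.

Lemma exists_proper g : good g -> (2 <= nrm g)%N -> exists i j c, proper i j c g.
Proof.
move=> gg g2; have [i [j [iJ jJ ij vi vj]]] := good_two gg g2.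
by have [c [p|p]] := proper_of_pair iJ jJ ij vi vj; [exists i, j, c|exists j, i, c].
Qed.

(** If |v_i| > |v_j| and the step shortens entry [j], then adding entry [j] to entry [i] with the
    same sign is proper; [conn_pair] links the two results. *)
Lemma decreasing_proper N g i j b : i \in J -> j \in J -> i != j ->
  nrm g = N.+1 -> (nrm (g * xs i j b) <= N)%N ->
  exists k l c, proper k l c g /\ conn N (g * xs i j b) (g * xs k l c).
Proof.
move=> iJ jJ ij gN gsN; have ji : j != i by rewrite eq_sym.
have nx := nrm_x g b ij.
have [le|lt] := leqP `|vec g 0%R i| `|vec g 0%R j|.
  exists i, j, b; split; last exact: conn0.
  by split=> //; case: b gsN nx => /=; lia.
have p : proper j i b g by split=> //; case: b gsN nx => /=; lia.
by exists j, i, b; split=> //; apply: conn_pair => //; apply: proper_lt p _; rewrite gN.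
Qed.

Lemma mulg_conjgr g (h u : E) : g * u * h = g * h * u ^ h.
Proof. by rewrite -!mulgA; congr (_ * _); exact: conjgC. Qed.

(* In the last case the entries are [v_i = - 2 (-1)^b v_j]; the two reduced
   vectors then differ by a signed permutation. *)
Lemma conn_neutral N g (s : E) : good g -> (1 <= N)%N -> step s ->
  nrm g = N.+1 -> nrm (g * s) = N.+1 ->
  exists i j b i' j' b', [/\ proper i j b g, proper i' j' b' (g * s) &
    conn N (g * xs i j b) (g * s * xs i' j' b')].
Proof.
move=> gg N1 ss gN gsN; have g2 : (2 <= nrm g)%N by rewrite gN.
case: ss gsN => i j => [b|] iJ jJ ij gsN.
  have ji : j != i by rewrite eq_sym.
  have [vi0|vi] := eqVneq (vec g 0%R i) 0%R; last first.
    have nx := nrm_x g b ij.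
    have p1 : proper j i b g.
      by split=> //; [|]; case: b gsN nx => /=; lia.
    have p2 : proper j i (~~ b) (g * xs i j b).
      split=> //; rewrite !vec_x eqxx ij ?(negPf ij) /=;
      by case: b gsN nx p1 => /= ? ? _; lia.
    exists j, i, b, j, i, (~~ b); split=> //.
    have e : g * xs i j b * xs j i (~~ b) =
        g * xs j i b * (if b then w_ j i else w_ i j).
      rewrite -!mulgA; congr (_ * _).
      case: b {p1 p2 nx gsN} => /=.
        by rewrite w_def -[xs j i true](xsV j i false) -!mulgA mulKg.
      by rewrite w_alt -[xs j i false](xsV j i true) -!mulgA mulKg.
    rewrite e; apply: conn_step.
    - by case: b {e p1 p2 gsN nx}; exact: step_w.
    - by apply: proper_lt p1 _; rewrite gN.
    - by rewrite -e; apply: proper_lt p2 _; rewrite gsN.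
  have same h l c : vec h 0%R i = 0%R -> vec (h * xs i l c) = vec h.
    move=> h0; apply/rowP => k; rewrite [LHS]vec_x h0 mulr0.
    by case: ifP => _; rewrite addr0.
  have nsame h l c : vec h 0%R i = 0%R -> nrm (h * xs i l c) = nrm h.
    by move=> h0; rewrite /nrm same.
  have [k [l [kJ lJ kl vk vl]]] := good_two gg g2.
  (* Entry [i] is zero, so [s] does not move the vector; a proper step avoiding [i] is proper before
     and after [s], and a commutator with [s] is again a factor from row [i], which fixes the
     vector. *)
  have [p [r [c [pr_pr pi ri]]]] : exists p r c, [/\ proper p r c g, p != i & r != i].
    have ki : k != i by apply: contraNneq vk => ->; rewrite vi0.
    have li : l != i by apply: contraNneq vl => ->; rewrite vi0.
    have [c [h|h]] := proper_of_pair kJ lJ kl vk vl.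
      by exists k, l, c.
    by exists l, k, c.
  have pr' : proper p r c (g * xs i j b) by case: pr_pr => *; split; rewrite ?same.
  exists p, r, c, p, r, c; split=> //.
  have ltN := proper_lt pr_pr (eq_leq gN).
  have t0 : vec (g * xs p r c) 0%R i = 0%R.
    by rewrite vec_x vi0 [i == r]eq_sym (negPf ri) addr0.
  have [pj|pj] := eqVneq p j; last first.
    have -> : g * xs i j b * xs p r c = g * xs p r c * xs i j b.
      by rewrite -!mulgA; congr (_ * _); apply: xs_commute; rewrite eq_sym.
    by apply: conn_step; rewrite ?nsame//; exact: step_x.
  subst p; case: (pr_pr) => _ rJ jr _ _.
  have -> : g * xs i j b * xs j r c = g * xs j r c * xs i j b * xs i r (b (+) c).
    by rewrite -!mulgA; congr (_ * _); rewrite commgC xs_commg// ?mulgA// eq_sym.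
  apply: (@conn_trans _ _ (g * xs j r c * xs i j b)).
    by apply: conn_step; rewrite ?nsame//; exact: step_x.
  apply: conn_step; rewrite ?nsame ?same//.
  by apply: step_x; rewrite // eq_sym.
have [p [r [c pr]]] := exists_proper gg g2.
have ws := wt_signed i j; rewrite -q_weyl in ws.
exists p, r, c, (tperm i j p), (tperm i j r),
  (c (+) ((p == j) && (i != j)) (+) ((r == j) && (i != j))); split=> //.
- case: (pr) => pJ rJ prn vp e.
  have tJ k : k \in J -> tperm i j k \in J by case: tpermP.
  split; rewrite ?tJ ?(inj_eq perm_inj)// !(vec_sp _ _ ws) ?mulf_neq0 ?signr_eq0//.
  rewrite !signr_addb !abszMsign -e; congr (_ + _)%N.
  move: (_ && _) (_ && _) => d d'; case: d; case: d'; case: (c) => /=; lia.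
- rewrite -xs_w -mulg_conjgr; apply: conn_step; rewrite ?nrm_w.
  + exact: step_w.
  + by apply: proper_lt pr _; rewrite gN.
  + by apply: proper_lt pr _; rewrite gN.
Qed.

Definition reduction N g (t : E) := (nrm g <= N)%N /\ t = 1 \/
  nrm g = N.+1 /\ exists i j b, proper i j b g /\ t = xs i j b.

Lemma conn_reduction N g (t u : E) : reduction N g t -> reduction N g u ->
  conn N (g * t) (g * u).
Proof.
case=> [[gN ->]|[gN [i [j [b [p1 ->]]]]]]; case=> [[gN' ->]|[gN' [k [l [c [p2 ->]]]]]].
- exact: conn0.
- by rewrite gN' ltnn in gN.
- by rewrite gN ltnn in gN'.
- by apply: conn_proper => //; rewrite gN.
Qed.

Lemma exists_reduction N g : good g -> (1 <= N)%N -> (nrm g <= N.+1)%N ->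
  exists t, reduction N g t.
Proof.
move=> gg N1; rewrite leq_eqVlt => /orP[/eqP gN|gN]; last by exists 1; left.
have [i [j [c p]]] : exists i j c, proper i j c g by apply: exists_proper => //; rewrite gN.
by exists (xs i j c); right; split=> //; exists i, j, c.
Qed.

(** Four cases, according to which ends of the step have norm N + 1; a step up is a step down read
    backwards. *)
Lemma conn_reduction_step N g (s t u : E) : good g -> (1 <= N)%N -> step s ->
  (nrm g <= N.+1)%N -> (nrm (g * s) <= N.+1)%N ->
  reduction N g t -> reduction N (g * s) u -> conn N (g * t) (g * s * u).
Proof.
move=> gg N1 ss gN gsN rt ru.
have down h s' t' u' : step s' -> nrm h = N.+1 -> (nrm (h * s') <= N)%N ->
    reduction N h t' -> reduction N (h * s') u' -> conn N (h * t') (h * s' * u').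
  move=> ss' hN hsN rt' [[_ ->]|[e _]]; last by rewrite e ltnn in hsN.
  rewrite mulg1; case: ss' hsN => i j => [b|] iJ jJ ij hsN; last first.
    by rewrite nrm_w hN ltnn in hsN.
  have [k [l [c [p pc]]]] := decreasing_proper iJ jJ ij hN hsN.
  apply: conn_trans (conn_sym pc); apply: conn_reduction => //.
  by right; split=> //; exists k, l, c.
move: gN gsN; rewrite leq_eqVlt ltnS => /orP[/eqP gN|gN];
  rewrite leq_eqVlt ltnS => /orP[/eqP gsN|gsN].
- have [i [j [b [i' [j' [b' [p p' c]]]]]]] := conn_neutral gg N1 ss gN gsN.
  apply: (@conn_trans _ _ (g * xs i j b)).
    by apply: conn_reduction => //; right; split=> //; exists i, j, b.
  apply: (conn_trans c); apply: conn_reduction => //.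
  by right; split=> //; exists i', j', b'.
- exact: down.
- apply: conn_sym; have := down (g * s) s^-1 u t (stepV ss) gsN.
  by rewrite mulgK; exact.
- case: rt => [[_ ->]|[e _]]; last by rewrite e ltnn in gN.
  case: ru => [[_ ->]|[e _]]; last by rewrite e ltnn in gsN.
  by rewrite !mulg1; exact: conn_step.
Qed.

Lemma conn_good N g h : conn N g h -> good g -> good h.
Proof. by elim=> // {}h s _ IH ss _ _ gg; apply: goodM ss (IH gg). Qed.

(* Each element of norm [N + 1] on a chain is replaced by a reduction of it. *)
Lemma conn_descend N g h (t u : E) : good g -> (1 <= N)%N -> conn N.+1 g h ->
  reduction N g t -> reduction N h u -> conn N (g * t) (h * u).
Proof.
move=> gg N1 gh rt; elim: gh u => [|{}h s gh IH ss hN hsN] u ru.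
  exact: conn_reduction.
have hg := conn_good gh gg.
have [r rr] := exists_reduction hg N1 hN.
exact: conn_trans (IH r rr) (conn_reduction_step hg N1 ss hN hsN rr ru).
Qed.

(** The level can be lowered from N + 1 to N as long as N + 1 >= 2, since a unimodular row of that
    norm admits a proper step. *)
Lemma conn_one N g h : good g -> (nrm g <= 1)%N -> (nrm h <= 1)%N ->
  conn N g h -> conn 1 g h.
Proof.
move=> gg g1 h1; elim: N => [|N IH]; first exact: conn_le.
case: N IH => [_|N IH gh]; first by [].
apply: IH; rewrite -(mulg1 g) -(mulg1 h); apply: conn_descend => //.
  by left; split=> //; exact: leq_trans g1 _.
by left; split=> //; exact: leq_trans h1 _.
Qed.

End peak_reduction.

(** Inverses are not built in: the generating sets [elts] are closed under inversion, see
    [gen_eltsV]. *)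
Inductive gen (S : E -> Prop) : E -> Prop :=
  | gen_one : gen S 1
  | gen_mulr x s : gen S x -> S s -> gen S (x * s).

Lemma gen_mul S x y : gen S x -> gen S y -> gen S (x * y).
Proof.
move=> Sx; elim=> [|z s _ IH Ss]; first by rewrite mulg1.
by rewrite mulgA; exact: gen_mulr.
Qed.

Lemma gen_sub (S S' : E -> Prop) x : (forall s, S s -> S' s) -> gen S x -> gen S' x.
Proof. by move=> SS'; elim=> [|z s _ IH /SS']; [exact: gen_one|exact: gen_mulr]. Qed.

Lemma gen_in (S : E -> Prop) s : S s -> gen S s.
Proof. by move=> Ss; rewrite -[s]mul1g; apply: gen_mulr => //; exact: gen_one. Qed.

Lemma weyl_conj g (s : {perm 'I_n}) e i j : signed_perm (q g) s e ->
  w_ i j ^ g = sgx (w_ (s i) (s j)) (e i (+) e j).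
Proof.
move=> gs; rewrite !w_def !conjMg !(xs_conj _ _ _ gs).
by case: (e i); case: (e j); rewrite //= !invMg !xsV mulgA.
Qed.

Lemma w_mul_sgx i j b : sgx (w_ i j) b * sgx (w_ i j) b = w_ i j * w_ i j.
Proof. by case: b => //=; rewrite -invMg; apply: mulg1_eq; exact: w_mul4. Qed.

Lemma w_signed i j : signed_perm (q (w_ i j)) (tperm i j) (fun l => (l == j) && (i != j)).
Proof. by rewrite q_weyl; exact: wt_signed. Qed.

Lemma w2_signed i j : signed_perm (q (w_ i j * w_ i j)) 1 (fun l => (l == i) (+) (l == j)).
Proof. by rewrite qM q_weyl; exact: dt_signed. Qed.

(** With [J :\ b] as row indices these elements fix the row vector e_b; with [[set b]] as column
    indices, and [b] not among the row indices, they commute. *)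
Definition elts (I J : {set 'I_n}) x := exists i j b,
  [/\ i \in I, j \in J, i != j & x = xs i j b].

Lemma gen_eltsV (I J : {set 'I_n}) x : gen (elts I J) x -> gen (elts I J) x^-1.
Proof.
elim=> [|y s _ IH [i [j [c [iI jJ ij ->]]]]]; first by rewrite invg1; exact: gen_one.
rewrite invMg xsV; apply: gen_mul => //; apply: gen_in.
by exists i, j, (~~ c).
Qed.

(** * Chains through vectors of norm at most one *)

Section norm_one.
Variables (J : {set 'I_n}) (b : 'I_n).
Hypothesis bJ : b \in J.

Local Notation P := (gen (elts (J :\ b) J)).

(* Signed permutations sending the [b]-th basis row vector to each [+/- e_j]. *)
Definition transversal r := r = 1 \/ exists j, [/\ j \in J, j != b &
  [\/ r = w_ b j, r = (w_ b j)^-1 | r = w_ b j * w_ b j]].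

Lemma P_w k l c : k \in J -> l \in J -> k != l -> k != b -> l != b ->
  P (sgx (w_ k l) c).
Proof.
have Pw k' l' : k' \in J -> l' \in J -> k' != l' -> k' != b -> l' != b -> P (w_ k' l').
  move=> kJ lJ kl kb lb; rewrite w_def.
  apply: gen_mul; [apply: gen_mul|]; apply: gen_in.
  - by exists k', l', false; split=> //; rewrite !inE kb.
  - by exists l', k', true; split=> //; rewrite ?inE ?lb// eq_sym.
  - by exists k', l', false; split=> //; rewrite !inE kb.
by move=> *; case: c => /=; rewrite -?weyl_sym; apply: Pw; rewrite // eq_sym.
Qed.

(** Lifted form of [dtM]: conjugation by [w_ b l] carries the square of [w_ b j] to that of
    [w_ l j], while the square of [w_ b j] inverts [w_ b l]. *)
Lemma w2M j l : j != b -> l != b -> j != l ->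
  w_ b l * w_ b l * (w_ b j * w_ b j) = w_ l j * w_ l j.
Proof.
move=> jb lb jl; have bj : b != j by rewrite eq_sym.
have e1 : (w_ b j * w_ b j) ^ w_ b l = w_ l j * w_ l j.
  by rewrite conjMg (weyl_conj _ _ (w_signed b l)) w_mul_sgx tpermL tpermD// eq_sym.
have e2 : w_ b l ^ (w_ b j * w_ b j) = (w_ b l)^-1.
  rewrite (weyl_conj _ _ (w2_signed b j)) !perm1 eqxx (negPf bj) (negPf lb).
  by rewrite eq_sym (negPf jl).
rewrite -e1; set W := w_ b j * w_ b j in e2 *; clearbody W.
have e3 : W * w_ b l = (w_ b l)^-1 * W.
  by rewrite -{1}(mulKg (w_ b l) W) [w_ b l * W]conjgC e2 mulgA mulgVK.
by rewrite -(w_mul_sgx b l true) /= /conjg e3 mulgA.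
Qed.

(** A Weyl element avoiding [b] lies in [P] and permutes the transversal by conjugation. One
    involving [b] is absorbed by conjugating it with [r], by [w2M] when [r] is a square, or by
    [w_mul4] when both lie over the same transposition. *)
Lemma transversal_mulw r k l : transversal r -> k \in J -> l \in J -> k != l ->
  exists p r', [/\ P p, transversal r' & r * w_ k l = p * r'].
Proof.
move=> rR kJ lJ kl.
have tb i j : i \in J -> j \in J -> i != b -> j != b -> i != j ->
    transversal r -> exists p r', [/\ P p, transversal r' & r * w_ i j = p * r'].
  move=> iJ jJ ib jb ij; case=> [->|[m [mJ mb mr]]].
    exists (w_ i j), 1; split; [exact: (@P_w i j false)|by left|by rewrite (mul1g (w_ i j)) (mulg1 (w_ i j))].
  exists (w_ i j), (r ^ w_ i j); split; [exact: (@P_w i j false)| |exact: conjgC].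
  have tm := w_signed i j.
  have bb : tperm i j b = b by rewrite tpermD.
  right; exists (tperm i j m); split; first by case: tpermP.
    by rewrite -[X in _ != X]bb (inj_eq perm_inj).
  have e : w_ b m ^ w_ i j = sgx (w_ b (tperm i j m)) ((m == j) && (i != j)).
    by rewrite (weyl_conj _ _ tm) bb [b == j]eq_sym (negPf jb).
  case: mr => ->; rewrite ?conjVg ?conjMg e ?w_mul_sgx.
  - by case: (_ && _); [apply: Or32|apply: Or31].
  - by case: (_ && _); rewrite /= ?invgK; [apply: Or31|apply: Or32].
  - exact: Or33.
have tw c m : m \in J -> m != b ->
    exists p r', [/\ P p, transversal r' & r * sgx (w_ b m) c = p * r'].
  move=> mJ mb; case: rR => [->|[j [jJ jb jr]]].
    exists 1, (sgx (w_ b m) c); split; rewrite ?mul1g//; first exact: gen_one.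
    right; exists m; split=> //; case: c; [exact: Or32|exact: Or31].
  have w4 := w_mul4 b j.
  have [jm|jm] := eqVneq j m.
    subst m; exists 1, (r * sgx (w_ b j) c); rewrite mul1g; split=> //; first exact: gen_one.
    have w3 : w_ b j * w_ b j * w_ b j = (w_ b j)^-1.
      by apply: (mulIg (w_ b j)); rewrite mulVg -w4 !mulgA.
    have wV2 := w_mul_sgx b j true; rewrite /= in wV2.
    case: jr => ->; case: c => /=; rewrite ?mulgV ?mulVg; try by left.
    - by right; exists j; split=> //; exact: Or33.
    - by right; exists j; split=> //; rewrite wV2; exact: Or33.
    - by right; exists j; split=> //; rewrite mulgK; exact: Or31.
    - by right; exists j; split=> //; rewrite w3; exact: Or32.
  have bj : b != j by rewrite eq_sym.
  have bm : b != m by rewrite eq_sym.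
  have mj : m != j by rewrite eq_sym.
  have cjw s d : s \in J -> s != b -> s != j ->
      w_ b s ^ sgx (w_ b j) d = sgx (w_ j s) d.
    move=> sJ sb sj; have sj' : j != s by rewrite eq_sym.
    have bs : b != s by rewrite eq_sym.
    case: d => /=.
      have tm := signed_permV (w_signed b j); rewrite -(qV qM) in tm.
      rewrite (weyl_conj _ _ tm) tpermV tpermL tpermD// eqxx bj.
      by rewrite (negPf sj).
    by rewrite (weyl_conj _ _ (w_signed b j)) tpermL tpermD// (negPf bj) (negPf sj).
  case: jr => rE.
  - exists (sgx (w_ j m) (~~ c)), r; split; first exact: P_w.
      by right; exists j; split=> //; exact: Or31.
    have := cjw m true mJ mb mj; rewrite -[sgx _ true]/((w_ b j)^-1) -rE => e.
    by rewrite [LHS]conjgCV sgxJ e sgx_sgx.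
  - exists (sgx (w_ j m) c), r; split; first exact: P_w.
      by right; exists j; split=> //; exact: Or32.
    have := cjw m false mJ mb mj; rewrite -[sgx _ false]invgK -rE => e.
    by rewrite [LHS]conjgCV sgxJ e.
  - exists (w_ j m * w_ j m), (sgx (w_ b m) (~~ c)); split.
    + by apply: gen_mul; apply: (@P_w j m false).
    + by right; exists m; split=> //; case: (c); [exact: Or31|exact: Or32].
    + rewrite -(w2M mb jb mj) rE -!mulgA; congr (_ * (_ * _)).
      case: (c) => /=; last by rewrite mulgV mulg1.
      by apply: mulg1_eq; have := w_mul4 b m; rewrite -!mulgA.
have [kb|kb] := eqVneq k b.
  by subst k; apply: (tw false); rewrite // eq_sym.
have [lb|lb] := eqVneq l b; last exact: tb.
subst l; rewrite -[w_ k b]invgK -weyl_sym; exact: (tw true).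
Qed.

Lemma transversalV r : transversal r -> transversal r^-1.
Proof.
case=> [->|[j [jJ jb jr]]]; first by left; rewrite invg1.
right; exists j; split=> //; case: jr => ->.
- exact: Or32.
- by rewrite invgK; exact: Or31.
- by rewrite invMg; apply: Or33; exact: (w_mul_sgx b j true).
Qed.

Lemma transversal_signed r : transversal r -> exists s e,
  signed_perm (q r) s e /\ forall i, i \in J -> s i \in J.
Proof.
have tJ j : j \in J -> forall i, i \in J -> tperm b j i \in J.
  by move=> jJ i iJ; case: tpermP.
case=> [->|[j [jJ jb [] ->]]].
- by exists 1, (fun=> false); rewrite (q1 qM); split=> [|i]; [exact: signed_perm1|rewrite perm1].
- by exists (tperm b j); eexists; split; [exact: w_signed|exact: tJ].
- exists (tperm b j)^-1; eexists; split; last by rewrite tpermV; exact: tJ.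
  rewrite (qV qM); exact: (signed_permV (w_signed b j)).
- by exists 1; eexists; split=> [|i]; [exact: w2_signed|rewrite perm1].
Qed.

Local Notation v0 := (delta_mx 0%R b : 'rV[int]_n).

Lemma v0b : v0 0%R b = 1%R. Proof. by rewrite mxE !eqxx. Qed.

Lemma v0D i : i != b -> v0 0%R i = 0%R.
Proof. by move=> /negPf ib; rewrite mxE ib andbF. Qed.

Lemma transversal_fix r : transversal r -> (v0 *m SLZval (q r)) 0%R b = 1%R -> r = 1.
Proof.
case=> [//|[j [jJ jb [] ->]]].
- have := w_signed b j v0 j; rewrite tpermR v0D// mulr0 => ->; by move/eqP.
- have := signed_permV (w_signed b j) v0 j; rewrite -(qV qM) tpermV tpermR v0D// mulr0 => ->; by move/eqP.
- have := w2_signed b j v0 b; rewrite perm1 eqxx eq_sym (negPf jb) v0b => ->; by move/eqP.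
Qed.

Lemma P_fix p : P p -> vec v0 p = v0.
Proof.
elim=> [|x s _ IH [i [j [c [iJ jJ ij ->]]]]]; first by rewrite /vec (q1 qM) mulmx1.
apply/rowP => l; rewrite [LHS]vec_x IH; case: ifP => _; last by rewrite addr0.
by rewrite (v0D (i := i)) ?mulr0 ?addr0//; move: iJ; rewrite !inE => /andP[].
Qed.

(** At norm 1 a row is some +-e_j, so a step [xs i j c] within norm 1 requires a zero at position
    [i]; conjugated past [r], it then has row index different from [b] and falls into [P]. *)
Lemma conn_one_form g : conn J v0 1 1 g ->
  exists p r, [/\ P p, transversal r & g = p * r].
Proof.
elim=> [|h x _ [p [r [Pp tr ->]]]].
  by exists 1, 1; split; [exact: gen_one|left|rewrite mulg1].
case=> i j => [c|] iJ jJ ij h1 hx1; last first.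
  have [p' [r' [Pp' tr' e]]] := transversal_mulw tr iJ jJ ij.
  by exists (p * p'), r'; split=> //; [exact: gen_mul|rewrite -mulgA e mulgA].
have [s [e [rs sJ]]] := transversal_signed (transversalV tr).
have xE := xs_conj i j c rs.
have sib : s i != b.
  apply/eqP => sib.
  have vE k : (v0 0%R (s k) = (-1) ^+ e k * vec v0 (p * r) 0 k)%R.
    by rewrite -(vec_sp _ _ _ rs) mulgK P_fix.
  have vj : vec v0 (p * r) 0%R j = 0%R.
    have : v0 0%R (s j) = 0%R.
      by apply: v0D; rewrite -sib (inj_eq perm_inj) eq_sym.
    by rewrite vE => /eqP; rewrite mulf_eq0 signr_eq0 => /eqP.
  have vi : absz (vec v0 (p * r) 0%R i) = 1%N.
    by have := vE i; rewrite sib v0b => /(congr1 absz); rewrite abszMsign => <-.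
  have := nrm_x v0 (p * r) c ij; rewrite vj add0r abszMsign vi /= => nx.
  have : (0 < nrm v0 (p * r))%N by rewrite /nrm (bigD1 i)//= vi.
  by move: nx hx1; clear; lia.
exists (p * xs i j c ^ r^-1), r; split=> //; last first.
  by rewrite -mulgA [r * _]conjgCV [LHS]mulgA.
apply: gen_mul => //; rewrite xE; apply: gen_in.
by exists (s i), (s j); eexists; rewrite !inE sib !sJ// (inj_eq perm_inj).
Qed.

End norm_one.

Lemma gen_conn J v0 g : gen (elts J J) g -> exists N, conn J v0 N 1 g.
Proof.
elim=> [|x s _ [N IH] [i [j [c [iJ jJ ij ->]]]]]; first by exists 0%N; exact: conn0.
exists (maxn N (maxn (nrm v0 x) (nrm v0 (x * xs i j c)))).
apply: connS; rewrite ?leq_max ?leqnn ?orbT//; last exact: step_x.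
by apply: conn_le IH; rewrite leq_max leqnn.
Qed.

(** Semidirect decomposition inside the stabilizer of e_b: by the commutator relations, the elements
    on [J :\ b] normalize the column [b] part. *)
Lemma elts_split (J : {set 'I_n}) (b : 'I_n) p : gen (elts (J :\ b) J) p ->
  exists h u, [/\ gen (elts (J :\ b) (J :\ b)) h, gen (elts (J :\ b) [set b]) u & p = h * u].
Proof.
elim=> [|x s _ [h [u [hJ uJ ->]]] [i [j [c [iJ jJ ij ->]]]]].
  by exists 1, 1; split; [exact: gen_one|exact: gen_one|rewrite mulg1].
have ib : i != b by move: iJ; rewrite !inE => /andP[].
have [jb|jb] := eqVneq j b.
  exists h, (u * xs i j c); split; rewrite ?mulgA//; apply: gen_mulr => //.
  by exists i, j, c; split=> //; rewrite inE jb.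
exists (h * xs i j c), (u ^ xs i j c); split.
- by apply: gen_mulr => //; exists i, j, c; rewrite !inE jb jJ -in_setD1.
- elim: uJ => [|y s' _ IH [l [b' [d [lJ b'b lb ->]]]]].
    by rewrite conj1g; exact: gen_one.
  rewrite conjMg; apply: gen_mul => //; move: b'b; rewrite inE => /eqP b'E; subst b'.
  have [ljE|lj] := eqVneq l j; last first.
    rewrite commute_conjg; last by apply: xs_commute; rewrite // eq_sym.
    by apply: gen_in; exists l, b, d; rewrite set11.
  subst l; rewrite -[xs j b d ^ _](mulVKg (xs j b d)) -commgEl.
  rewrite -invgR xs_commg// xsV; apply: gen_mul; apply: gen_in.
    by exists j, b, d; rewrite set11.
  by exists i, b, (~~ (c (+) d)); rewrite set11.
- by rewrite -!mulgA; congr (_ * _); exact: conjgC.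
Qed.

(** The generators commute, so inversion is multiplicative on what they generate and agrees with
    conjugation once it does on generators. *)
Lemma gen_inverted S g y : (forall s t, S s -> S t -> commute s t) ->
  (forall s, S s -> s ^ g = s^-1) -> gen S y -> y ^ g = y^-1.
Proof.
move=> Sc Sg; suff h : gen S y -> y ^ g = y^-1 /\ forall s, S s -> commute s y by move=> /h[].
elim=> [|x s _ [IH xc] Ss]; first by rewrite conj1g invg1; split=> // s _; exact: commute1.
split; first by rewrite conjMg IH Sg// -invMg xc.
by move=> t St; apply: commuteM; [exact: xc|exact: Sc].
Qed.

(** * Injectivity of [q] on the subgroup generated by the lifts *)

Hypothesis n3 : (3 <= n)%N.
Hypothesis q_surj : forall a : SLZ n, exists x, q x = a.
Hypothesis q_selfinv : forall z g, q z = 1 -> z ^ g = z^-1 -> z = 1.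

(* The group is abelian and a diagonal matrix inverts its generators, so every
   central element in it is its own inverse. *)
Lemma column_kernel (L : {set 'I_n}) (b : 'I_n) u : b \notin L -> gen (elts L [set b]) u -> q u = 1 -> u = 1.
Proof.
move=> bL uL u1.
have Lcomm (L' L'' : {set 'I_n}) s t : b \notin L' -> b \notin L'' ->
    elts L' [set b] s -> elts L'' [set b] t -> commute s t.
  move=> bL' bL'' [i [b' [c [iL + ib ->]]]] [j [b'' [d [jL + jb ->]]]].
  rewrite !inE => /eqP -> /eqP ->; apply: xs_commute; first by apply: contraNneq bL'' => ->.
  by apply: contraNneq bL' => <-.
have gen_commute (L' L'' : {set 'I_n}) x y : b \notin L' -> b \notin L'' -> gen (elts L' [set b]) x ->
    gen (elts L'' [set b]) y -> commute x y.
  move=> bL' bL'' xL yL; apply: commute_sym; elim: xL => [|x' s _ IH Ss]; first exact: commute1.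
  apply: commuteM => //; apply: commute_sym; elim: yL => [|y' t _ IH' St]; first exact: commute1.
  by apply: commuteM => //; exact: (Lcomm L' L'').
have inv (L' : {set 'I_n}) m y : b \notin L' -> m != b -> m \notin L' -> gen (elts L' [set b]) y -> q y = 1 -> y = 1.
  move=> bL' mb mL' yL y1; have [g gE] := q_surj (dt b m).
  apply: (q_selfinv (g := g)) => //; apply: gen_inverted yL => s.
    by move=> t Ss St; exact: (Lcomm L' L').
  move=> [i [b' [c [iL + ib ->]]]]; rewrite inE => /eqP b'E; subst b'.
  have gs := dt_signed b m; rewrite -gE in gs; rewrite (xs_conj _ _ _ gs) !perm1 xsV; congr xs.
  have im : i != m by apply: contraNneq mL' => <-.
  by rewrite eqxx (negPf ib) (negPf im) eq_sym (negPf mb); case: (c).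
have act (L' : {set 'I_n}) y (v : 'rV[int]_n) : b \notin L' -> (forall i, i \in L' -> v 0%R i = 0%R) ->
    gen (elts L' [set b]) y -> v *m SLZval (q y) = v.
  move=> bL' vL; elim=> [|x s _ IH [i [b' [c [iL b'b ib ->]]]]].
    by rewrite (q1 qM) mulmx1.
  rewrite qM SLZ_valM mulmxA IH; apply/rowP => l; rewrite q_xs [LHS]eltE (vL i iL) mulr0.
  by case: ifP => _; rewrite addr0.
(* A diagonal sign matrix has an even number of entries -1, so inverting column [b] takes a second
   index outside [L], which may not exist. Splitting off one index [t] frees an index for each of
   the two factors. *)
have [t|L0] := pickP (mem L); last first.
  elim: uL {u1} => // x s _ _ [i [j [c [iL _ _ _]]]]; by have := L0 i; rewrite /= iL.
move=> tL; have tb : t != b by apply: contraNneq bL => <-.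
have bt : b \notin [set t] by rewrite inE eq_sym.
have bLt : b \notin L :\ t by rewrite !inE (negPf bL) andbF.
have [y [u' [yt u'L uE]]] : exists y u', [/\ gen (elts [set t] [set b]) y,
    gen (elts (L :\ t) [set b]) u' & u = y * u'].
  elim: uL {u1} => [|x s _ [y [u' [yt u'L ->]]] [i [b' [c [iL b'b ib sE]]]]].
    by exists 1, 1; split; [exact: gen_one|exact: gen_one|rewrite mulg1].
  have [iE|it] := eqVneq i t.
    have St : elts [set t] [set b] s by exists i, b', c; rewrite inE iE eqxx -iE.
    exists (y * s), u'; split=> //; first exact: gen_mulr.
    rewrite -!mulgA; congr (_ * _); apply: (gen_commute (L :\ t) [set t]) => //; exact: gen_in.
  have Su : elts (L :\ t) [set b] s by exists i, b', c; split=> //; rewrite !inE it.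
  by exists y, (u' * s); split=> //; [exact: gen_mulr|rewrite mulgA].
have [m yE] : exists m : int, forall (v : 'rV[int]_n) l,
    ((v *m SLZval (q y)) 0 l = v 0 l + (l == b)%:R * (m * v 0 t))%R.
  elim: yt {uE} => [|x s _ [m IH] [i [b' [c [+ + ib ->]]]]].
    by exists 0%R => v l; rewrite (q1 qM) mulmx1 mul0r mulr0 addr0.
  rewrite !inE => /eqP -> /eqP ->; exists (m + (-1) ^+ c)%R => v l.
  rewrite qM SLZ_valM mulmxA q_xs eltE !IH tb andbT (negPf tb) mul0r addr0.
  by case: eqP => _ /=; ring.
have m0 : m = 0%R.
  have e : (delta_mx 0%R t *m SLZval (q y)) *m SLZval (q u') = delta_mx 0%R t :> 'rV[int]_n.
    by rewrite -mulmxA -SLZ_valM -qM -uE u1 mulmx1.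
  have := congr1 (fun v : 'rV_n => v 0%R b) e; rewrite /= (act (L :\ t))//.
    by rewrite yE !mxE !eqxx (eq_sym b) (negPf tb) /= add0r mul1r mulr1.
  move=> i iL; rewrite yE !mxE; move: iL; rewrite !inE => /andP[/negPf it iL].
  have /negPf ib : i != b by apply: contraNneq bL => <-.
  by rewrite it ib eqxx /= mul0r addr0.
have y1 : q y = 1.
  by apply: SLZ_ext => v l; rewrite yE m0 mul0r mulr0 addr0 mulmx1.
have u'1 : q u' = 1 by move: u1; rewrite uE qM y1 mul1g.
have [k kt kb] := index_outside n3 t b.
have yE1 : y = 1 by apply: (inv [set t] k y bt kb _ yt y1); rewrite inE.
have u'E1 : u' = 1 by apply: (inv (L :\ t) t u' bLt tb _ u'L u'1); rewrite !inE eqxx.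
by rewrite uE yE1 u'E1 mulg1.
Qed.

(** A word for [g] is a chain for e_b whose ends have norm 1; once reduced it reads [p * r] with
    [r = 1], and [p] splits as [h * u]. As [u] only alters column [b] and [h] never does, [h] is
    itself in the kernel. Induction on the size of [J] handles [h], and [column_kernel] handles
    [u]. *)
Lemma gen_kernel (J : {set 'I_n}) g : gen (elts J J) g -> q g = 1 -> g = 1.
Proof.
have [m] := ubnP #|J|; elim: m J g => // m IH J g Jm gJ g1.
have [b bJ|J0] := pickP (mem J); last first.
  by elim: gJ {g1} => // x s _ _ [i [j [c [iL _ _ _]]]]; have := J0 i; rewrite /= iL.
have {}bJ : b \in J := bJ.
set v0 : 'rV[int]_n := delta_mx 0%R b.
have v1 h : q h = 1 -> vec v0 h = v0 by move=> h1; rewrite /vec h1 mulmx1.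
have n1 h : q h = 1 -> nrm v0 h = 1%N.
  move=> h1; rewrite /nrm v1// (bigD1 b)//= v0b big1 ?addn0// => i ib.
  by rewrite v0D.
have good1 : good J v0 1.
  rewrite /good v1 ?(q1 qM)//; split; first by move=> i iJ; rewrite v0D//; apply: contraNneq iJ => ->.
  by exists (delta_mx b 0%R); rewrite -rowE !mxE !eqxx.
have [N /conn_one] := gen_conn v0 gJ.
rewrite !n1 ?(q1 qM)// => /(_ good1 isT isT)/(conn_one_form bJ)[p [r [pP tr gE]]].
have r1 : r = 1.
  apply: (transversal_fix tr); rewrite -{1}(P_fix pP) -vecM -gE v1//; exact: v0b.
rewrite r1 mulg1 in gE; subst g.
have [h [u [hJ uJ pE]]] := elts_split pP.
have bJb : b \notin J :\ b by rewrite !inE eqxx.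
have h1 : q h = 1.
  apply: SLZ_ext => v l; rewrite mulmx1; have [->|lb] := eqVneq l b.
    elim: hJ {pE} => [|x s _ IHx [i [j [c [iJ jJ ij ->]]]]]; first by rewrite (q1 qM) mulmx1.
    rewrite qM SLZ_valM mulmxA q_xs eltE IHx; case: eqP => [bj|]; last by rewrite addr0.
    by rewrite -bj (negPf bJb) in jJ.
  have := congr1 (fun A : SLZ n => (v *m SLZval A) 0%R l) g1; rewrite /= mulmx1 pE qM SLZ_valM mulmxA => <-.
  elim: uJ {pE} => [|x s _ IHx [i [j [c [iJ jJ ij ->]]]]]; first by rewrite (q1 qM) mulmx1.
  rewrite qM SLZ_valM mulmxA q_xs eltE -IHx; case: eqP => [lj|]; last by rewrite addr0.
  by move: jJ; rewrite inE -lj (negPf lb).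
have hE : h = 1.
  by apply: IH hJ h1; move: Jm; rewrite (cardsD1 b) bJ.
rewrite pE hE mul1g; apply: column_kernel bJb uJ _.
by move: g1; rewrite pE qM h1 mul1g.
Qed.
End steinberg_generators.

(** * Generation of SL_n(Z) by elementary matrices *)

Section generation.
Variable n : nat.
Implicit Types (i j k l : 'I_n) (c : bool) (g p : SLZ n).

Section reduce_row.
Variables (J : {set 'I_n}) (b : 'I_n).
Hypothesis bJ : b \in J.

Local Notation H := (gen (elts (@elt n) J [set: 'I_n])).

(** Right multiplication by [elt i j c] with [i] in [K] respects this condition, since the rows
    outside [K] vanish at position [i]; rows can thus be cleared one at a time. *)
Definition standard_off (K : {set 'I_n}) g := forall i, i \notin K ->
  delta_mx 0 i *m SLZval g = delta_mx 0 i :> 'rV[int]_n.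

Lemma standard_offM g p : standard_off J g -> H p -> standard_off J (g * p)%g.
Proof.
move=> sg; elim=> [|x s _ IH [i [j [c [iJ _ ij ->]]]]]; first by rewrite mulg1.
move=> k kJ; rewrite mulgA SLZ_valM mulmxA IH//; apply/rowP => l; rewrite eltE.
have ki : i != k by apply: contraNneq kJ => <-.
by rewrite !mxE (negPf ki) andbF mulr0 if_same addr0.
Qed.

Definition rowb g : 'rV[int]_n := delta_mx 0 b *m SLZval g.

Lemma rowb_elt g i j c l : rowb (g * elt i j c)%g 0%R l =
  rowb g 0%R l + (if (l == j) && (i != j) then (-1) ^+ c * rowb g 0%R i else 0).
Proof. by rewrite /rowb SLZ_valM mulmxA eltE. Qed.

Lemma H_elt i j c : i \in J -> H (elt i j c).
Proof.
move=> iJ; have [->|ij] := eqVneq i j; first by rewrite elt_diag; exact: gen_one.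
by apply: gen_in; exists i, j, c; rewrite inE.
Qed.

Lemma H_wt i j : i \in J -> j \in J -> H (wt i j).
Proof. by move=> iJ jJ; apply: gen_mul; [apply: gen_mul|]; exact: H_elt. Qed.

Lemma H_dt i j : i \in J -> j \in J -> H (dt i j).
Proof. by move=> iJ jJ; apply: (gen_mul (H_wt iJ jJ) (H_wt iJ jJ)). Qed.

(** The rows of the inverse outside [J] are standard as well, so only indices in [J] contribute to
    the diagonal entry [b] of the product. *)
Lemma unimodular_on g : standard_off J g ->
  exists u : 'I_n -> int, \sum_(l in J) rowb g 0%R l * u l = 1.
Proof.
move=> sg; exists (fun l => SLZval g^-1%g l b).
have e : (rowb g *m SLZval g^-1%g) 0 b = 1.
  by rewrite /rowb -mulmxA -SLZ_valM mulgV mulmx1 !mxE !eqxx.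
rewrite -[RHS]e mxE [RHS](bigID (mem J)) /= [X in _ + X]big1 ?addr0// => l lJ.
have : delta_mx 0 l *m SLZval g^-1%g = delta_mx 0 l :> 'rV[int]_n.
  by rewrite -{1}(sg l lJ) -mulmxA -SLZ_valM mulgV mulmx1.
rewrite -rowE => /(congr1 (fun v : 'rV_n => v 0 b)); rewrite !mxE => ->.
by rewrite (_ : b == l = false) ?andbF ?mulr0//; apply: contraNF lJ => /eqP <-.
Qed.

(** Euclidean algorithm on the entries in [J]: the last nonzero one is a unit by [unimodular_on]. *)
Lemma reduce_inside g : standard_off J g -> exists p l, [/\ H p, l \in J,
  absz (rowb (g * p)%g 0%R l) = 1%N &
  forall k, k \in J -> k != l -> rowb (g * p)%g 0%R k = 0].
Proof.
have [m] := ubnP (\sum_(l in J) absz (rowb g 0%R l))%N; elim: m g => // m IH g gm sg.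
have [[i [j [iJ jJ ij [vi vj le]]]]|none] := pselect (exists i j, [/\ i \in J, j \in J, i != j &
    [/\ rowb g 0%R i != 0, rowb g 0%R j != 0 & (absz (rowb g 0%R i) <= absz (rowb g 0%R j))%N]]).
  have [c cE] : exists c, (absz (rowb g 0%R j + (-1) ^+ c * rowb g 0%R i)%R < absz (rowb g 0%R j))%N.
    have [s|s] := boolP (0%R <= rowb g 0%R i * rowb g 0%R j).
      by exists true; rewrite /= expr1 mulN1r; nia.
    by exists false; rewrite /= expr0 mul1r; nia.
  have [||p [l [Hp lJ pl p0]]] := IH (g * elt i j c)%g.
  - have e : (\sum_(l | (l \in J) && (l != j)) absz (rowb (g * elt i j c)%g 0%R l) =
              \sum_(l | (l \in J) && (l != j)) absz (rowb g 0%R l))%N.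
      by apply: eq_bigr => l /andP[_ lj]; rewrite rowb_elt (negPf lj) addr0.
    move: gm; rewrite (bigD1 j)//= [in X in _ -> X](bigD1 j)//= e rowb_elt eqxx ij /=.
    by rewrite ltnS; apply: leq_trans; rewrite ltn_add2r.
  - by apply: standard_offM => //; exact: H_elt.
  exists (elt i j c * p)%g, l; rewrite mulgA; split=> //.
  by apply: gen_mul => //; exact: H_elt.
have [u uE] := unimodular_on sg.
have [l lJ vl] : exists2 l, l \in J & rowb g 0%R l != 0.
  apply: contrapT => all0; move: uE; rewrite big1 => [/esym/eqP|l lJ].
    by rewrite oner_eq0.
  have [->|vl] := eqVneq (rowb g 0%R l) 0; first by rewrite mul0r.
  by exfalso; apply: all0; exists l.
have other k : k \in J -> k != l -> rowb g 0%R k = 0.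
  move=> kJ kl; apply/eqP/negP => /negP vk; apply: none.
  have [le|le] := leqP (absz (rowb g 0%R k)) (absz (rowb g 0%R l)).
    by exists k, l.
  by exists l, k; split=> //; [rewrite eq_sym|split=> //; exact: ltnW].
exists 1%g, l; rewrite mulg1; split=> //; first exact: gen_one.
move: uE; rewrite (bigD1 l)//= big1 ?addr0 => [|k /andP[kJ kl]]; last by rewrite other ?mul0r.
by move=> /(congr1 absz); rewrite abszM => /eqP; rewrite muln_eq1 => /andP[/eqP].
Qed.

Lemma reduce_outside g : absz (rowb g 0%R b) = 1%N -> exists p, [/\ H p,
  forall k, k \notin J -> rowb (g * p)%g 0%R k = 0 &
  forall k, k \in J -> rowb (g * p)%g 0%R k = rowb g 0%R k].
Proof.
have [m] := ubnP (\sum_(l | l \notin J) absz (rowb g 0%R l))%N; elim: m g => // m IH g gm gb.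
have [[j jJ vj]|none] := pselect (exists2 j, j \notin J & rowb g 0%R j != 0); last first.
  exists 1%g; rewrite mulg1; split=> //; first exact: gen_one.
  by move=> k kJ; apply/eqP/negP => /negP vk; apply: none; exists k.
have bj : b != j by apply: contraNneq jJ => <-.
have [c cE] : exists c, (absz (rowb g 0%R j + (-1) ^+ c * rowb g 0%R b)%R < absz (rowb g 0%R j))%N.
  have [s|s] := boolP (0%R <= rowb g 0%R b * rowb g 0%R j).
    by exists true; rewrite /= expr1 mulN1r; nia.
  by exists false; rewrite /= expr0 mul1r; nia.
have [||p [Hp p0 pJ]] := IH (g * elt b j c)%g.
- have e : (\sum_(l | (l \notin J) && (l != j)) absz (rowb (g * elt b j c)%g 0%R l) =
            \sum_(l | (l \notin J) && (l != j)) absz (rowb g 0%R l))%N.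
    by apply: eq_bigr => l /andP[_ lj]; rewrite rowb_elt (negPf lj) addr0.
  move: gm; rewrite (bigD1 j)//= [in X in _ -> X](bigD1 j)//= e rowb_elt eqxx bj /=.
  by rewrite ltnS; apply: leq_trans; rewrite ltn_add2r.
- by rewrite rowb_elt (negPf bj) addr0.
exists (elt b j c * p)%g; rewrite mulgA; split=> //.
  by apply: gen_mul => //; exact: H_elt.
move=> k kJ; rewrite pJ// rowb_elt.
have /negPf -> : k != j by apply: contraNneq jJ => <-.
by rewrite addr0.
Qed.

Lemma reduce_row g : standard_off J g -> exists2 p, H p & standard_off (J :\ b) (g * p)%g.
Proof.
move=> sg.
have fin p : H p -> rowb (g * p)%g = delta_mx 0 b -> standard_off (J :\ b) (g * p)%g.
  move=> Hp pb i; rewrite !inE negb_and negbK => /orP[/eqP ->//|].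
  exact: standard_offM.
have [p1 [l [Hp1 lJ pl p0]]] := reduce_inside sg.
have [p2 [Hp2 pb2 p02]] : exists p2, [/\ H p2, absz (rowb (g * p2)%g 0%R b) = 1%N &
    forall k, k \in J -> k != b -> rowb (g * p2)%g 0%R k = 0].
  have [lb|lb] := eqVneq l b; first by subst l; exists p1.
  exists (p1 * wt l b)%g; rewrite [(g * _)%g](mulgA g p1 (wt l b)).
  have wE k : rowb (g * p1 * wt l b)%g 0%R (tperm l b k) =
      (-1) ^+ ((k == b) && (l != b)) * rowb (g * p1)%g 0%R k.
    by rewrite /rowb SLZ_valM mulmxA; exact: wt_signed.
  split; first by apply: (gen_mul Hp1); exact: H_wt.
    by rewrite -{2}(tpermL l b) wE abszMsign.
  move=> k kJ kb; rewrite -(tpermK l b k) wE p0 ?mulr0//.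
    by case: tpermP.
  by apply: contraNneq kb => kl; rewrite -(tpermK l b k) kl tpermL.
have [p3 [Hp3 p3out p3in]] := reduce_outside pb2.
rewrite -mulgA in p3out p3in; have Hp : H (p2 * p3)%g by exact: gen_mul.
set p := (p2 * p3)%g in p3out p3in Hp.
have row0 k : k != b -> rowb (g * p)%g 0%R k = 0.
  by move=> kb; have [kJ|kJ] := boolP (k \in J); [rewrite p3in// p02|rewrite p3out].
have : rowb (g * p)%g 0%R b = 1 \/ rowb (g * p)%g 0%R b = -1.
  by rewrite p3in//; move: pb2; clear; lia.
case=> pb.
  exists p => //; apply: fin => //; apply/rowP => k; rewrite [RHS]mxE eqxx /=.
  by have [->|kb] := eqVneq k b; [rewrite pb|rewrite row0].
(* The sign is corrected by [dt b j] if [J] has another index; if not, the matrix is diagonal with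
   determinant -1, which is absurd. *)
have [[j jJ jb]|none] := pselect (exists2 j, j \in J & j != b).
  exists (p * dt b j)%g; first by apply: (gen_mul Hp); exact: H_dt.
  apply: fin; first by apply: (gen_mul Hp); exact: H_dt.
  have dE k : rowb (g * p * dt b j)%g 0%R k = (-1) ^+ ((k == b) (+) (k == j)) * rowb (g * p)%g 0%R k.
    by rewrite -(dt_signed b j) perm1 /rowb (SLZ_valM (g * p)%g) mulmxA.
  rewrite [(g * _)%g](mulgA g p (dt b j)); apply/rowP => k; rewrite [RHS]mxE eqxx dE /=.
  have [->|kb] := eqVneq k b; last by rewrite row0 ?mulr0.
  by rewrite pb eq_sym (negPf jb) mulrNN mulr1.
have := SLZ_det (g * p)%g.
have -> : SLZval (g * p)%g = diag_mx (\row_k (if k == b then -1 else 1)).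
  apply/row_matrixP => k; rewrite !rowE.
  have [->|kb] := eqVneq k b.
    apply/rowP => m; rewrite -[LHS]/(rowb (g * p)%g 0%R m) -[in RHS]rowE [RHS]mxE [RHS]mxE [X in X *+ _]mxE eqxx.
    by have [->|mb] := eqVneq m b; [rewrite pb|rewrite row0].
  rewrite (@standard_offM g p sg Hp).
    apply/rowP => m; rewrite -rowE !mxE (negPf kb) eqxx /= eq_sym.
    by case: eqP.
  by apply/negP => kJ; apply: none; exists k.
rewrite det_diag (bigD1 b)//= big1 => [|k /negPf kb]; last by rewrite mxE kb.
by rewrite mxE eqxx mulr1.
Qed.

End reduce_row.

Lemma standard_off_gen (J : {set 'I_n}) g : standard_off J g ->
  gen (elts (@elt n) J [set: 'I_n]) g.
Proof.
have [m] := ubnP #|J|; elim: m J g => // m IH J g Jm sg.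
have [b bJ|J0] := pickP (mem J); last first.
  suff -> : g = 1%g by exact: gen_one.
  apply: val_inj; apply/row_matrixP => i; rewrite !rowE sg ?mulmx1//.
  by have /negbT := J0 i.
have {}bJ : b \in J := bJ; have [p Hp sp] := reduce_row bJ sg.
rewrite -(mulgK p g); apply: gen_mul; last exact: (gen_eltsV (@eltV n)).
have := IH (J :\ b) _ _ sp; rewrite (cardsD1 b) bJ in Jm; move=> /(_ Jm).
apply: gen_sub => x [i [j [c [iJ jJ ij ->]]]]; exists i, j, c; split=> //.
by move: iJ; rewrite !inE => /andP[].
Qed.

Lemma SLZ_generated g : gen (elts (@elt n) [set: 'I_n] [set: 'I_n]) g.
Proof. by apply: standard_off_gen => i; rewrite inE. Qed.

End generation.

(** The section picks the preimage in the subgroup generated by the canonical lifts: it exists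
    because elementary matrices generate, and is unique by [gen_kernel]. *)
Lemma central_extension_splits (n : nat) (E : groupType) (q : E -> SLZ n) :
  (3 <= n)%N ->
  (forall x y, q (x * y) = q x * q y)%g ->
  (forall g, exists x, q x = g) ->
  (forall z, q z = 1%g -> forall x, commute z x) ->
  (forall z, q z = 1%g -> (z * z)%g = 1%g -> z = 1%g) ->
  exists s : SLZ n -> E, (forall g h, s (g * h) = s g * s h)%g /\ forall g, q (s g) = g.
Proof.
move=> n3 qM q_surj q_central q_tors.
set X := xs n3 q_surj; set W := w_ n3 q_surj.
have w_alt' i j : (W i j = X j i true * X i j false * X j i true)%g.
  by rewrite /W (w_alt n3 qM q_surj q_central q_tors).
have ker := gen_kernel qM (q_xs n3 qM q_surj) (xsV n3 q_surj)
  (@xs_conj _ _ _ n3 qM q_surj q_central q_tors)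
  (@xs_commute _ _ _ n3 qM q_surj q_central q_tors)
  (@xs_commg _ _ _ n3 qM q_surj q_central q_tors)
  (fun i j => erefl (W i j)) w_alt'
  (w_mul4 n3 qM q_surj q_central q_tors) n3 q_surj
  (@ker_selfinv _ _ _ q_central q_tors).
have lift g : exists x, gen (elts X [set: 'I_n] [set: 'I_n]) x /\ q x = g.
  elim: (SLZ_generated g) => [|h e _ [x [xX <-]] [i [j [c [_ _ ij ->]]]]].
    by exists 1%g; split; [exact: gen_one|exact: q1].
  exists (x * X i j c)%g; split; last by rewrite qM q_xs.
  by apply: gen_mulr => //; exists i, j, c; rewrite !inE.
pose s g := sval (cid (lift g)).
have sX g : gen (elts X [set: 'I_n] [set: 'I_n]) (s g) /\ q (s g) = g by rewrite /s; case: cid.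
exists s; split=> [g h|g]; last exact: (sX g).2.
have [gX gq] := sX g; have [hX hq] := sX h; have [ghX ghq] := sX (g * h)%g.
apply: (mulIg (s (g * h)%g)^-1%g); rewrite mulgV; symmetry; apply: ker.
  exact: (gen_mul (gen_mul gX hX) (gen_eltsV (xsV n3 q_surj) ghX)).
by rewrite !qM (qV qM) gq hq ghq mulgV.
Qed.

(** * Representations of dimension less than n *)

Section eigenvectors.
Variables (F : fieldType) (k : nat) (I : finType) (v : I -> 'rV[F]_k).

Definition eigen_family (A : 'M[F]_k) (c : I -> F) := forall i, v i *m A = c i *: v i.

Definition separated := forall l m, l != m ->
  exists A c, eigen_family A c /\ c l != c m.

Hypothesis v_neq0 : forall i, v i != 0.
Hypothesis v_sep : separated.

(** A product of factors A - d_m, each killing one [v m] but not [v l]. *)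
Lemma eigen_filter l (s : seq I) : l \notin s -> exists B c,
  [/\ eigen_family B c, c l != 0 & forall m, m \in s -> c m = 0].
Proof.
elim: s => [_|m s IH]; first by exists 1%:M, (fun=> 1); split=> // [i|]; rewrite ?mulmx1 ?scale1r ?oner_eq0.
rewrite inE negb_or => /andP[lm /IH[B [c [Bc cl cs]]]].
have [A [d [Ad dlm]]] := v_sep lm.
exists (B *m (A - (d m)%:M)), (fun i => c i * (d i - d m)); split.
- move=> i; rewrite mulmxA Bc -scalemxAl mulmxBr Ad mul_mx_scalar -scalerBl.
  by rewrite scalerA.
- by rewrite mulf_neq0// subr_eq0.
- by move=> i; rewrite inE => /orP[/eqP->|/cs->]; rewrite ?subrr ?mulr0 ?mul0r.
Qed.

Lemma eigen_free (a : I -> F) : \sum_i a i *: v i = 0 -> forall l, a l = 0.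
Proof.
move=> a0 l; have ls : l \notin enum (predC1 l) by rewrite mem_enum !inE eqxx.
have [B [c [Bc cl cs]]] := eigen_filter ls.
have := congr1 (mulmx^~ B) a0; rewrite /= mul0mx mulmx_suml (bigD1 l)//= big1 => [|i il].
  rewrite addr0 -scalemxAl Bc scalerA => /eqP.
  by rewrite scaler_eq0 mulf_eq0 (negPf cl) (negPf (v_neq0 l)) !orbF => /eqP.
by rewrite -scalemxAl Bc cs ?scale0r ?scaler0// mem_enum.
Qed.

Definition eigen_mx : 'M[F]_(#|I|, k) := \matrix_(i < #|I|) v (enum_val i).

Lemma mul_eigen_mx (u : 'rV_#|I|) :
  u *m eigen_mx = \sum_i u 0 (enum_rank i) *: v i.
Proof.
rewrite mulmx_sum_row [RHS](reindex_omap enum_val (fun i => Some (enum_rank i))) => [|i _]; last by rewrite /= enum_rankK.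
by apply: eq_big => [i|i _]; rewrite ?enum_valK ?eqxx// rowK.
Qed.

Lemma eigen_mx_free : row_free eigen_mx.
Proof.
apply: inj_row_free => u; rewrite mul_eigen_mx => /eigen_free u0.
by apply/rowP => i; rewrite mxE -(enum_valK i) u0.
Qed.

Lemma card_eigen_family : (#|I| <= k)%N.
Proof. by move: eigen_mx_free; rewrite /row_free => /eqP <-; exact: rank_leq_col. Qed.

Hypothesis cardI : #|I| = k.

Lemma eigen_mx_full : row_full eigen_mx.
Proof. by move: eigen_mx_free; rewrite /row_free /row_full => /eqP ->; rewrite cardI. Qed.

Lemma eigenbasis_eq (A B : 'M[F]_k) : (forall i, v i *m A = v i *m B) -> A = B.
Proof.
move=> AB; apply/row_matrixP => i; rewrite !rowE.
have /submxP[D ->] := submx_full (delta_mx 0 i : 'rV_k) eigen_mx_full.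
rewrite -!mulmxA; congr (_ *m _).
by apply/row_matrixP => j; rewrite !row_mul rowK.
Qed.

(** The eigenvalue systems of the basis are distinct, so each has multiplicity one. *)
Lemma eigenbasis_coord (x : 'rV[F]_k) l : (forall m, m != l ->
    exists A c, [/\ eigen_family A c, c l != c m & x *m A = c l *: x]) ->
  exists a, x = a *: v l.
Proof.
move=> xl; have /submxP[D xE] := submx_full x eigen_mx_full.
rewrite mul_eigen_mx in xE; exists (D 0 (enum_rank l)); rewrite {1}xE (bigD1 l)//= big1 ?addr0// => m ml.
have [A [c [Ac clm xA]]] := xl m ml.
suff : (c m - c l) * D 0 (enum_rank m) = 0.
  by move=> /eqP; rewrite mulf_eq0 subr_eq0 eq_sym (negPf clm) => /eqP ->; rewrite scale0r.
apply: (eigen_free (a := fun i => (c i - c l) * D 0 (enum_rank i))).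
rewrite (eq_bigr (fun i => D 0 (enum_rank i) *: (v i *m A) - c l *: (D 0 (enum_rank i) *: v i))) => [|i _].
  rewrite big_split/= sumrN -scaler_sumr -xE -xA xE mulmx_suml -sumrB.
  by rewrite big1// => i _; rewrite -scalemxAl subrr.
by rewrite Ac mulrC -scalerA scalerBl !scalerBr !scalerA [c l * _]mulrC.
Qed.

End eigenvectors.

(** Each involution A replaces w by w + wA, unless this vanishes, when wA = -w. The result is [v]
    times a polynomial in the involutions, whence the last clause, which lets a prescribed
    eigenvalue of [v] survive. *)
Lemma involutions_eigenvector (F : fieldType) k (ms : seq 'M[F]_k) (v : 'rV[F]_k) :
  (forall A, A \in ms -> A *m A = 1%:M) ->
  (forall A B, A \in ms -> B \in ms -> A *m B = B *m A) -> v != 0 ->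
  exists v' : 'rV[F]_k, [/\ v' != 0, forall A, A \in ms -> v' *m A = v' \/ v' *m A = - v' &
    forall B c, (forall A, A \in ms -> A *m B = B *m A) -> v *m B = c *: v -> v' *m B = c *: v'].
Proof.
elim: ms => [|A ms IH] ms2 msC v0; first by exists v.
have [||w [w0 wms wv]] := IH _ _ v0.
- by move=> B Bms; apply: ms2; rewrite inE Bms orbT.
- by move=> B C Bms Cms; apply: msC; rewrite inE ?Bms ?Cms orbT.
have AA : A *m A = 1%:M by apply: ms2; rewrite inE eqxx.
have AC B : B \in ms -> A *m B = B *m A by move=> Bms; apply: msC; rewrite inE ?eqxx ?Bms ?orbT.
have [wA|wA] := eqVneq (w + w *m A) 0.
  exists w; split=> // [B|B c BC vB].
    rewrite inE => /orP[/eqP ->|]; last exact: wms.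
    by right; apply/eqP; rewrite -addr_eq0 addrC wA.
  by apply: wv => // C Cms; apply: BC; rewrite inE Cms orbT.
exists (w + w *m A); split=> // [B|B c BC vB].
  rewrite inE => /orP[/eqP ->|Bms].
    by left; rewrite mulmxDl -mulmxA AA mulmx1 addrC.
  rewrite mulmxDl -mulmxA AC// mulmxA.
  by case: (wms B Bms) => ->; [left|right; rewrite mulNmx opprD].
have wB : w *m B = c *: w by apply: wv => // C Cms; apply: BC; rewrite inE Cms orbT.
by rewrite mulmxDl -mulmxA BC ?inE ?eqxx// mulmxA wB scalerDr scalemxAl.
Qed.

(** * Characters of the sign matrices and of the root elements of one row *)

Section small_representations.
Variables (F : fieldType) (n k : nat) (theta : SLZ n -> 'M[F]_k).
Hypothesis n3 : (3 <= n)%N.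
Hypothesis kn : (k < n)%N.
Hypothesis F2 : (2%:R : F) != 0.
Hypothesis theta1 : theta 1%g = 1%:M.
Hypothesis thetaM : forall g h, theta (g * h)%g = theta g *m theta h.
Implicit Types (i j l m p q r s : 'I_n) (g h : SLZ n).

Lemma thetaVr g : theta g *m theta g^-1%g = 1%:M.
Proof. by rewrite -thetaM mulgV theta1. Qed.

Lemma theta_neq0 g (v : 'rV[F]_k) : v != 0 -> v *m theta g != 0.
Proof.
apply: contraNneq => vg.
by rewrite -[v]mulmx1 -(thetaVr g) mulmxA vg mul0mx.
Qed.

Lemma theta_commg g h : theta g *m theta h = theta h *m theta g ->
  theta [~ g, h]%g = 1%:M.
Proof.
move=> gh; have -> : [~ g, h]%g = ((h * g)^-1 * (g * h))%g by rewrite /commg /conjg !gnorm.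
by rewrite thetaM (thetaM g) gh -thetaM -thetaM mulVg theta1.
Qed.

(** If one factor of a Steinberg commutator acts trivially, so does the commutator; from [elt q r]
    this reaches every pair of indices. *)
Lemma theta_elt_all q r : q != r -> theta (elt q r false) = 1%:M ->
  forall i j c, theta (elt i j c) = 1%:M.
Proof.
move=> qr qr1; pose K i j := theta (elt i j false) = 1%:M.
have Kc i j l : i != j -> j != l -> i != l -> K i j \/ K j l -> K i l.
  move=> ij jl il h; rewrite /K -(elt_commg ij jl il); apply: theta_commg.
  by case: h => ->; rewrite mul1mx mulmx1.
have Kir i : i != r -> K i r.
  by move=> ir; have [->//|iq] := eqVneq i q; apply: (@Kc i q r) => //; right.
have Kqj j : j != q -> K q j.
  by move=> jq; have [->//|jr] := eqVneq j r; apply: (@Kc q r j); do ?[by []|by rewrite eq_sym]; left.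
have Kij i j : i != j -> K i j.
  move=> ij; have [ir|ir] := eqVneq i r; last first.
    have [->|jr] := eqVneq j r; first exact: Kir.
    by apply: (@Kc i r j); do ?[by []|by rewrite eq_sym]; left; exact: Kir.
  subst i; have [jq|jq] := eqVneq j q; last first.
    by apply: (@Kc r q j); do ?[by []|by rewrite eq_sym]; right; exact: Kqj.
  subst j; have [t tq tr] := index_outside n3 q r.
  apply: (@Kc r t q); do ?[by []|by rewrite eq_sym]; left.
  by apply: (@Kc r q t); do ?[by []|by rewrite eq_sym]; right; exact: Kqj.
move=> i j c; have [->|ij] := eqVneq i j; first by rewrite elt_diag theta1.
case: c; last exact: Kij.
by have := thetaM (elt i j false) (elt i j true); rewrite (elt_mulN i j false) theta1 (Kij i j ij) mul1mx.
Qed.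

Lemma theta_trivial_of_elt : (forall i j c, theta (elt i j c) = 1%:M) ->
  forall g, theta g = 1%:M.
Proof.
move=> th g; elim: (SLZ_generated g) => [//|h x _ IH [i [j [c [_ _ _ ->]]]]].
by rewrite thetaM IH th mulmx1.
Qed.

Local Notation T i j := (theta (dt i j)).
Local Notation W i j := (theta (wt i j)).

(** A character of the diagonal sign matrices of determinant 1, written as a set of indices; a set
    and its complement give the same character. *)
Definition has_char (v : 'rV[F]_k) (chi : 'I_n -> bool) :=
  forall i j, v *m T i j = (-1) ^+ (chi i (+) chi j) *: v.

Lemma has_char_W v chi p q : has_char v chi -> has_char (v *m W p q) (chi \o tperm p q).
Proof.
move=> vchi i j /=; have e := dt_conj (tperm p q i) (tperm p q j) (wt_signed p q).
rewrite !tpermK in e; rewrite -mulmxA -thetaM -e -[(_ * _)%g]conjgC thetaM.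
by rewrite mulmxA vchi scalemxAl.
Qed.

Lemma exists_char a b : theta (dt a b) != 1%:M -> exists (v : 'rV[F]_k) chi a b,
  [/\ v != 0, chi a = false, chi b = true & has_char v chi].
Proof.
move=> Tab; have [u u0] : exists u : 'rV[F]_k, u - u *m T a b != 0.
  apply: contrapT => none; move/eqP: Tab; apply; apply/row_matrixP => i; rewrite !rowE mulmx1.
  by apply/eqP; rewrite eq_sym -subr_eq0; apply/negP => /negP h; apply: none; eexists; exact: h.
pose ms := [seq T ij.1 ij.2 | ij <- enum {: 'I_n * 'I_n}].
have msP A : A \in ms -> exists i j, A = T i j.
  by move=> /mapP[[i j] _ ->]; exists i, j.
have Tms i j : T i j \in ms by apply/mapP; exists (i, j); rewrite ?mem_enum.
(* The starting vector has eigenvalue -1 for the involution [T a b], and the construction preserves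
   this, so the character obtained is nontrivial. *)
have [|||v [v0 vms vB]] := @involutions_eigenvector F k ms (u - u *m T a b).
- by move=> A /msP[i [j ->]]; rewrite -thetaM dt2 theta1.
- by move=> A B /msP[i [j ->]] /msP[p [q ->]]; rewrite -!thetaM dt_commute.
- exact: u0.
pose chi i := v *m T a i != v.
have va i : v *m T a i = (-1) ^+ (chi i) *: v.
  rewrite /chi; case: eqVneq => [->|ne]; first by rewrite scale1r.
  by rewrite scaleN1r; case: (vms _ (Tms a i)) => [e|//]; rewrite e eqxx in ne.
have vab : v *m T a b = - v.
  rewrite -scaleN1r; apply: vB => [A /msP[i [j ->]]|]; first by rewrite -!thetaM dt_commute.
  by rewrite mulmxBl -mulmxA -thetaM dt2 theta1 mulmx1 scaleN1r opprB.
have ne : - v != v.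
  by rewrite -subr_eq0 -opprD oppr_eq0 -mulr2n -scaler_nat scaler_eq0 (negPf F2).
exists v, chi, a, b; split=> //.
- have -> : chi a = (v *m T a a != v) by [].
  have -> : dt a a = 1%g by have := dt2 a a; rewrite dtM.
  by rewrite theta1 mulmx1 eqxx.
- by rewrite /chi vab.
- move=> i j; rewrite -(dtM i a j) thetaM [dt i a]dtC mulmxA va -scalemxAl va scalerA.
  by rewrite signr_addb.
Qed.

Lemma sgn_neq (b c : bool) : b != c -> (-1) ^+ b != (-1) ^+ c :> F.
Proof.
have ne : 1 != -1 :> F by rewrite -subr_eq0 opprK -mulr2n.
by case: b; case: c => //= _; rewrite expr0 expr1// eq_sym.
Qed.

(* Translating a nontrivial sign character by suitable transpositions gives
   [n] distinct characters, unless [n = 4] and the character is balanced. *)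
Lemma char_orbit (v : 'rV[F]_k) chi a b :
  v != 0 -> chi a = false -> chi b = true -> has_char v chi ->
  exists l m, [/\ chi l = true, l != b, chi m = false, m != a &
    forall i, i \in [:: a; b; l; m]].
Proof.
move=> v0 ca cb vchi; have ab : a != b by apply: contraFneq ca => ->; rewrite cb.
(* Moves [chi] by the transposition of [l] with an index of opposite value, [a] or [b]; [fl l] is
   the set of the two flipped indices, empty for [l = a]. *)
pose w l : SLZ n := if chi l then wt a l else if l == a then 1%g else wt b l.
pose fl l i := if chi l then (i == a) (+) (i == l) else
  if l == a then false else (i == b) (+) (i == l).
have vw l : has_char (v *m theta (w l)) (fun i => chi i (+) fl l i).
  rewrite /w /fl; case: ifP => cl.
    have al : a != l by apply: contraTneq cl => <-; rewrite ca.
    move=> i j; rewrite (has_char_W a l vchi); congr (_ ^+ (nat_of_bool _) *: _).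
    by congr (_ (+) _) => /=; case: tpermP => [->|->|/eqP/negPf-> /eqP/negPf->];
      rewrite ?eqxx ?(negPf al) ?[l == a]eq_sym ?(negPf al) ?cl ?ca ?addbF.
  case: eqVneq => [la|la]; first by rewrite theta1 mulmx1 => i j; rewrite !addbF vchi.
  have bl : b != l by apply: contraFneq cl => <-.
  move=> i j; rewrite (has_char_W b l vchi); congr (_ ^+ (nat_of_bool _) *: _).
  by congr (_ (+) _) => /=; case: tpermP => [->|->|/eqP/negPf-> /eqP/negPf->];
    rewrite ?eqxx ?(negPf bl) ?[l == b]eq_sym ?(negPf bl) ?cl ?cb ?addbF.
have [l [m [lm same]]] : exists l m, l != m /\
    forall i j, fl l i (+) fl l j = fl m i (+) fl m j.
  apply: contrapT => none; have := kn; rewrite ltnNge => /negP; apply.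
  rewrite -[X in (X <= _)%N]card_ord; apply: (@card_eigen_family _ _ _ (fun l => v *m theta (w l))).
    by move=> l; exact: theta_neq0.
  move=> l m lm.
  have [i [j ne]] : exists i j, fl l i (+) fl l j != fl m i (+) fl m j.
    apply: contrapT => none'; apply: none; exists l, m; split=> // i j.
    by apply/eqP/negP => /negP h; apply: none'; exists i, j.
  exists (T i j), (fun l => (-1) ^+ ((chi i (+) fl l i) (+) (chi j (+) fl l j))).
  split; first by move=> t; exact: vw.
  apply: sgn_neq; move: ne; apply: contraNneq.
  by case: (chi i); case: (chi j); case: (fl l i); case: (fl l j); case: (fl m i); case: (fl m j).
have two x y : x != y -> (forall i, fl l i (+) fl m i = (i == x) (+) (i == y)) -> False.
  move=> xy h; have [z zx zy] := index_outside n3 x y.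
  have := same x z; have := h x; have := h z.
  rewrite eqxx (negPf xy) (negPf zx) (negPf zy).
  by case: (fl l x); case: (fl l z); case: (fl m x); case: (fl m z).
(* Apart from degenerate cases the flipped pairs are {a, l'} and {b, m'}: the characters coincide
   only if together they exhaust all indices. *)
have main l' m' : (forall i j, fl l' i (+) fl l' j = fl m' i (+) fl m' j) ->
    (forall x y, x != y -> (forall i, fl l' i (+) fl m' i = (i == x) (+) (i == y)) -> False) ->
    chi l' = true -> chi m' = false ->
    exists l m, [/\ chi l = true, l != b, chi m = false, m != a & forall i, i \in [:: a; b; l; m]].
  move=> same' two' cl cm.
  have al : a != l' by apply: contraTneq cl => <-; rewrite ca.
  have bm : b != m' by apply: contraFneq cm => <-.
  have lm' : l' != m' by apply: contraTneq cl => ->; rewrite cm.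
  have [ma|ma] := eqVneq m' a.
    by case: (two' _ _ al) => i; rewrite /fl cl cm ma eqxx addbF.
  have [lb|lb] := eqVneq l' b.
    case: (two' a m'); first by rewrite eq_sym.
    by move=> i; rewrite /fl cl cm (negPf ma) lb; case: (i == a); case: (i == b); case: (i == m').
  exists l', m'; split=> // z; rewrite !inE; apply/negPn/negP.
  rewrite !negb_or => /and4P[/negPf za /negPf zb /negPf zl /negPf zm].
  have := same' a z; rewrite /fl cl cm (negPf ma) !eqxx za zb zl zm (negPf al) (negPf ab).
  by rewrite eq_sym (negPf ma).
case cl: (chi l); case cm: (chi m).
- by case: (two _ _ lm) => i; rewrite /fl cl cm; case: (i == a); case: (i == l); case: (i == m).
- exact: main cl cm.
- apply: main cm cl => // x y xy h; apply: (two x y xy) => i; rewrite -h.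
  exact: addbC.
- exfalso; have [la|la] := eqVneq l a; have [ma|ma] := eqVneq m a.
  + by rewrite la ma eqxx in lm.
  + have bm : b != m by apply: contraFneq cm => <-.
    by apply: (two _ _ bm) => i; rewrite /fl cl cm la eqxx (negPf ma).
  + have bl : b != l by apply: contraFneq cl => <-.
    by apply: (two _ _ bl) => i; rewrite /fl cl cm ma eqxx (negPf la) addbF.
  + apply: (two _ _ lm) => i; rewrite /fl cl cm (negPf la) (negPf ma).
    by case: (i == b); case: (i == l); case: (i == m).
Qed.

(* Balanced case: the torsion element [wt p q * wt r s] acts as a polynomial in
   [dt p q], so it commutes with [elt p q], which it conjugates into the
   opposite root subgroup. *)
Lemma balanced_char (v : 'rV[F]_k) chi p q r s :
  v != 0 -> has_char v chi -> p != q -> r != s ->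
  chi p = false -> chi q = false -> chi r = true -> chi s = true ->
  (forall i, i \in [:: p; q; r; s]) -> forall i j c, theta (elt i j c) = 1%:M.
Proof.
move=> v0 vchi pq rs cp cq cr cs all4.
have ne x y : chi x = false -> chi y = true -> x != y.
  by move=> cx cy; apply: contraFneq cx => ->; rewrite cy.
have pr := ne _ _ cp cr; have ps := ne _ _ cp cs; have qr := ne _ _ cq cr; have qs := ne _ _ cq cs.
have k3 : (k <= 3)%N.
  rewrite -ltnS; apply: (leq_trans kn); rewrite -[X in (X <= _)%N]card_ord.
  apply: (@leq_trans #|[:: p; q; r; s]|); last exact: card_size.
  by apply: subset_leq_card; apply/fintype.subsetP => i _; exact: all4.
(* The three vectors carry the three partitions of the four indices into pairs. As k <= 3, they form
   a basis and each character has multiplicity one. *)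
pose v1 := v *m W q r; pose v2 := v1 *m W p q.
pose chi1 := chi \o tperm q r; pose chi2 := chi1 \o tperm p q.
have v1chi : has_char v1 chi1 by exact: has_char_W.
have v2chi : has_char v2 chi2 by exact: has_char_W.
pose w (o : option bool) : 'rV[F]_k := if o is Some b then if b then v2 else v1 else v.
pose psi (o : option bool) := if o is Some b then if b then chi2 else chi1 else chi.
have wpsi o : has_char (w o) (psi o) by case: o => [[]|].
have w0 o : w o != 0 by case: o => [[]|]//=; rewrite /v2 /v1 ?theta_neq0.
pose t x y o : F := (-1) ^+ (psi o x (+) psi o y).
have wT x y : eigen_family w (T x y) (t x y) by move=> o; exact: wpsi.
have psiE : [/\ psi None p = false, psi None q = false, psi None r = true & psi None s = true] by [].
have psiE1 : [/\ psi (Some false) p = false, psi (Some false) q = true,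
    psi (Some false) r = false & psi (Some false) s = true].
  have ep : tperm q r p = p by rewrite tpermD// eq_sym.
  have es : tperm q r s = s by rewrite tpermD.
  by rewrite /= /chi1 /= tpermL tpermR ep es.
have psiE2 : [/\ psi (Some true) p = true, psi (Some true) q = false,
    psi (Some true) r = false & psi (Some true) s = true].
  have [hp hq hr hs] := psiE1.
  have er : tperm p q r = r by rewrite tpermD.
  have es : tperm p q s = s by rewrite tpermD.
  by rewrite /= /chi2 /= tpermL tpermR er es.
have sepW : separated w.
  have pq_pr o o' : (psi o p (+) psi o q != psi o' p (+) psi o' q) ||
      (psi o p (+) psi o r != psi o' p (+) psi o' r) ->
      exists A c, eigen_family w A c /\ c o != c o'.
    by case/orP => h; [exists (T p q), (t p q)|exists (T p r), (t p r)];
      split=> //; exact: sgn_neq.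
  have [a0 b0 c0 d0] := psiE; have [a1 b1 c1 d1] := psiE1; have [a2 b2 c2 d2] := psiE2.
  by case=> [[]|] [[]|] // _; apply: pq_pr;
    rewrite ?a0 ?b0 ?c0 ?a1 ?b1 ?c1 ?a2 ?b2 ?c2.
have cardk : #|{: option bool}| = k.
  apply/eqP; rewrite eqn_leq (card_eigen_family w0 sepW).
  by rewrite card_option card_bool.
have mult x o : has_char x (psi o) -> exists c, x = c *: w o.
  move=> xo; apply: (eigenbasis_coord w0 sepW cardk) => o' oo'.
  have : (psi o p (+) psi o q != psi o' p (+) psi o' q) ||
      (psi o p (+) psi o r != psi o' p (+) psi o' r).
    have [a0 b0 c0 d0] := psiE; have [a1 b1 c1 d1] := psiE1; have [a2 b2 c2 d2] := psiE2.
    by move: oo'; case: o {xo} => [[]|]; case: o' => [[]|] // _;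
      rewrite ?a0 ?b0 ?c0 ?a1 ?b1 ?c1 ?a2 ?b2 ?c2.
  by case/orP => h; [exists (T p q), (t p q)|exists (T p r), (t p r)];
    split=> //; rewrite ?xo//; exact: sgn_neq.
have chiW x chi' y z : has_char x chi' -> chi' y = chi' z -> has_char (x *m W y z) chi'.
  move=> xc yz i j; rewrite (has_char_W y z xc) /=.
  by congr (_ ^+ (nat_of_bool (_ (+) _)) *: _); case: tpermP => // ->; rewrite yz.
have [e eE] : exists e, v *m W p q = e *: v.
  by apply: (mult _ None); apply: chiW => //; rewrite /= cp cq.
have [f fE] : exists f, v *m W r s = f *: v.
  by apply: (mult _ None); apply: chiW => //; rewrite /= cr cs.
(* [wt r s] turns the set {q, s} of [v1] into {q, r}, the complement of the set {p, s} of [v2]. *)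
have [c cE] : exists c, v1 *m W r s = c *: v2.
  apply: (mult _ (Some true)) => i j; rewrite (has_char_W r s v1chi).
  congr (_ ^+ (nat_of_bool _) *: _).
  have [a1 b1 c1 d1] := psiE1; have [a2 b2 c2 d2] := psiE2.
  have h x : (chi1 \o tperm r s) x = ~~ psi (Some true) x.
    have ep : tperm r s p = p by rewrite tpermD// eq_sym.
    have eq : tperm r s q = q by rewrite tpermD// eq_sym.
    have := all4 x; rewrite !inE => /or4P[]/eqP ->; rewrite ?a2 ?b2 ?c2 ?d2 /=.
    - by rewrite ep -[chi1 p]/(psi (Some false) p) a1.
    - by rewrite eq -[chi1 q]/(psi (Some false) q) b1.
    - by rewrite tpermL -[chi1 s]/(psi (Some false) s) d1.
    - by rewrite tpermR -[chi1 r]/(psi (Some false) r) c1.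
  by rewrite !h; case: (psi _ i); case: (psi _ j).
have tpq o : t p q o = if o is None then 1 else -1.
  have [a0 b0 c0 d0] := psiE; have [a1 b1 c1 d1] := psiE1; have [a2 b2 c2 d2] := psiE2.
  by rewrite /t; case: o => [[]|]; rewrite ?a0 ?b0 ?a1 ?b1 ?a2 ?b2.
have WC : W p q *m W r s = W r s *m W p q.
  rewrite -!thetaM; congr theta.
  have cm x y z u : x \in [:: p; q] -> y \in [:: p; q] -> z \in [:: r; s] -> u \in [:: r; s] ->
      forall b d, commute (elt x y b) (elt z u d).
    rewrite !inE => /orP[]/eqP -> /orP[]/eqP -> /orP[]/eqP -> /orP[]/eqP -> b d;
    by apply: elt_commute; rewrite // eq_sym.
  have cw x y d : x \in [:: p; q] -> y \in [:: p; q] -> commute (elt x y d) (wt r s).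
    by move=> xpq ypq; apply: commuteM; [apply: commuteM|]; apply: cm => //; rewrite !inE eqxx ?orbT.
  apply: commute_sym; apply: commuteM; [apply: commuteM|]; apply: commute_sym;
    by apply: cw; rewrite !inE eqxx ?orbT.
pose y := (wt p q * wt r s)%g.
have v1pq2 : v1 *m W p q *m W p q = - v1.
  by rewrite -mulmxA -thetaM -[LHS]/(w (Some false) *m T p q) wT tpq scaleN1r.
have v1y : v1 *m theta y = - c *: v1.
  by rewrite thetaM WC mulmxA cE -scalemxAl v1pq2 scalerN scaleNr.
have v2y : v2 *m theta y = - c *: v2.
  rewrite thetaM WC mulmxA -[v2]/(v1 *m W p q) -(mulmxA v1) WC mulmxA cE.
  by rewrite -!scalemxAl v1pq2 mulNmx scalerN scaleNr.
have vy : v *m theta y = (e * f) *: v.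
  by rewrite thetaM mulmxA eE -scalemxAl fE scalerA.
(* Read off on the basis: [theta y] is e f on [v] and -c on [v1] and [v2], where [T p q] is 1 and -1
   respectively. *)
have Y2 : 2%:R *: theta y = (e * f - c)%:M + (e * f + c) *: T p q.
  apply: (eigenbasis_eq w0 sepW cardk) => o; rewrite -scalemxAr mulmxDr mul_mx_scalar.
  rewrite -scalemxAr wT tpq scalerA -scalerDl; case: o => [[]|] /=.
  - by rewrite v2y scalerA; congr (_ *: _); ring.
  - by rewrite v1y scalerA; congr (_ *: _); ring.
  - by rewrite vy scalerA; congr (_ *: _); ring.
have XT : theta (elt p q false) *m T p q = T p q *m theta (elt p q false).
  rewrite -!thetaM; congr theta; rewrite [LHS]conjgC elt_dt.
  by congr (_ * elt p q _)%g; eq_cases.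
have XY : theta (elt p q false) *m theta y = theta y *m theta (elt p q false).
  apply: (scalerI F2); rewrite scalemxAr scalemxAl Y2 mulmxDr mulmxDl.
  by rewrite mul_mx_scalar mul_scalar_mx -scalemxAr -scalemxAl XT.
have Xqp : theta (elt p q false) = theta (elt q p true).
  have ey : (elt p q false ^ y = elt q p true)%g.
    rewrite conjgM !elt_wt tpermL tpermR eqxx (negPf pq) /=.
    have eq : tperm r s q = q by rewrite tpermD// eq_sym.
    have ep : tperm r s p = p by rewrite tpermD// eq_sym.
    by rewrite eq ep (negPf qs) (negPf ps).
  move: XY; rewrite -[LHS]thetaM [(_ * y)%g]conjgC ey thetaM => XY.
  have := congr1 (mulmx (theta y^-1%g)) XY.
  by rewrite !mulmxA -thetaM mulVg theta1 !mul1mx.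
have qp : q != p by rewrite eq_sym.
(* [elt q p true] acts as [elt p q false], which commutes with [elt p r]; hence the commutator
   giving [elt q r] acts trivially. *)
apply: (theta_elt_all qr); rewrite -(elt_commg qp pr qr); apply: theta_commg.
have comm : theta (elt q p true) *m theta (elt p r false) = theta (elt p r false) *m theta (elt q p true).
  by rewrite -Xqp -!thetaM; congr theta; apply: elt_commute; rewrite // eq_sym.
have inv : theta (elt q p false) *m theta (elt q p true) = 1%:M.
  by rewrite -thetaM (elt_mulN q p false).
have inv' : theta (elt q p true) *m theta (elt q p false) = 1%:M.
  by rewrite -thetaM (elt_mulN q p true).
rewrite -[RHS]mul1mx -inv -!mulmxA; congr (_ *m _).
by rewrite mulmxA comm -mulmxA inv' mulmx1.
Qed.

Lemma dt_trivial i j : T i j = 1%:M.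
Proof.
apply/eqP/negP => /negP /exists_char[v [chi [a [b [v0 ca cb vchi]]]]].
have [l [m [cl lb cm ma all4]]] := char_orbit v0 ca cb vchi.
have am : a != m by rewrite eq_sym.
have bl : b != l by rewrite eq_sym.
have th : forall i j c, theta (elt i j c) = 1%:M.
  apply: (balanced_char v0 vchi am bl) => // x; move: (all4 x); rewrite !inE.
  by case: (x == a); case: (x == b); case: (x == l); case: (x == m).
have := vchi a b; rewrite !thetaM !th.
move=> /eqP; rewrite !mulmx1 ca cb /= expr1 scaleN1r -subr_eq0 opprK -mulr2n -scaler_nat.
by rewrite scaler_eq0 (negPf F2) (negPf v0).
Qed.

Local Notation X i j := (theta (elt i j false)).

(** Once the sign matrices act trivially, root elements act by involutions, and those of row [o]
    commute. Their characters are vectors of F_2^(n-1), indexed by the columns other than [o], on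
    which the root elements away from [o] act by transvections; a nonzero vector has 2^(n-1) - 1 >=
    n conjugates. *)
Lemma elt_trivial o a : X o a = 1%:M.
Proof.
have [->|oa] := eqVneq o a; first by rewrite elt_diag.
have ao : a != o by rewrite eq_sym.
apply/eqP/negP => /negP Xoa.
have XV i j : theta (elt i j true) = X i j.
  have [->|ij] := eqVneq i j; first by rewrite !elt_diag.
  have [z zi zj] := index_outside n3 i j.
  have -> : elt i j true = (elt i j false ^ dt j z)%g by rewrite elt_dt; congr elt; eq_cases.
  rewrite /conjg thetaM (thetaM (elt i j false)) dt_trivial mulmx1.
  have := thetaVr (dt j z)^-1%g; rewrite invgK dt_trivial mulmx1 => ->.
  by rewrite mul1mx.
have X2 i j : X i j *m X i j = 1%:M by rewrite -{2}XV -thetaM (elt_mulN i j false).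
have XC i j : X o i *m X o j = X o j *m X o i.
  rewrite -!thetaM; congr theta.
  have [->|io] := eqVneq o i; first by rewrite elt_diag mul1g mulg1.
  have [->|jo] := eqVneq o j; first by rewrite elt_diag mul1g mulg1.
  by apply: elt_commute; rewrite // eq_sym.
have [u u0] : exists u : 'rV[F]_k, u - u *m X o a != 0.
  apply: contrapT => none; move/eqP: Xoa; apply; apply/row_matrixP => i; rewrite !rowE mulmx1.
  by apply/eqP; rewrite eq_sym -subr_eq0; apply/negP => /negP h; apply: none; eexists; exact: h.
pose ms := [seq X o j | j <- enum 'I_n].
have msP A : A \in ms -> exists j, A = X o j by move=> /mapP[j _ ->]; exists j.
have Xms j : X o j \in ms by apply/mapP; exists j; rewrite ?mem_enum.
have [|||v [v0 vms vB]] := @involutions_eigenvector F k ms (u - u *m X o a).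
- by move=> A /msP[j ->]; exact: X2.
- by move=> A B /msP[i ->] /msP[j ->]; exact: XC.
- exact: u0.
pose hc (x : 'rV[F]_k) (chi : 'I_n -> bool) := forall j, j != o -> x *m X o j = (-1) ^+ (chi j) *: x.
pose chi j := v *m X o j != v.
have vchi : hc v chi.
  move=> j _; rewrite /chi; case: eqVneq => [->|ne]; first by rewrite scale1r.
  by rewrite scaleN1r; case: (vms _ (Xms j)) => [e|//]; rewrite e eqxx in ne.
have chia : chi a = true.
  have -> : chi a = (v *m X o a != v) by [].
  have -> : v *m X o a = - v.
    rewrite -scaleN1r; apply: vB => [A /msP[j ->]|]; first exact: XC.
    by rewrite mulmxBl -mulmxA X2 mulmx1 scaleN1r opprB.
  by rewrite -subr_eq0 -opprD oppr_eq0 -mulr2n -scaler_nat scaler_eq0 (negPf F2).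
have hcX x psi p q : p != o -> q != o -> p != q -> hc x psi ->
    hc (x *m X p q) (fun j => psi j (+) ((j == p) && psi q)).
  move=> po qo pq xpsi j jo; have op : o != p by rewrite eq_sym.
  have oq : o != q by rewrite eq_sym.
  have [->|jp] := eqVneq j p; last first.
    have -> : x *m X p q *m X o j = x *m X o j *m X p q.
      by rewrite -!mulmxA -!thetaM; congr (_ *m theta _); apply: elt_commute; rewrite // eq_sym.
    by rewrite (xpsi j jo) addbF scalemxAl.
  have e : X p q *m X o p = X o p *m X o q *m X p q.
    rewrite -(XV o q) -!thetaM; congr theta.
    have c : commute (elt o q true) (elt p q false).
      by apply: elt_commute; rewrite // eq_sym.
    rewrite -mulgA c mulgA -(eltV o q false) -(elt_commg op pq oq) invgR.
    exact: commgC.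
  by rewrite -mulmxA e !mulmxA xpsi// -scalemxAl xpsi// scalerA -scalemxAl signr_addb.
have [b bo ba] := index_outside n3 o a; have ab : a != b by rewrite eq_sym.
pose v' := if chi b then v else v *m X b a.
have [psi psib v'psi] : exists2 psi, psi b && psi a & hc v' psi.
  rewrite /v'; case: ifP => cb; first by exists chi => //; rewrite cb chia.
  exists (fun j => chi j (+) ((j == b) && chi a)); last exact: hcX.
  by rewrite eqxx cb chia (negPf ab).
case/andP: psib => psib psia.
(* The character is [chi] for [l = a], [chi] altered at [l] for [l] other than [a] and [o], and for
   [l = o] one vanishing at [a], where the others are 1. To obtain the last, [psi] was arranged to
   be 1 at both [a] and [b]. *)
pose vl l := if l == o then v' *m X a b else if l == a then v else v *m X l a.
pose cl l j := if l == o then psi j (+) ((j == a) && psi b)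
  else if l == a then chi j else chi j (+) ((j == l) && chi a).
have vlP l : hc (vl l) (cl l).
  rewrite /vl /cl; case: eqVneq => [_|lo]; first exact: hcX.
  by case: eqVneq => [_|la] //; exact: hcX.
have vl0 l : vl l != 0.
  by rewrite /vl /v'; case: ifP => _; [|case: ifP => _ //]; rewrite ?theta_neq0//; case: ifP; rewrite ?theta_neq0.
have := kn; rewrite ltnNge => /negP; apply.
apply: (@leq_trans #|'I_n|); first by rewrite card_ord.
apply: (card_eigen_family vl0) => l m lm.
suff [j jo ne] : exists2 j, j != o & cl l j != cl m j.
  by exists (X o j), (fun l => (-1) ^+ (cl l j)); split; [move=> i; exact: vlP|exact: sgn_neq].
rewrite /cl; have [lo|lo] := eqVneq l o; have [mo|mo] := eqVneq m o.
- by rewrite lo mo eqxx in lm.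
- by exists a => //; rewrite eqxx psia psib chia [a == m]eq_sym; case: (m == a).
- by exists a => //; rewrite eqxx psia psib chia [a == l]eq_sym; case: (l == a).
- have [la|la] := eqVneq l a.
    subst l; exists m => //; rewrite eqxx chia [m == a]eq_sym (negPf lm).
    by case: (chi m).
  exists l => //; rewrite eqxx chia (negPf lm); have [ma|ma] := eqVneq m a.
    by case: (chi l).
  by case: (chi l).
Qed.

Theorem small_representation_trivial g : theta g = 1%:M.
Proof.
apply: theta_trivial_of_elt => i j c; case: c; last exact: elt_trivial.
have := thetaM (elt i j false) (elt i j true).
by rewrite (elt_mulN i j false) theta1 elt_trivial mul1mx.
Qed.

End small_representations.

Lemma additive_rVz_mx k (f : 'rV[int]_k -> 'rV[int]_k) :
  (forall a b, f (a + b) = f a + f b) ->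
  forall a, f a = a *m \matrix_i f (delta_mx 0 i).
Proof.
move=> fD; have f0 : f 0 = 0 by apply: (addrI (f 0)); rewrite -fD !addr0.
have fB : {morph f : a b / a - b}.
  by move=> a b; apply: (addIr (f b)); rewrite -fD !subrK.
pose fA : {additive 'rV[int]_k -> 'rV[int]_k} :=
  HB.pack f (GRing.isZmodMorphism.Build _ _ f fB).
move=> a; rewrite -[f]/(fA : _ -> _) {1}(row_sum_delta a) raddf_sum mulmx_sum_row.
apply: eq_bigr => i _; rewrite rowK -[a 0 i]intz !scaler_int.
exact: raddfMz.
Qed.

Theorem free_abelian_extension_splits (n k : nat) (E : groupType) (q : E -> SLZ n)
    (phi : 'rV[int]_k -> E) :
  (3 <= n)%N -> (k < n)%N ->
  (forall x y, q (x * y) = q x * q y)%g ->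
  (forall g, exists x, q x = g) ->
  injective phi -> (forall a b, phi (a + b) = phi a * phi b)%g ->
  (forall z, q z = 1%g <-> exists a, phi a = z) ->
  exists s : SLZ n -> E, (forall g h, s (g * h) = s g * s h)%g /\ forall g, q (s g) = g.
Proof.
move=> n3 kn qM q_surj phi_inj phiD kerP.
have qphi a : q (phi a) = 1%g by apply/kerP; exists a.
have conj_ex x a : exists b, phi b = (phi a ^ x)%g.
  by apply/kerP; rewrite (qJ qM) qphi conj1g.
pose act x a := sval (cid (conj_ex x a)).
have actE x a : phi (act x a) = (phi a ^ x)%g by rewrite /act; case: cid.
have actD x a b : act x (a + b) = act x a + act x b.
  by apply: phi_inj; rewrite phiD !actE phiD conjMg.
have actM x y a : act (x * y)%g a = act y (act x a).
  by apply: phi_inj; rewrite !actE conjgM.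
have act_ker z a : q z = 1%g -> act z a = a.
  move=> /kerP[b <-]; apply: phi_inj; rewrite actE; apply: commute_conjg.
  by rewrite /commute -!phiD addrC.
pose Mx x : 'M[int]_k := \matrix_i act x (delta_mx 0 i).
have actMx x a : act x a = a *m Mx x by exact: additive_rVz_mx.
have MxP A B : (forall a : 'rV[int]_k, a *m A = a *m B) -> A = B :> 'M[int]_k.
  by move=> AB; apply/row_matrixP => i; rewrite !rowE AB.
have MxM x y : Mx (x * y)%g = Mx x *m Mx y.
  by apply: MxP => a; rewrite mulmxA -!actMx actM.
have Mx_q x y : q x = q y -> Mx x = Mx y.
  move=> /(q_eq qM)[z z1 ->]; apply: MxP => a.
  by rewrite -!actMx actM (act_ker z).
(* Integer matrices embed in rational ones, where 2 is invertible; the choice made by [lift_of] is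
   harmless by [Mx_q], the kernel being abelian. *)
pose theta g : 'M[rat]_k := map_mx (fun z : int => z%:~R) (Mx (lift_of q_surj g)).
have theta1 : theta 1%g = 1%:M.
  rewrite /theta (Mx_q _ 1%g) ?lift_ofK ?(q1 qM)//.
  rewrite (_ : Mx 1%g = 1%:M) ?map_mx1//; apply: MxP => a.
  by rewrite -actMx mulmx1 act_ker// (q1 qM).
have thetaM g h : theta (g * h)%g = theta g *m theta h.
  have -> : theta (g * h)%g = map_mx intr (Mx (lift_of q_surj g * lift_of q_surj h)%g).
    by rewrite /theta (Mx_q _ (lift_of q_surj g * lift_of q_surj h)%g)// qM !lift_ofK.
  by rewrite MxM map_mxM.
have thE := small_representation_trivial n3 kn (isT : (2%:R : rat) != 0) theta1 thetaM.
have Mx1 x : Mx x = 1%:M.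
  rewrite (Mx_q x (lift_of q_surj (q x))) ?lift_ofK//; apply/matrixP => i j.
  have := congr1 (fun A : 'M[rat]_k => A i j) (thE (q x)).
  rewrite /theta mxE [RHS]mxE => e; apply: (@intr_inj rat); rewrite e mxE.
  by case: (i == j).
apply: central_extension_splits => //.
- move=> z /kerP[a <-] x; have : act x a = a by rewrite actMx Mx1 mulmx1.
  by move=> /(congr1 phi); rewrite actE => e; rewrite /commute conjgC e.
- move=> z /kerP[a <-]; rewrite -phiD => /esym; have <- : phi 0 = 1%g.
    by apply: (mulgI (phi 0)); rewrite -phiD addr0 mulg1.
  move=> /phi_inj a0; congr phi; apply/rowP => i; rewrite mxE.
  by have := congr1 (fun v : 'rV[int]_k => v 0 i) a0; rewrite !mxE => /esym/eqP; rewrite -mulr2n mulrn_eq0 => /eqP.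
Qed.

Local Open Scope classical_set_scope.
Local Open Scope ring_scope.

(** * Lifting maps through a covering *)

(** Each point has a neighbourhood on which [P] is constant, so [P] and its complement are open.
    This replaces subdivision arguments: uniqueness of lifts, path lifting and continuity in a
    parameter are phrased as locally constant properties. *)
Lemma connected_locally_constant (T : topologicalType) (P : T -> Prop) :
  connected [set: T] ->
  (forall t0 : T, exists2 N, nbhs t0 N & forall s t, N s -> N t -> P s -> P t) ->
  forall a b, P a -> P b.
Proof.
move=> cT loc a b Pa.
have op (Q : T -> Prop) :
    (forall t0 : T, exists2 N, nbhs t0 N & forall s t, N s -> N t -> Q s -> Q t) ->
    open [set t | Q t].
  move=> locQ; rewrite openE => t0 Qt0; rewrite /interior /=.
  have [N Nt0 h] := locQ t0; have N0 := nbhs_singleton Nt0.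
  by apply: filterS Nt0 => t Nt; exact: (h t0 t).
have e : [set t | P t] = [set: T].
  apply: cT; first by exists a.
    by exists [set t | P t]; rewrite ?setTI//; exact: op.
  exists [set t | P t]; rewrite ?setTI// -[X in closed X]setCK.
  apply: open_closedC; apply: op => t0; have [N Nt0 h] := loc t0.
  by exists N => // s t Ns Nt nPs Pt; apply: nPs; exact: (h t s).
have : [set t | P t] b by rewrite e.
by [].
Qed.

(** * Paths parametrized by the whole real line *)

Section real_line.
Variable R : realType.

Lemma real_line_connected : connected [set: R].
Proof. by apply/connected_intervalP => x y _ _ z _. Qed.

(** For a <= b, the retraction onto [a, b]; it turns maps controlled only on an interval into
    continuous maps on the line. *)
Definition clamp (a b x : R) : R := Num.max a (Num.min b x).

Lemma clamp_continuous a b : continuous (clamp a b).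
Proof.
move=> x; apply: continuous_max; first exact: cvg_cst.
by apply: continuous_min; [exact: cvg_cst|exact: cvg_id].
Qed.

Lemma clamp_itv a b x : a <= b -> a <= clamp a b x <= b.
Proof.
move=> ab; rewrite /clamp le_max lexx /= ge_max ab /=.
by rewrite ge_min lexx.
Qed.

Lemma clamp_id a b x : a <= x <= b -> clamp a b x = x.
Proof.
by move=> /andP[ax xb]; rewrite /clamp (min_idPr xb) (max_idPr ax).
Qed.

Lemma clampK a b x : a <= b -> clamp a b (clamp a b x) = clamp a b x.
Proof. by move=> ab; rewrite clamp_id// clamp_itv. Qed.

Lemma clamp_left a b x : a <= b -> x <= a -> clamp a b x = a.
Proof. by move=> ab xa; rewrite /clamp (min_idPr (le_trans xa ab)) (max_idPl xa). Qed.

Lemma glue_continuous (Z : topologicalType) (f g : R -> Z) a :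
  continuous f -> continuous g -> f a = g a ->
  continuous (fun u => if u <= a then f u else g u).
Proof.
move=> cf cg fga u0 V /=; rewrite nbhs_simpl /=.
have [u ->] : exists u : R, u0 = u by exists u0.
rewrite -[X in _ -> X]/(nbhs (u : R) _) => nV.
have FF : Filter (nbhs (u : R)) by exact: nbhs_filter.
have near_f : f u = (if u <= a then f u else g u) -> \forall t \near (u : R), V (f t).
  by move=> e; apply: cf; rewrite e.
have near_g : g u = (if u <= a then f u else g u) -> \forall t \near (u : R), V (g t).
  by move=> e; apply: cg; rewrite e.
have [ua|au|ua] := ltgtP u a.
- have h := near_f; rewrite ltW// in h; have {}h := h erefl.
  have k : \forall t \near u, t < a by apply: open_nbhs_nbhs; split=> //; exact: open_lt.
  by apply: (filterS _ (filterI h k)) => t [Vt ta]; rewrite /= ltW.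
- have h := near_g; rewrite leNgt au /= in h; have {}h := h erefl.
  have k : \forall t \near u, a < t by apply: open_nbhs_nbhs; split=> //; exact: open_gt.
  by apply: (filterS _ (filterI h k)) => t [Vt ta]; rewrite /= leNgt ta.
- subst u; rewrite lexx in near_f near_g.
  apply: (filterS _ (filterI (near_f erefl) (near_g (esym fga)))) => t [? ?] /=.
  by case: ifP.
Qed.

Lemma within_comp_continuous (S T U : topologicalType) (A : set T) (f : T -> U) (c : S -> T) :
  {within A, continuous f} -> continuous c -> (forall s, A (c s)) -> continuous (f \o c).
Proof.
move=> /continuousP cf /continuousP cc Ac; apply/continuousP => W oW.
have /open_subspaceP[V oV VW] := cf _ oW.
suff -> : (f \o c) @^-1` W = c @^-1` V by exact: cc.
apply/seteqP; split=> s /= h.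
  have : ((f @^-1` W) `&` A) (c s) by split.
  by rewrite -VW => -[].
have : (V `&` A) (c s) by split.
by rewrite VW => -[].
Qed.

End real_line.

(** * Unique lifting, path lifting and dependence on a parameter *)

Section lifting.
Variables (R : realType) (X Y : topologicalType) (p : X -> Y).
Hypothesis cov : covering_map p.

(* [s] is the inverse of the restriction of [p] to the sheet [V] over [U]. *)
Definition sheet (U : set Y) (V : set X) (s : Y -> X) :=
  [/\ open V, forall x, V x -> U (p x) /\ s (p x) = x &
    forall y, U y -> [/\ V (s y), p (s y) = y & {for y, continuous s}]].

Lemma covering_sheets y : exists U, [/\ open U, U y & exists S : set (set X),
  [/\ forall x, U (p x) -> exists2 V, S V & V x,
      forall V W, S V -> S W -> V `&` W !=set0 -> V = W &
      forall V, S V -> exists s, sheet U V s]].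
Proof.
have [_ _ /(_ y)[U [oU Uy [S [So Sd Sc Sh]]]]] := cov.
exists U; split=> //; exists S; split=> //.
  move=> x Ux; have : (p @^-1` U) x by [].
  by rewrite -Sc => -[V SV Vx]; exists V.
move=> V SV; have [s [h1 h2]] := (homeo_on_openP p (So V SV) oU).1 (Sh V SV).
exists s; split; first exact: So.
  by move=> x /h1[].
by move=> z /h2[].
Qed.

Lemma lift_unique (T : topologicalType) (f1 f2 : T -> X) a :
  connected [set: T] -> continuous f1 -> continuous f2 ->
  (forall t, p (f1 t) = p (f2 t)) -> f1 a = f2 a -> forall t, f1 t = f2 t.
Proof.
move=> cT c1 c2 pf f12 t.
apply: (@connected_locally_constant T (fun t => f1 t = f2 t) cT _ a) => // t0.
have [U [oU Ut0 [S [Sex Sd Ss]]]] := covering_sheets (p (f1 t0)).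
have [V SV Vf1] := Sex _ Ut0; have [s [oV sV sU]] := Ss V SV.
have Ut0' : U (p (f2 t0)) by rewrite -pf.
have [V' SV' Vf2] := Sex _ Ut0'; have [s' [oV' sV' sU']] := Ss V' SV'.
exists (f1 @^-1` V `&` f2 @^-1` V').
  apply: filterI; [apply: c1|apply: c2]; exact: open_nbhs_nbhs.
move=> t1 t2 [/= V1 V1'] [V2 V2'] e.
have VV : V = V' by apply: Sd => //; exists (f1 t1); split=> //; rewrite e.
subst V'; have [_ <-] := sV _ V2; have [_ <-] := sV _ V2'.
by rewrite pf.
Qed.

(** Being liftable up to [s] is locally constant in [s]: within one evenly covered set a lift is
    continued through a sheet. Since [gam] is constant on negative parameters, a constant map serves
    for [s <= 0]. *)
Lemma path_lift_upto (gam : R -> Y) x0 : continuous gam ->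
  (forall u, u <= 0 -> gam u = gam 0) -> p x0 = gam 0 ->
  forall s, exists g : R -> X, [/\ continuous g, g 0 = x0 & forall u, u <= s -> p (g u) = gam u].
Proof.
move=> cg g0 px0 s.
have P0 s' : s' <= 0 -> exists g : R -> X,
    [/\ continuous g, g 0 = x0 & forall u, u <= s' -> p (g u) = gam u].
  move=> s0; exists (fun=> x0); split=> // [u|u us]; first exact: cvg_cst.
  by rewrite px0 g0// (le_trans us).
pose Q s' := exists g : R -> X,
    [/\ continuous g, g 0 = x0 & forall u, u <= s' -> p (g u) = gam u].
apply: (@connected_locally_constant _ Q (@real_line_connected R) _ 0 s (P0 0 (lexx 0))) => s0.
have [U [oU Us0 [S [Sex Sd Ss]]]] := covering_sheets (gam s0).
have /nbhs_ballP[e /= e0 eU] : nbhs s0 (gam @^-1` U).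
  by apply: cg; exact: open_nbhs_nbhs.
exists (ball s0 e); first exact: nbhsx_ballx.
move=> s1 s2 b1 b2 [g [cgg gx0 pg]].
have [s20|s20] := leP s2 0; first exact: P0.
have [s21|s12] := leP s2 s1.
  by exists g; split=> // u us; apply: pg; exact: le_trans s21.
(* Gluing at a nonnegative parameter keeps the value at 0. *)
pose r := Num.max 0 s1.
have r0 : 0 <= r by rewrite le_max lexx.
have [h [ch hx0 ph]] : exists h : R -> X,
    [/\ continuous h, h 0 = x0 & forall u, u <= r -> p (h u) = gam u].
  rewrite /r; case: (leP 0 s1) => [s10|s10]; last exact: P0.
  by exists g.
have rs2 : r < s2 by rewrite gt_max s20.
have inU u : r <= u <= s2 -> U (gam u).
  move=> /andP[ru us]; apply: eU; move: b1 b2; rewrite /ball /= !ltr_distlC => /andP[h1 h2] /andP[h3 h4].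
  have s1u : s1 <= u by apply: le_trans ru; rewrite le_max lexx orbT.
  by apply/andP; split; lra.
have Ur : U (p (h r)) by rewrite ph//; apply: inU; rewrite lexx ltW.
have [V SV Vr] := Sex _ Ur; have [sg [oV sV sU]] := Ss V SV.
have cl u : r <= clamp r s2 u <= s2 by apply: clamp_itv; exact: ltW.
exists (fun u => if u <= r then h u else sg (gam (clamp r s2 u))); split.
- apply: glue_continuous => //.
    move=> u; apply: continuous_comp; last by have [_ _] := sU _ (inU _ (cl u)).
    apply: continuous_comp; [exact: clamp_continuous|exact: cg].
  rewrite clamp_id ?lexx ?ltW// -ph//.
  by have [_ ->] := sV _ Vr.
- by rewrite r0.
- move=> u us; case: leP => ur; first exact: ph.
  rewrite clamp_id ?(ltW ur)//.
  by have [_ ->] : [/\ V (sg (gam u)), p (sg (gam u)) = gam u & {for (gam u), continuous sg}]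
    by apply: sU; apply: inU; rewrite (ltW ur).
Qed.

Lemma path_lift (gam : R -> Y) x0 : continuous gam -> p x0 = gam 0 ->
  exists g : R -> X, [/\ continuous g, g 0 = x0 & forall u, p (g u) = gam (clamp 0 1 u)].
Proof.
move=> cg px0; pose gam' u := gam (clamp 0 1 u).
have cg' : continuous gam'.
  by move=> u; apply: continuous_comp; [exact: clamp_continuous|exact: cg].
have c0 : clamp 0 1 0 = 0 :> R by rewrite clamp_id// lexx ler01.
have g'0 u : u <= 0 -> gam' u = gam' 0 by move=> u0; rewrite /gam' c0 clamp_left.
have px0' : p x0 = gam' 0 by rewrite /gam' c0.
have [g [cgg gx0 pg]] := path_lift_upto cg' g'0 px0' 1.
exists (g \o clamp 0 1); split=> /= [u| |u].
- by apply: continuous_comp; [exact: clamp_continuous|exact: cgg].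
- by rewrite c0.
- have /andP[_ c1] := @clamp_itv R 0 1 u ler01.
  by rewrite pg// /gam' clampK.
Qed.

(** Continuity of [G s] at [t0] is locally constant in [s]: near a given parameter [H] stays in one
    evenly covered set, and by unique lifting [G] is there [H] followed by the section of one
    sheet. *)
Lemma lift_continuous_parameter (T : topologicalType) (H : R -> T -> Y) (G : R -> T -> X) t0 :
  (forall u, {for (u, t0), continuous (fun z : R * T => H z.1 z.2)}) ->
  (\forall t \near t0, continuous (G^~ t) /\ forall u, p (G u t) = H u t) ->
  {for t0, continuous (G 0)} -> forall s, {for t0, continuous (G s)}.
Proof.
move=> cH nG cG0.
move=> s; pose Q s' := {for t0, continuous (G s')}.
apply: (@connected_locally_constant _ Q (@real_line_connected R) _ 0 s cG0) => s0.
have [cGt0 pGt0] := nbhs_singleton nG.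
have [U [oU Us0 [S [Sex Sd Ss]]]] := covering_sheets (H s0 t0).
have [[A B] /= [As0 Bt0] AB] : nbhs (s0, t0) ((fun z : R * T => H z.1 z.2) @^-1` U).
  by apply: cH; exact: open_nbhs_nbhs.
have /nbhs_ballP[e /= e0 eA] := As0.
exists (ball s0 e); first exact: nbhsx_ballx.
move=> s1 s2 b1 b2 cG1.
pose a := Num.min s1 s2; pose b := Num.max s1 s2.
have ab : a <= b by rewrite /a /b ge_min !le_max lexx.
have s1ab : a <= s1 <= b by rewrite /a /b ge_min le_max lexx.
have s2ab : a <= s2 <= b by rewrite /a /b ge_min le_max lexx !orbT.
have inA u : a <= u <= b -> A u.
  rewrite /a /b ge_min le_max => h; apply: eA.
  move: b1 b2; rewrite /ball /= !ltr_distlC => /andP[h1 h2] /andP[h3 h4].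
  by apply/andP; split; case/andP: h => /orP[? /orP[]|? /orP[]] ?; lra.
have HU t u : B t -> a <= u <= b -> U (H u t).
  by move=> Bt uab; apply: (AB (u, t)); split=> //=; exact: inA.
have Us1 : U (p (G s1 t0)).
  by rewrite pGt0; apply: HU => //; exact: nbhs_singleton.
have [V SV Vs1] := Sex _ Us1; have [sg [oV sV sU]] := Ss V SV.
have nV : \forall t \near t0, V (G s1 t) by apply: cG1; exact: open_nbhs_nbhs.
have nE : \forall t \near t0, sg (H s2 t) = G s2 t.
  apply: (filterS _ (filterI nV (filterI Bt0 nG))) => t [Vt [Bt [cGt pGt]]].
  have cl u : a <= clamp a b u <= b by exact: clamp_itv.
  have := @lift_unique R (fun u => sg (H (clamp a b u) t)) (fun u => G (clamp a b u) t) s1.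
  move=> /(_ _ _ _ _ _ s2); rewrite !clamp_id//; apply.
  - exact: real_line_connected.
  - move=> u; apply: continuous_comp; last first.
      by have [_ _] := sU _ (HU _ _ Bt (cl u)).
    have -> : (fun u => H (clamp a b u) t) = p \o (G^~ t \o clamp a b).
      by apply: funext => v /=; rewrite pGt.
    apply: (@continuous_comp _ _ _ (G^~ t \o clamp a b) p); last by have [cp _ _] := cov; exact: cp.
    by apply: (@continuous_comp _ _ _ (clamp a b) (G^~ t)); [exact: clamp_continuous|exact: cGt].
  - by move=> u; apply: (@continuous_comp _ _ _ (clamp a b) (G^~ t)); [exact: clamp_continuous|exact: cGt].
  - move=> u; rewrite pGt.
    by have [_ -> _] := sU _ (HU _ _ Bt (cl u)).
  - by rewrite -pGt; have [_ ->] := sV _ Vt.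
have Us2 : U (H s2 t0) by apply: HU => //; exact: nbhs_singleton.
have eq0 : sg (H s2 t0) = G s2 t0 := nbhs_singleton nE.
rewrite /Q /prop_for /continuous_at -eq0.
apply: cvg_trans; first exact: (near_eq_cvg nE).
apply: (@continuous_comp _ _ _ (H s2) sg); last by have [_ _] := sU _ Us2.
apply: (@continuous_comp _ _ _ (fun t => (s2, t)) (fun z : R * T => H z.1 z.2)); last exact: cH.
exact: (cvg_pair (cvg_cst s2) cvg_id).
Qed.

End lifting.

(* [lra] fails on hypotheses that are equations in a topological space. *)
Ltac clear_lra := repeat match goal with
  | h : @eq (Topological.sort _) _ _ |- _ => clear h end; lra.

(** * The lifting criterion for a simply connected total space *)

Section map_lifting.
Variables (R : realType) (X Y : topologicalType) (p : X -> Y).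
Hypothesis cov : covering_map p.
Hypothesis scX : simply_connected R X.

Lemma clamp01 (u : R) : `[0, 1]%classic (clamp 0 1 u).
Proof. by rewrite /= in_itv /=; exact: clamp_itv. Qed.

Lemma exists_path (x y : X) : exists g : R -> X, [/\ continuous g, g 0 = x & g 1 = y].
Proof.
have [_ /(_ x y)[g [cg g0 g1]] _] := scX.
exists (g \o clamp 0 1); split=> /=.
- exact: (within_comp_continuous cg (@clamp_continuous R 0 1) clamp01).
- by rewrite clamp_id// lexx ler01.
- by rewrite clamp_id// lexx ler01.
Qed.

Lemma path_cat_continuous (g h : R -> X) : continuous g -> continuous h -> g 1 = h 0 ->
  continuous (fun u : R => if u <= 2^-1 then g (2 * u) else h (2 * u - 1)).
Proof.
move=> cg ch gh; apply: (@glue_continuous R X (fun u : R => g (2 * u)) (fun u : R => h (2 * u - 1))).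
- move=> u; apply: (@continuous_comp _ _ _ (fun u : R => 2 * u) g); last exact: cg.
  by apply: cvgM; [exact: cvg_cst|exact: cvg_id].
- move=> u; apply: (@continuous_comp _ _ _ (fun u : R => 2 * u - 1) h); last exact: ch.
  by apply: cvgB; [apply: cvgM; [exact: cvg_cst|exact: cvg_id]|exact: cvg_cst].
- by rewrite mulfV ?subrr// pnatr_eq0.
Qed.

Section monodromy.
Variables (f : X -> Y) (x0 y0 : X).
Hypothesis cf : continuous f.
Hypothesis py0 : p y0 = f x0.

Definition lifts_path (g L : R -> X) := [/\ continuous g, g 0 = x0, continuous L, L 0 = y0 &
  forall u, 0 <= u <= 1 -> p (L u) = f (g u)].

Lemma exists_lifts_path g : continuous g -> g 0 = x0 -> exists L, lifts_path g L.
Proof.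
move=> cg g0; have cfg : continuous (f \o g).
  by move=> u; apply: continuous_comp; [exact: cg|exact: cf].
have e : p y0 = (f \o g) 0 by rewrite /= g0.
have [L [cL L0 pL]] := path_lift cov cfg e.
by exists L; split=> // u u01; rewrite pL clamp_id.
Qed.

(* The lifts of the stages of a null homotopy end in the discrete fibre over the
   base point, so their end point does not move. *)
Lemma loop_lift_closed (g : R -> X) : continuous g -> g 0 = x0 -> g 1 = x0 ->
  exists K, lifts_path g K /\ K 1 = y0.
Proof.
move=> cg g0 g1.
have [_ _ /(_ g)] := scX; rewrite g0 g1 => /(_ (continuous_subspaceT cg) erefl).
case=> H [cH Hs0 Hs1 Ht].
pose c2 (z : R * R) : R * R := (clamp 0 1 z.1, clamp 0 1 z.2).
have cc2 : continuous c2.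
  move=> z.
  have h1 : {for z, continuous (fun z : R * R => clamp 0 1 z.1)}.
    by apply: (@continuous_comp _ _ _ fst (clamp 0 1)); [exact: cvg_fst|exact: clamp_continuous].
  have h2 : {for z, continuous (fun z : R * R => clamp 0 1 z.2)}.
    by apply: (@continuous_comp _ _ _ snd (clamp 0 1)); [exact: cvg_snd|exact: clamp_continuous].
  exact: (cvg_pair h1 h2).
have cHc : continuous (H \o c2).
  by apply: (within_comp_continuous cH cc2) => z; split; exact: clamp01.
have c0 : clamp 0 1 0 = 0 :> R by rewrite clamp_id// lexx ler01.
have c1 : clamp 0 1 1 = 1 :> R by rewrite clamp_id// lexx ler01.
have cl (u : R) : clamp 0 1 u \in `[0, 1] by rewrite in_itv /=; exact: clamp_itv.
pose gam t u := f (H (c2 (u, t))).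
have cgam t : continuous (gam t).
  move=> u; apply: (@continuous_comp _ _ _ (H \o c2 \o (fun u => (u, t))) f); last exact: cf.
  apply: (@continuous_comp _ _ _ (fun u => (u, t)) (H \o c2)); last exact: cHc.
  exact: (cvg_pair cvg_id (cvg_cst t)).
have gam0 t : p y0 = gam t 0.
  by rewrite py0 /gam /c2 /= c0; have [-> _] := Ht _ (cl t); rewrite g0.
pose G u t := sval (cid (path_lift cov (cgam t) (gam0 t))) u.
have GP t : [/\ continuous (G^~ t), G 0 t = y0 & forall u, p (G u t) = gam t (clamp 0 1 u)].
  by rewrite /G; case: cid.
have gamc t u : gam t (clamp 0 1 u) = gam t u by rewrite /gam /c2 /= clampK// ler01.
have cG1 : continuous (G 1).
  move=> t0; have near_all (Q : R -> Prop) : (forall t, Q t) -> \forall t \near (t0 : R), Q t.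
    by move=> h; apply: (@filterE _ _ (nbhs_filter (t0 : R))).
  apply: (@lift_continuous_parameter R X Y p cov R (fun u t => gam t u) G t0).
  - move=> u; have h : {for (u, t0), continuous (f \o (H \o c2))}.
      by apply: continuous_comp; [exact: cHc|exact: cf].
    exact: h.
  - apply: near_all => t; have [cGt _ pG] := GP t; split=> // u.
    by rewrite pG gamc.
  - apply: near_cst_continuous; apply: near_all => t; have [_ -> _] := GP t; reflexivity.
have pG1 t : p (G 1 t) = p y0.
  have [_ _ ->] := GP t; rewrite gamc /gam /c2 /= c1 py0.
  by have [_ ->] := Ht _ (cl t); rewrite g0.
have G11 : G 1 1 = y0.
  have [cG G0 pG] := GP 1; suff h t : G t 1 = y0 by [].
  move: t; apply: (@lift_unique X Y p cov _ (G^~ 1) (fun=> y0) 0 (@real_line_connected R) cG).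
  - by move=> u; exact: cvg_cst.
  - by move=> u; rewrite pG gamc /gam /c2 /= c1 Hs1// g0.
  - exact: G0.
have G10 : G 1 0 = y0.
  rewrite -G11; suff h t : G 1 t = G 1 1 by [].
  move: t; apply: (@lift_unique X Y p cov _ (G 1) (fun=> G 1 1) 1 (@real_line_connected R) cG1) => //.
  - by move=> u; exact: cvg_cst.
  - by move=> u; rewrite !pG1.
exists (G^~ 0); split=> //; have [cG G0 pG] := GP 0; split=> // u u01.
by rewrite pG gamc /gam /c2 /= c0 clamp_id// Hs0// in_itv.
Qed.

(** The first path followed by the reverse of the second is a loop; by unique lifting its closed
    lift runs along [L1] and then backwards along [L2], so both end points are its midpoint. *)
Lemma lifts_path_end g1 L1 g2 L2 : lifts_path g1 L1 -> lifts_path g2 L2 ->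
  g1 1 = g2 1 -> L1 1 = L2 1.
Proof.
move=> [cg1 g10 cL1 L10 pL1] [cg2 g20 cL2 L20 pL2] e.
pose h (u : R) := g2 (1 - u).
have ch : continuous h.
  move=> u; apply: (@continuous_comp _ _ _ (fun u : R => 1 - u) g2); last exact: cg2.
  by apply: cvgB; [exact: cvg_cst|exact: cvg_id].
pose g u := if u <= 2^-1 then g1 (2 * u) else h (2 * u - 1).
have cg : continuous g by apply: path_cat_continuous; rewrite // /h subr0.
have half : 0 <= (2^-1 : R) <= 1 by apply/andP; split; clear_lra.
have t0 : (0 : R) <= 2^-1 by clear_lra.
have t1 : ((1 : R) <= 2^-1) = false by apply/negP => ?; clear_lra.
have g0 : g 0 = x0 by rewrite /g t0 mulr0.
have gg1 : g 1 = x0.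
  rewrite /g t1.
  by rewrite /h (_ : 1 - (2 * 1 - 1) = 0 :> R)//; clear_lra.
have [K [[_ _ cK K0 pK] K1]] := loop_lift_closed cg g0 gg1.
have cl (u : R) := @clamp_itv R 0 1 u ler01.
have c0 : clamp 0 1 0 = 0 :> R by rewrite clamp_id// lexx ler01.
have c1 : clamp 0 1 1 = 1 :> R by rewrite clamp_id// lexx ler01.
have cc (L : R -> X) : continuous L -> continuous (L \o clamp 0 1).
  by move=> cL u; apply: continuous_comp; [exact: clamp_continuous|exact: cL].
have -> : L1 1 = K 2^-1.
  have -> : L1 1 = (L1 \o clamp 0 1) 1 by rewrite /= c1.
  have -> : K 2^-1 = (K \o (fun u => 2^-1 * u) \o clamp 0 1) 1 by rewrite /= c1 mulr1.
  apply: (@lift_unique X Y p cov _ _ _ 0 (@real_line_connected R)); first exact: cc.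
  - apply: cc => u; apply: (@continuous_comp _ _ _ (fun u : R => 2^-1 * u) K); last exact: cK.
    by apply: cvgM; [exact: cvg_cst|exact: cvg_id].
  - move=> u /=; have /andP[u0 u1] := cl u.
    rewrite pL1 ?u0// pK; last by apply/andP; split; clear_lra.
    by rewrite /g ifT; [rewrite mulrA mulfV ?mul1r// pnatr_eq0|clear_lra].
  - by rewrite /= c0 mulr0 L10 K0.
have -> : L2 1 = (L2 \o clamp 0 1) 1 by rewrite /= c1.
have -> : K 2^-1 = (K \o (fun u => 1 - 2^-1 * u) \o clamp 0 1) 1.
  by rewrite /= c1 mulr1; congr K; clear_lra.
apply: (@lift_unique X Y p cov _ _ _ 0 (@real_line_connected R)); last 1 first.
- by rewrite /= c0 mulr0 subr0 K1 L20.
- apply: cc => u; apply: (@continuous_comp _ _ _ (fun u : R => 1 - 2^-1 * u) K); last exact: cK.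
  by apply: cvgB; [exact: cvg_cst|apply: cvgM; [exact: cvg_cst|exact: cvg_id]].
- exact: cc.
- move=> u /=; have /andP[u0 u1] := cl u.
  rewrite pL2 ?u0// pK; last by apply/andP; split; clear_lra.
  congr f; rewrite /g; case: leP => [le|_].
    have -> : clamp 0 1 u = 1 by clear_lra.
    by rewrite (_ : 2 * (1 - 2^-1 * 1) = 1); [exact: e|clear_lra].
  by rewrite /h; congr g2; clear_lra.
Qed.

(** Paths [c^~ x'] from [x] to each nearby [x'], with joint continuity at the points (u, x): the
    form in which continuity of a lift at [x] is derived. *)
Definition locally_contractible := forall x : X, exists c : R -> X -> X,
  (\forall x' \near x, [/\ c 0 x' = x, c 1 x' = x' & continuous (c^~ x')]) /\
  forall u, {for (u, x), continuous (fun z : R * X => c z.1 z.2)}.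

(** The lift sends a point to the end of a lifted path from [x0]. Near [x] such a path is prolonged
    by [c^~ x'], and the end of the lifted prolongation is continuous in [x'] at [x]. *)
Lemma map_lift : locally_contractible -> exists F : X -> X,
  [/\ continuous F, forall x, p (F x) = f x & F x0 = y0].
Proof.
move=> loc.
have ex x : exists gL : (R -> X) * (R -> X), lifts_path gL.1 gL.2 /\ gL.1 1 = x.
  have [g [cg g0 g1]] := exists_path x0 x.
  by have [L gL] := exists_lifts_path cg g0; exists (g, L).
pose F x := (sval (cid (ex x))).2 1.
have FE g L : lifts_path g L -> L 1 = F (g 1).
  move=> gL; rewrite /F; case: cid => -[g' L'] /= [gL' e].
  exact: (lifts_path_end gL gL' (esym e)).
have Fex x : exists g L, [/\ lifts_path g L, g 1 = x & L 1 = F x].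
  by have [[g L] /= [gL g1]] := ex x; exists g, L; split=> //; rewrite (FE g)// g1.
have pF x : p (F x) = f x.
  have [g [L [[_ _ _ _ pL] <- <-]]] := Fex x.
  by rewrite pL// ler01 lexx.
have Fx0 : F x0 = y0.
  have h : lifts_path (fun=> x0) (fun=> y0).
    by split=> // [u|u]; exact: cvg_cst.
  by rewrite -(FE _ _ h).
exists F; split=> // x.
have [c [cnear ccont]] := loc x.
pose good x' := [/\ c 0 x' = x, c 1 x' = x' & continuous (c^~ x')].
(* The constant value is a placeholder for points [x'] too far from [x]. *)
have exG x' : exists G : R -> X, good x' ->
    [/\ continuous G, G 0 = F x & forall u, p (G u) = f (c (clamp 0 1 u) x')].
  have [[cx0 cx1 cc]|ng] := pselect (good x'); last by exists (fun=> x).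
  have cfc : continuous (f \o c^~ x').
    by move=> u; apply: continuous_comp; [exact: cc|exact: cf].
  have e : p (F x) = (f \o c^~ x') 0 by rewrite /= cx0 pF.
  by have [G GP] := path_lift cov cfc e; exists G.
pose G u x' := sval (cid (exG x')) u.
have GP x' : good x' -> [/\ continuous (G^~ x'), G 0 x' = F x &
    forall u, p (G u x') = f (c (clamp 0 1 u) x')].
  by rewrite /G; case: cid.
have c1 : clamp 0 1 1 = 1 :> R by rewrite clamp_id// lexx ler01.
have t0 : (0 : R) <= 2^-1 by clear_lra.
have t1 : ((1 : R) <= 2^-1) = false by apply/negP => ?; clear_lra.
have cG : {for x, continuous (G 1)}.
  apply: (@lift_continuous_parameter R X Y p cov X (fun u x' => f (c (clamp 0 1 u) x')) G x).
  - move=> u; apply: (@continuous_comp _ _ _ (fun z : R * X => c (clamp 0 1 z.1) z.2) f); last exact: cf.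
    apply: (@continuous_comp _ _ _ (fun z : R * X => (clamp 0 1 z.1, z.2)) (fun z => c z.1 z.2)); last exact: ccont.
    have h1 : {for (u, x), continuous (fun z : R * X => clamp 0 1 z.1)}.
      by apply: (@continuous_comp _ _ _ fst (clamp 0 1)); [exact: cvg_fst|exact: clamp_continuous].
    exact: (cvg_pair h1 cvg_snd).
  - by apply: filterS cnear => x' /GP[].
  - apply: near_cst_continuous; apply: filterS cnear => x' /GP[_ + _]; exact.
have FG : \forall x' \near x, G 1 x' = F x'.
  apply: filterS cnear => x' gx'; have [cGx G0 pG] := GP _ gx'; have [cx0 cx1 cc] := gx'.
  have [g [L [[cg g0 cL L0 pL] g1 L1]]] := Fex x.
  have gL : lifts_path (fun u : R => if u <= 2^-1 then g (2 * u) else c (2 * u - 1) x')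
      (fun u : R => if u <= 2^-1 then L (2 * u) else G (2 * u - 1) x').
    split.
    - by apply: (@path_cat_continuous g (c^~ x')) => //; rewrite g1 cx0.
    - by rewrite t0 mulr0.
    - by apply: (@path_cat_continuous L (G^~ x')) => //; rewrite L1 G0.
    - by rewrite t0 mulr0.
    - move=> u /andP[u0 u1]; case: leP => u2.
        by rewrite pL//; apply/andP; split; clear_lra.
      by rewrite pG clamp_id//; apply/andP; split; clear_lra.
  have := FE _ _ gL; rewrite t1.
  by rewrite (_ : 2 * 1 - 1 = 1 :> R); [rewrite cx1|clear_lra].
have e : G 1 x = F x := nbhs_singleton FG.
rewrite /continuous_at -e; apply: cvg_trans; last exact: cG.
exact: (near_eq_cvg FG).
Qed.

End monodromy.
End map_lifting.

(** * The group of lifts *)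

Lemma atlas_locally_contractible (R : realType) m C (M : topologicalType)
    (A : set (chart R m M)) : is_atlas C A -> locally_contractible R M.
Proof.
move=> [Ac Acov _] x; have [[U phi] /= Ac' Ux] := Acov x.
have [/= oU oW hU] := Ac _ Ac'.
have [g [h1 h2]] := (homeo_on_openP _ oU oW).1 hU.
have Wx : (phi @` U) (phi x) by exists x.
have /nbhs_ballP[e /= e0 eW] : nbhs (phi x) (phi @` U) by exact: open_nbhs_nbhs.
(* Segments in the chart: balls are convex, so for [x'] near [x] the clamped parameter keeps them in
   the image of the chart for every real [u]. *)
pose line (u : R) x' := phi x + clamp 0 1 u *: (phi x' - phi x).
have c0 : clamp 0 1 0 = 0 :> R by rewrite clamp_id// lexx ler01.
have c1 : clamp 0 1 1 = 1 :> R by rewrite clamp_id// lexx ler01.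
exists (fun u x' => g (line u x')); split.
  have nU : \forall x' \near x, U x' by exact: open_nbhs_nbhs.
  have nB : \forall x' \near x, ball (phi x) e (phi x').
    by have [_ _ cphi] := h1 _ Ux; apply: cphi; exact: nbhsx_ballx.
  apply: (filterS _ (filterI nU nB)) => x' [Ux' Bx']; split.
  - by rewrite /line c0 scale0r addr0; have [_ ->] := h1 _ Ux.
  - by rewrite /line c1 scale1r addrC subrK; have [_ ->] := h1 _ Ux'.
  - move=> u; apply: (@continuous_comp _ _ _ (line^~ x') g); last first.
      have Wu : (phi @` U) (line u x').
        apply: eW; move: Bx'; rewrite -ball_normE /ball_ /= /line opprD addrA subrr sub0r normrN.
        rewrite distrC normrZ => lt; apply: le_lt_trans lt.
        have /andP[cu0 cu1] := @clamp_itv R 0 1 u ler01.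
        by rewrite ger0_norm// ler_piMl.
      by have [_ _] := h2 _ Wu.
    apply: cvgD; first exact: cvg_cst.
    by apply: cvgZ; [exact: clamp_continuous|exact: cvg_cst].
move=> u; apply: (@continuous_comp _ _ _ (fun z => line z.1 z.2) g); last first.
  have e1 : line u x = phi x by rewrite /line subrr scaler0 addr0.
  by rewrite /= e1; have [_ _] := h2 _ Wx.
apply: cvgD; first exact: cvg_cst.
apply: cvgZ.
  by apply: (@continuous_comp _ _ _ fst (clamp 0 1)); [exact: cvg_fst|exact: clamp_continuous].
apply: cvgB; last exact: cvg_cst.
apply: (@continuous_comp _ _ _ snd phi); first exact: cvg_snd.
by have [_ _] := h1 _ Ux.
Qed.

(** In lifted charts [F] has the coordinate expression of [f] in the charts below, so the same [t]
    serves. *)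
Lemma lift_morphism (R : realType) m C (M' M : topologicalType) (p : M' -> M)
    (A : set (chart R m M)) (f : M -> M) (F : M' -> M') :
  morphism_of_class C A A f -> continuous F -> (forall x, p (F x) = f (p x)) ->
  morphism_of_class C (lifted_atlas p A) (lifted_atlas p A) F.
Proof.
move=> [_ fA] cF pF; split=> // -[V phi] [W psi] [/= oV opV hV [c [Ac cV ->]]].
move=> [/= oW opW hW [d [Ad dW ->]]].
have [t [rt ht]] := fA _ _ Ac Ad; exists t; split=> /=.
  apply: regular_onW rt => _ [x [Vx Wx] <-] /=; exists (p x) => //; split=> /=.
    by apply: cV; exists x.
  by rewrite -pF; apply: dW; exists (F x).
move=> x [Vx Wx] /=; rewrite ht ?pF//; split=> /=.
  by apply: cV; exists x.
by rewrite -pF; apply: dW; exists (F x).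
Qed.

Section lifted_group.
Variables (n : nat) (M' M : topologicalType) (p : M' -> M) (rho : SLZ n -> M -> M).
Hypothesis rhoA : group_action rho.

(* The inverse homeomorphism is carried along so that inversion needs no choice. *)
Definition is_lift (x : SLZ n * ((M' -> M') * (M' -> M'))) : bool :=
  `[< [/\ cancel x.2.1 x.2.2, cancel x.2.2 x.2.1, continuous x.2.1,
          continuous x.2.2 & forall z, p (x.2.1 z) = rho x.1 (p z)] >].

Definition lifted := {x | is_lift x}.

Lemma lifted_one_subproof : is_lift (1%g, (idfun, idfun)).
Proof.
apply/asboolP; split=> //= [x|x|z]; [exact: cvg_id|exact: cvg_id|].
by rewrite rhoA.1.
Qed.

Lemma lifted_mul_subproof (x y : lifted) :
  is_lift ((val x).1 * (val y).1, ((val x).2.1 \o (val y).2.1, (val y).2.2 \o (val x).2.2))%g.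
Proof.
case: x => -[g [F F']] /= /asboolP[/= FK F'K cF cF' pF].
case: y => -[h [G G']] /= /asboolP[/= GK G'K cG cG' pG].
apply/asboolP; split=> /=.
- by move=> z /=; rewrite FK GK.
- by move=> z /=; rewrite G'K F'K.
- by move=> z; apply: continuous_comp; [exact: cG|exact: cF].
- by move=> z; apply: continuous_comp; [exact: cF'|exact: cG'].
- by move=> z /=; rewrite pF pG rhoA.2.
Qed.

Lemma lifted_inv_subproof (x : lifted) :
  is_lift ((val x).1^-1, ((val x).2.2, (val x).2.1))%g.
Proof.
case: x => -[g [F F']] /= /asboolP[/= FK F'K cF cF' pF].
apply/asboolP; split=> //= z.
by rewrite -{2}(F'K z) pF -rhoA.2 mulVg rhoA.1.
Qed.

Definition lifted_one : lifted := Sub _ lifted_one_subproof.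
Definition lifted_mul x y : lifted := Sub _ (lifted_mul_subproof x y).
Definition lifted_inv x : lifted := Sub _ (lifted_inv_subproof x).

Lemma lifted_mulA : associative lifted_mul.
Proof. by move=> x y z; apply: val_inj; rewrite /= mulgA. Qed.

Lemma lifted_mul1 : left_id lifted_one lifted_mul.
Proof. by case=> -[g [F F']] h; apply: val_inj; rewrite /= mul1g. Qed.

Lemma lifted_mulr1 : right_id lifted_one lifted_mul.
Proof. by case=> -[g [F F']] h; apply: val_inj; rewrite /= mulg1. Qed.

Lemma lifted_mulV : left_inverse lifted_one lifted_inv lifted_mul.
Proof.
case=> -[g [F F']] h; have /asboolP[/= FK F'K _ _ _] := h; apply: val_inj.
by rewrite /= mulVg; congr (_, (_, _)); apply: funext => z /=; rewrite FK.
Qed.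

Lemma lifted_mulrV : right_inverse lifted_one lifted_inv lifted_mul.
Proof.
case=> -[g [F F']] h; have /asboolP[/= FK F'K _ _ _] := h; apply: val_inj.
by rewrite /= mulgV; congr (_, (_, _)); apply: funext => z /=; rewrite F'K.
Qed.

HB.instance Definition _ := gen_eqMixin lifted.
HB.instance Definition _ := gen_choiceMixin lifted.

Definition lifted_group : groupType := HB.pack lifted
  (isGroup.Build lifted lifted_mulA lifted_mul1 lifted_mulr1 lifted_mulV lifted_mulrV).

End lifted_group.

Theorem theorem1p4 (R : realType) (C : category) (m n k : nat)
    (M' M : topologicalType) (A : set (chart R m M)) (p : M' -> M) :
  (3 <= n)%N ->
  is_manifold C A -> connected [set: M] ->
  is_manifold C (lifted_atlas p A) -> connected [set: M'] ->
  universal_covering R p -> deck_group_is_Zk p k ->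
  (forall rho : SLZ n -> M' -> M',
     action_by_automorphisms C (lifted_atlas p A) rho -> trivial_action rho) ->
  (k <= n - 1)%N ->
  forall rho : SLZ n -> M -> M,
    action_by_automorphisms C A rho -> trivial_action rho.
Proof.
move=> n3 _ _ [_ _ atlas'] cM' [cov scM'] [d [d_inj d_range dD]] noact kn rho [rhoA rhoaut].
have [cp sp _] := cov.
have crho g : continuous (rho g) by have [? [_ _ []]] := rhoaut g.
have loc := atlas_locally_contractible atlas'.
have [[x0 _] _ _] := scM'.
have deckP a : homeomorphism (d a) /\ p \o d a = p.
  have : range d (d a) by exists a.
  by rewrite d_range.
have d0 : d 0 = idfun.
  have [[g [dK _ _ _]] _] := deckP 0; apply: funext => x /=.
  by apply: (can_inj dK); rewrite -[RHS]/(d 0 x) -[in RHS](addr0 0) dD.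
have dN a x : d a (d (- a) x) = x.
  by rewrite -[LHS]/((d a \o d (- a)) x) -dD subrr d0.
have dNr a x : d (- a) (d a x) = x.
  by rewrite -[LHS]/((d (- a) \o d a) x) -dD addNr d0.
have cd a : continuous (d a) by have [[? [_ _ ? _]] _] := deckP a.
have pd a x : p (d a x) = p x by have [_ /(congr1 (fun f => f x))] := deckP a.
have phi_sub a : is_lift p rho (1%g, (d a, d (- a))).
  apply/asboolP; split=> /=; [exact: dNr|exact: dN|exact: cd|exact: cd|].
  by move=> x; rewrite pd rhoA.1.
pose E := lifted_group p rhoA.
pose phi a : E := (Sub _ (phi_sub a) : lifted p rho).
pose q (x : E) : SLZ n := (val (x : lifted p rho)).1.
have qM (x y : E) : q (x * y)%g = (q x * q y)%g by [].
(* Lifts of [rho g] and of its inverse with exchanged base points are mutually inverse: both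
   composites lift the identity and fix a point. *)
have q_surj g : exists x : E, q x = g.
  have [y0 _ py0] : range p (rho g (p x0)) by rewrite sp.
  have lift h y z : p z = rho h (p y) -> exists F : M' -> M',
      [/\ continuous F, forall x, p (F x) = rho h (p x) & F y = z].
    move=> pz; apply: (map_lift cov scM' _ pz loc).
    by move=> x; apply: (@continuous_comp _ _ _ p (rho h)); [exact: cp|exact: crho].
  have [F [cF pF Fx]] := lift g x0 y0 py0.
  have [F' [cF' pF' F'y]] : exists F : M' -> M',
      [/\ continuous F, forall x, p (F x) = rho g^-1%g (p x) & F y0 = x0].
    by apply: lift; rewrite py0 -rhoA.2 mulVg rhoA.1.
  have FK x : F' (F x) = x.
    apply: (@lift_unique M' M p cov M' (F' \o F) idfun x0 cM').
    - by move=> z; apply: continuous_comp; [exact: cF|exact: cF'].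
    - by move=> z; exact: cvg_id.
    - by move=> z /=; rewrite pF' pF -rhoA.2 mulVg rhoA.1.
    - by rewrite /= Fx.
  have F'K x : F (F' x) = x.
    apply: (@lift_unique M' M p cov M' (F \o F') idfun y0 cM').
    - by move=> z; apply: continuous_comp; [exact: cF'|exact: cF].
    - by move=> z; exact: cvg_id.
    - by move=> z /=; rewrite pF pF' -rhoA.2 mulgV rhoA.1.
    - by rewrite /= F'y.
  have h : is_lift p rho (g, (F, F')) by apply/asboolP; split.
  by exists (Sub _ h : lifted p rho).
have phi_inj : injective phi.
  by move=> a b /(congr1 (fun x : lifted p rho => (val x).2.1)) /= /d_inj.
have phiD a b : phi (a + b) = (phi a * phi b)%g.
  by apply: val_inj => /=; rewrite mulg1 dD opprD addrC dD.
(* An invertible lift of the identity is a deck transformation, and it determines the inverse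
   carried along. *)
have kerP (z : E) : q z = 1%g <-> exists a, phi a = z.
  split=> [|[a <-]//].
  case: z => -[g [F F']] h /= g1; rewrite /q /= in g1; subst g.
  have /asboolP[/= FK F'K cF cF' pF] := h.
  have : deck_transformation p F.
    split; first by exists F'.
    by apply: funext => x /=; rewrite pF rhoA.1.
  rewrite -d_range => -[a _ dF]; exists a; apply: val_inj => /=.
  congr (_, (_, _)) => //; apply: funext => x.
  by rewrite -{1}(F'K x) -dF dNr.
have kn' : (k < n)%N by rewrite (leq_ltn_trans kn)// subn1 prednK// (leq_trans _ n3).
have [s [sM sK]] := free_abelian_extension_splits n3 kn' qM q_surj phi_inj phiD kerP.
pose rho' g : M' -> M' := (val (s g : lifted p rho)).2.1.
have rho'P g : [/\ cancel (rho' g) (val (s g : lifted p rho)).2.2,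
    cancel (val (s g : lifted p rho)).2.2 (rho' g), continuous (rho' g),
    continuous (val (s g : lifted p rho)).2.2 & forall z, p (rho' g z) = rho g (p z)].
  have /asboolP[h1 h2 h3 h4 h5] := valP (s g : lifted p rho).
  split=> // z; rewrite /rho' h5; congr (rho _ _); exact: sK.
have rho'M g h x : rho' (g * h)%g x = rho' g (rho' h x) by rewrite /rho' sM.
have rho'1 x : rho' 1%g x = x.
  have [K _ _ _ _] := rho'P 1%g.
  by apply: (can_inj K); rewrite -rho'M mulg1.
have := noact rho' _; have H : action_by_automorphisms C (lifted_atlas p A) rho'.
  split; first by split.
  move=> g; exists (rho' g^-1%g); split.
  - by move=> x; rewrite -rho'M mulVg rho'1.
  - by move=> x; rewrite -rho'M mulgV rho'1.
  - have [_ _ cF _ pF] := rho'P g; apply: lift_morphism cF pF.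
    by have [? []] := rhoaut g.
  - have [_ _ cF _ pF] := rho'P g^-1%g; apply: lift_morphism cF pF.
    by have [? []] := rhoaut g^-1%g.
move=> /(_ H) triv g y.
have [x _ <-] : range p y by rewrite sp.
by have [_ _ _ _ <-] := rho'P g; rewrite triv.
Qed.
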